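(* Let $(Z_n)_{n\ge 0}$ be a supercritical branching process with immigration in an i.i.d. random environment (as described in the context), with $0<m_1<\infty$ a.s., $\mu:=\mathbb{E}\log m_1\in(0,\infty)$ and $\mathbb{P}(h(\{0\})<1)>0$. Assume that (A) $\mathbb{P}\big(h(\{0\})>0,\ f(\{0\})>0,\ f(\{1\})>0\big)>0$; (B) there exists $\delta\in(0,1)$ such that $f(\{0\})<\delta$ a.s.; (C) there are $q>1$ and $p\in(1,2]$ such that $$\mathbb{E}\Big[(1+|\log m_1|^q)\Big(\Big(\frac{N_{1,1}}{m_1}\Big)^p+1\Big)\Big]<\infty\quad\text{and}\quad \mathbb{E}[Y_1^p]<\infty .$$ Assume moreover that $\mathbb{E}(\log m_1)^2<\infty$ and $\sigma>0$, where $\sigma\ge0$ and $\sigma^2:=\mathrm{Var}(\log m_1)$. Then for all integers $k\ge1$ and all $x\in\mathbb{R}$, $$\lim_{n\to\infty}\mathbb{P}_k\Big(\frac{\log Z_n-n\mu}{\sqrt n\,\sigma}\le x\ \Big|\ Z_n>0\Big)=\Phi(x),\qquad \Phi(x):=\frac1{\sqrt{2\pi}}\int_{-\infty}^x e^{-y^2/2}\,dy .$$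
   Context: $\mathbb{N}=\{0,1,2,\dots\}$. Let $\Delta$ be the space of pairs of probability measures on $\mathbb{N}$, with the component-wise total variation metric. Let $\mathbf Q=(f,h)$ be a random element of $\Delta$ and let $\mathbf Q_n=(f_n,h_n)$, $n\ge1$, be independent copies of $\mathbf Q$ (independence of $f_n$ and $h_n$ for fixed $n$ is not assumed). The sequence $\xi=(\mathbf Q_1,\mathbf Q_2,\dots)$ is the random environment. The branching process with immigration in the random environment $\xi$ is the $\mathbb{N}$-valued process $(Z_n)$ with $Z_0=k\in\mathbb{N}\setminus\{0\}$ which, given $\xi$, is a Markov chain satisfying $Z_n=\sum_{i=1}^{Z_{n-1}}N_{n,i}+Y_n$ for $n\ge1$, where given $\xi$ all the variables $N_{n,i},Y_n$ are independent (and independent of the past), the $N_{n,i}$, $i\ge1$, have law $f_n$ (offspring) and $Y_n$ has law $h_n$ (immigrants). $\mathbb{P}$ is the annealed probability (averaged over $\xi$), $\mathbb{E}$ its expectation; $\mathbb{P}_k(\cdot)=\mathbb{P}(\cdot\mid Z_0=k)$. $m_n=\sum_{j\ge0} j f_n(\{j\})$ is the mean of $f_n$. *)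

(* Defs.v *)
From HB Require Import structures.
From mathcomp Require Import all_boot all_order all_algebra finmap.
From mathcomp Require Import all_classical all_reals all_analysis. 
From mathcomp Require Import measurable_realfun.

Set Implicit Arguments.
Unset Strict Implicit.
Unset Printing Implicit Defensive.

Import Order.TTheory GRing.Theory Num.Theory.
Import numFieldNormedType.Exports.

Local Open Scope classical_set_scope.
Local Open Scope ring_scope.

(* Pairs (offspring law, immigration law). The sigma-algebra is the product of
   those generated by the evaluations of measures at sets; since nat is
   countable, this is the Borel sigma-algebra of the component-wise total
   variation metric. *)
Notation Delta R := (pprobability nat R * pprobability nat R)%type.

Section independence.
Local Open Scope ereal_scope.
Context d d' (T : measurableType d) (E : measurableType d') (R : realType).
Variable P : probability T R.

Definition mutually_independent (X : nat -> {RV P >-> E}) : Prop :=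
  forall (J : {fset nat}) (A : nat -> set E), (forall i, measurable (A i)) ->
    P (\bigcap_(i in [set` J]) X i @^-1` A i) =
    \prod_(i <- J) P (X i @^-1` A i).

Definition identically_distributed (X : nat -> {RV P >-> E}) : Prop :=
  forall (n : nat) (A : set E), measurable A ->
    distribution P (X n) A = distribution P (X 0%N) A.

Definition iid (X : nat -> {RV P >-> E}) : Prop :=
  mutually_independent X /\ identically_distributed X.

(* The sigma-algebra generated by a sequence of random variables is
   <<s generators X >>. *)
Definition generators (X : nat -> {RV P >-> E}) : set (set T) :=
  \bigcup_n preimage_set_system setT (X n) measurable.

(* [g] is a version of the conditional probability of [A] given <<s G >>. *)
Definition is_cond_prob (G : set (set T)) (A : set T) (g : T -> \bar R) : Prop :=
  measurable_fun [set: g_sigma_algebraType G] g /\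
  forall B : set T, <<s G >> B -> P (A `&` B) = \int[P]_(w in B) g w.

(* Elementary conditional probability P(A | B); it is 0 when P B = 0. *)
Definition cprob (A B : set T) : R := (fine (P (A `&` B)) / fine (P B))%R.

End independence.

Section BPIRE.
Context d (T : measurableType d) (R : realType) (P : probability T R).

(* Generations are numbered from 0: the environment Q n, the offspring numbers
   N n i (i >= 0) and the immigration Y n produce generation n.+1. *)
Variables (Q : nat -> {RV P >-> Delta R}).
Variables (N : nat -> nat -> {RV P >-> nat}) (Y : nat -> {RV P >-> nat}).

Definition offspring (n : nat) (w : T) : probability nat R := (Q n w).1.
Definition immigration (n : nat) (w : T) : probability nat R := (Q n w).2.

(* Given the environment, all the N n i and Y n are independent, N n i has law
   offspring n and Y n has law immigration n: the product formula for the
   conditional probability of every finite family of events. *)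
Definition quenched_independent : Prop :=
  forall (J : {fset nat * nat}) (K : {fset nat})
         (A : nat -> nat -> set nat) (B : nat -> set nat),
    is_cond_prob P (generators Q)
      ((\bigcap_(j in [set` J]) N j.1 j.2 @^-1` A j.1 j.2) `&`
       (\bigcap_(n in [set` K]) Y n @^-1` B n))
      (fun w => ((\prod_(j <- J) offspring j.1 w (A j.1 j.2)) *
                 (\prod_(n <- K) immigration n w (B n)))%E).

Record bpire_data : Prop := BPIREData {
  environment_iid : iid Q ;
  particles_quenched : quenched_independent }.

(* The process started from Z_0 = k. *)
Fixpoint Z (k n : nat) (w : T) : nat :=
  if n is n'.+1 then (\sum_(i < Z k n' w) N n' i w + Y n' w)%N else k.

Definition law_mean (f : probability nat R) : \bar R :=
  (\sum_(0 <= j <oo) j%:R%:E * f [set j])%E.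

(* The mean m_1 of the first offspring law; real-valued, hence meaningful
   where [law_mean (offspring 0 w)] is finite. *)
Definition m1 (w : T) : R := fine (law_mean (offspring 0 w)).

End BPIRE.

Definition Phi (R : realType) (x : R) : R :=
  (Num.sqrt (2 * pi))^-1 *
  \int[lebesgue_measure]_(y in `]-oo, x]) expR (- (y ^+ 2) / 2).

(* Main.v *)
Require Import Defs.
From HB Require Import structures.
From mathcomp Require Import all_boot all_order all_algebra finmap.
From mathcomp Require Import all_classical all_reals all_analysis.
From mathcomp Require Import measurable_realfun.
From mathcomp Require Import ring lra.

Set Implicit Arguments.
Unset Strict Implicit.
Unset Printing Implicit Defensive.

Import Order.TTheory GRing.Theory Num.Theory.
Import numFieldNormedType.Exports.
Import HBNNSimple.

Local Open Scope classical_set_scope.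
Local Open Scope ring_scope.

(* Write [S_n] for the sum of the [log m_j], which satisfies the central limit
   theorem; the latter is proved by replacing the summands one at a time in
   [Phi ((x - S_j / sqrt n) / sqrt s)], which solves the heat equation. It is
   then enough that [log Z_n - S_n = o(sqrt n)] in probability and that
   [P(Z_n > 0)] tends to 1. Since [f({0}) < delta], [log m_1] is bounded below,
   hence [rho := E[m_1^(- theta)] < 1] for a small [theta > 0].

   Upper bound: [E[(Z_n / e^(S_n))^theta]] is bounded, as the immigrants of
   generation [n] contribute at most a constant times [rho^n].

   Lower bound: without immigration, [L] particles normalized by their
   conditional mean form a martingale whose moment of order [1 + theta] is
   controlled by [rho], so with probability close to 1 uniformly in time the
   population stays above [e^(S_n) L / 2] for large [L]. With immigration, any
   level [L] is eventually exceeded with probability close to 1: each attempt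
   succeeds with a positive probability, whatever the past. *)

(** * Measure-theoretic tools *)

(** Conditioning is available only through product formulas for finite families of events. Hence an
    estimate given the past is stated as a relation between integrals against all nonnegative
    weights measurable for the past, or over all past events, and obtained from pi-systems; a random
    number of particles is made deterministic by splitting the integral along its value.

    The exponent [theta] obeys three constraints: [theta <= 1] for concavity, [1 + theta <= p] for
    the offspring moment, and [rho < 1], true for small [theta] because [E[m_1^(- theta)]] has
    derivative [- mu < 0] at [0]. The same [rho] controls the martingale: without immigration, in
    the mean of [Z_m e^(- (1 + theta) S_m)] each offspring mean is compensated by one factor
    [1 / m_j], and [m_j^(- theta)] is left over.

    The escape argument depends on the order of quantifiers: the number of particles that makes
    survival likely is chosen before the level to be exceeded, so the success probability of an
    attempt does not depend on that level. *)

Lemma g_sigma_measurable_fun d (T : measurableType d) d' (T' : measurableType d')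
  (G : set (set T)) (f : T -> T') : G `<=` measurable ->
  measurable_fun [set: g_sigma_algebraType G] f -> measurable_fun [set: T] f.
Proof.
move=> Gm mf _ B mB; rewrite setTI.
have := mf measurableT B mB; rewrite setTI => h.
by apply: (smallest_sub _ Gm h); exact: sigma_algebra_measurable.
Qed.

Lemma g_sigma_measurable_funS (T : pointedType) d' (T' : measurableType d')
  (G G' : set (set T)) (f : T -> T') : G `<=` <<s G' >> ->
  measurable_fun [set: g_sigma_algebraType G] f ->
  measurable_fun [set: g_sigma_algebraType G'] f.
Proof.
move=> Gm mf _ B mB; rewrite setTI.
have := mf measurableT B mB; rewrite setTI => h.
apply: (smallest_sub _ Gm h); exact: smallest_sigma_algebra.
Qed.

Section extend.
Local Open Scope ereal_scope.
Context d (T : measurableType d) (R : realType) (P : {measure set T -> \bar R}).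

(** The sets on which the two integrals agree form a Dynkin class: complements are handled by
    subtraction from the total integral, which must be finite and common to both. [G] is not assumed
    to contain the whole space, hence the separate hypothesis on the totals. *)
Lemma pi_system_integral_set (G : set (set T)) (u v : T -> \bar R) :
  G `<=` measurable -> setI_closed G ->
  measurable_fun setT u -> measurable_fun setT v ->
  (forall x, 0 <= u x) -> (forall x, 0 <= v x) ->
  \int[P]_w u w < +oo ->
  \int[P]_w u w = \int[P]_w v w ->
  (forall C, G C -> \int[P]_(w in C) u w = \int[P]_(w in C) v w) ->
  forall C, <<s G >> C -> \int[P]_(w in C) u w = \int[P]_(w in C) v w.
Proof.
move=> Gm GI mu mv u0 v0 ufin uv uvG.
pose GT := g_sigma_algebraType G.
have sub C : <<s G >> C -> d.-measurable C.
  by move=> h; apply: (smallest_sub _ Gm h); exact: sigma_algebra_measurable.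
apply: (@dynkin_induction _ GT G (fun C =>
   \int[P]_(w in C) u w = \int[P]_(w in C) v w)) => //.
- move=> S mS IH; have mS' := sub _ mS.
  have fS : \int[P]_(w in S) u w \is a fin_num.
    rewrite ge0_fin_numE; last exact: integral_ge0.
    by apply: le_lt_trans ufin; apply: ge0_subset_integral.
  have E (f : T -> \bar R) : measurable_fun setT f -> (forall x, 0 <= f x) ->
     \int[P]_w f w = \int[P]_(w in S) f w + \int[P]_(w in ~` S) f w.
    move=> mf f0; rewrite -ge0_integral_setU ?setUv//.
    - exact: measurableC.
    - by apply/disj_setPS; rewrite setICr.
  have := uv; rewrite (E u)// (E v)// -IH => H.
  by rewrite -[LHS](addeK _ fS) -[RHS](addeK _ fS); congr (_ - _); rewrite addeC H addeC.
- move=> F mF tF IH.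
  have mF' n : d.-measurable (F n) by exact: sub (mF n).
  rewrite !ge0_integral_bigcup//=; try by move=> *; apply: measurable_funTS.
  by apply: eq_eseriesr => n _; exact: IH.
Qed.

(** In effect [u] and [v] have the same conditional expectation given [G]; a general weight [phi] is
    reached from simple functions by monotone convergence. No integrability is assumed. *)
Lemma sub_sigma_integral (G : set (set T)) (u v : T -> \bar R) :
  G `<=` measurable ->
  measurable_fun setT u -> measurable_fun setT v ->
  (forall x, 0 <= u x) -> (forall x, 0 <= v x) ->
  (forall C, <<s G >> C -> \int[P]_(w in C) u w = \int[P]_(w in C) v w) ->
  forall phi : T -> \bar R, measurable_fun [set: g_sigma_algebraType G] phi ->
    (forall x, 0 <= phi x) ->
  \int[P]_w (phi w * u w) = \int[P]_w (phi w * v w).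
Proof.
move=> Gm mu mv u0 v0 uv phi mphi phi0.
have mphi' : measurable_fun [set: T] phi by exact: g_sigma_measurable_fun mphi.
have sub C : <<s G >> C -> d.-measurable C.
  by move=> h; apply: (smallest_sub _ Gm h); exact: sigma_algebra_measurable.
pose GT := g_sigma_algebraType G.
pose f_ := @nnsfun_approx _ GT R setT measurableT phi mphi.
have mf n : measurable_fun [set: T] (f_ n : T -> R).
  by apply: (@g_sigma_measurable_fun _ T _ _ G) => //; exact: (measurable_funP (f_ n)).
have cv (h : T -> \bar R) (h0 : forall x, 0 <= h x) w :
    phi w * h w = limn (fun n => (f_ n w)%:E * h w).
  apply/esym/cvg_lim => //.
  have c := @cvg_nnsfun_approx _ GT R setT measurableT phi mphi (fun x _ => phi0 x) w I.
  have [hf|] := boolP (h w \is a fin_num); first exact: cvgeZr c.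
  rewrite fin_numE negb_and !negbK => /orP[/eqP hw|/eqP hw].
    by have := h0 w; rewrite hw.
  (* Where [h] is infinite, the limit rests on the convention [0 * +oo = 0] if [phi] vanishes, since
     the approximations then vanish too, and otherwise on their being eventually positive. *)
  rewrite hw; have [pw|pw] := eqVneq (phi w) 0.
    rewrite pw mul0e; apply: cvg_near_cst; near=> n.
    have : ((f_ n w)%:E <= phi w).
      rewrite /f_ nnsfun_approxE; exact: le_approx.
    rewrite pw lee_fin => fw; have /eqP -> : (f_ n w == 0)%R.
      by rewrite eq_le fw fun_ge0.
    by rewrite mul0e.
  have pw0 : 0 < phi w by rewrite lt_neqAle eq_sym pw phi0.
  have c1 : \forall n \near \oo, 0 < (f_ n w)%:E by exact: (c _ (open_ereal_gt' pw0)).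
  rewrite gt0_muley//; apply: cvg_near_cst; near=> n.
  by rewrite gt0_muley//; near: n.
have mono (h : T -> \bar R) : measurable_fun setT h -> (forall x, 0 <= h x) ->
    \int[P]_w (phi w * h w) = limn (fun n => \int[P]_w ((f_ n w)%:E * h w)).
  move=> mh h0; under eq_integral do rewrite cv//.
  apply: monotone_convergence => //.
  - by move=> n; apply: emeasurable_funM => //; exact/measurable_EFinP.
  - by move=> n x _; rewrite mule_ge0// lee_fin.
  - move=> x _ m n mn; rewrite lee_wpmul2r// lee_fin.
    by have /lefP := nd_nnsfun_approx measurableT mphi mn; exact.
have simpl (h : T -> \bar R) n : measurable_fun setT h -> (forall x, 0 <= h x) ->
    \int[P]_w ((f_ n w)%:E * h w) =
    \sum_(y \in range (f_ n)) y%:E * \int[P]_(w in f_ n @^-1` [set y]) h w.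
  move=> mh h0.
  have mpre y : d.-measurable (f_ n @^-1` [set y] : set T).
    apply: sub; have := @measurable_funPTI _ _ _ _ (f_ n) [set y] (measurable_set1 y); exact.
  have y0 y : (range (f_ n)) y -> (0 <= y)%R by case=> x _ <-.
  transitivity (\int[P]_w (\sum_(y \in range (f_ n))
      (y%:E * ((\1_(f_ n @^-1` [set y]) w)%:E * h w)))).
    apply: eq_integral => w _.
    rewrite {1}(fimfunE (f_ n) w) -fsumEFin// ge0_mule_fsuml.
    - by apply: eq_fsbigr => y _; rewrite EFinM muleA.
    - move=> y; rewrite lee_fin; have [/y0 ?|] := pselect (range (f_ n) y).
        by rewrite mulr_ge0.
      move=> ny; rewrite indicE; case: (boolP (w \in _)) => [|_]; last by rewrite mulr0.
      by rewrite inE => /= wy; exfalso; apply: ny; exists w.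
  rewrite ge0_integral_fsum//.
  - apply: eq_fsbigr => y /[!inE] ry.
    rewrite ge0_integralZl_EFin//; last 3 first.
    + by move=> x _; rewrite mule_ge0// lee_fin.
    + apply: emeasurable_funM => //; apply/measurable_EFinP.
      exact: measurable_indic.
    + exact: y0.
    congr (_ * _); rewrite [RHS]integral_mkcond.
    apply: eq_integral => w _; rewrite patchE indicE.
    by case: ifPn => _; rewrite ?mul1e ?mul0e.
  - move=> y; apply: measurable_funeM; apply: emeasurable_funM => //.
    by apply/measurable_EFinP; exact: measurable_indic.
  - move=> y w _; have [/y0 ?|ny] := pselect (range (f_ n) y).
      by rewrite !mule_ge0// lee_fin.
    rewrite indicE; case: (boolP (w \in _)) => [|_]; last by rewrite mul0e mule0.
    by rewrite inE => /= wy; exfalso; apply: ny; exists w.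
rewrite !mono//; congr (limn _); apply/funext => n.
rewrite !simpl//; apply: eq_fsbigr => y _; congr (_ * _); apply: uv.
have := @measurable_funPTI _ _ _ _ (f_ n) [set y] (measurable_set1 y); exact.
Unshelve. all: by end_near. Qed.

End extend.

Lemma preimage_system_measurable d (T : measurableType d) d' (T' : measurableType d')
  (X : T -> T') : measurable_fun setT X ->
  preimage_set_system setT X measurable `<=` measurable.
Proof. by move=> mX _ [B mB <-]; exact: mX. Qed.

Lemma preimage_system_setI (T : Type) d' (T' : measurableType d') (X : T -> T') :
  setI_closed (preimage_set_system setT X measurable).
Proof.
move=> _ _ [A mA <-] [B mB <-]; exists (A `&` B); first exact: measurableI.
by rewrite !setTI.
Qed.

Lemma preimage_system_fun (T : pointedType) d' (T' : measurableType d') (X : T -> T') :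
  measurable_fun [set: g_sigma_algebraType (preimage_set_system setT X measurable)] X.
Proof. by move=> _ B mB; apply: sub_sigma_algebra; exists B. Qed.

(** * Independence of sigma-algebras generated by pi-systems *)

Section independence.
Local Open Scope ereal_scope.
Context d (T : measurableType d) (R : realType) (P : probability T R).
Variables G1 G2 : set (set T).
Hypotheses (mG1 : G1 `<=` measurable) (mG2 : G2 `<=` measurable).
Hypotheses (IG1 : setI_closed G1) (IG2 : setI_closed G2).
Hypothesis indep : forall A B, G1 A -> G2 B -> P (A `&` B) = P A * P B.

(** For fixed [B], both sides are integrals over [A], of the indicator of [B] and of a constant, so
    the extension from a pi-system applies; it is used once for each family. *)
Lemma pi_indep A B : <<s G1 >> A -> <<s G2 >> B -> P (A `&` B) = P A * P B.
Proof.
have sub (G : set (set T)) : G `<=` measurable -> <<s G >> `<=` measurable.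
  by move=> mG; apply: smallest_sub => //; exact: sigma_algebra_measurable.
have main (G : set (set T)) B0 : d.-measurable B0 -> G `<=` measurable ->
    setI_closed G -> (forall A0, G A0 -> P (A0 `&` B0) = P A0 * P B0) ->
    forall A0, <<s G >> A0 -> P (A0 `&` B0) = P A0 * P B0.
  move=> mB0 mG IG H A0 sA0.
  have E C : d.-measurable C -> \int[P]_(w in C) (\1_B0 w)%:E = P (C `&` B0).
    by move=> mC; rewrite integral_indic// setIC.
  have E2 C : d.-measurable C -> \int[P]_(w in C) (cst (P B0)) w = P C * P B0.
    by move=> mC; rewrite integral_cst// muleC.
  have mA0 : d.-measurable A0 by exact: sub sA0.
  rewrite -E// -E2//; apply: (@pi_system_integral_set _ _ _ P G) => //.
  - exact/measurable_EFinP/measurable_indic.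
  - by rewrite E// setTI (le_lt_trans (probability_le1 _ _))// ltry.
  - by rewrite E// E2// setTI probability_setT mul1e.
  - by move=> C GC; rewrite E ?E2; [exact: H|exact: mG|exact: mG].
move=> sA sB; apply: (main G1) => //; first exact: sub sB.
move=> A0 GA0; rewrite setIC muleC; apply: (main G2) => //; first exact: mG1.
by move=> B0 GB0; rewrite setIC muleC indep.
Qed.

(** Two replacements under the integral: [g] by its mean, against functions of the first
    sigma-algebra; and, to justify this, the indicator of an event of that sigma-algebra by its
    probability, against [g]. *)
Lemma indep_ge0_integral (f g : T -> \bar R) :
  measurable_fun [set: g_sigma_algebraType G1] f ->
  measurable_fun [set: g_sigma_algebraType G2] g ->
  (forall x, 0 <= f x) -> (forall x, 0 <= g x) ->
  \int[P]_w (f w * g w) = \int[P]_w f w * \int[P]_w g w.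
Proof.
move=> mf mg f0 g0.
have sub (G : set (set T)) : G `<=` measurable -> <<s G >> `<=` measurable.
  by move=> mG; apply: smallest_sub => //; exact: sigma_algebra_measurable.
have mf' : measurable_fun [set: T] f by exact: g_sigma_measurable_fun mf.
have mg' : measurable_fun [set: T] g by exact: g_sigma_measurable_fun mg.
rewrite (@sub_sigma_integral _ _ _ P G1 g (cst (\int[P]_w g w)))//.
- by rewrite ge0_integralZr// integral_ge0.
- by move=> x; exact: integral_ge0.
move=> A sA; have mA := sub _ mG1 _ sA.
rewrite integral_cst// integral_mkcond.
transitivity (\int[P]_w (g w * (\1_A w)%:E)).
  by apply: eq_integral => w _; rewrite epatch_indic.
rewrite (@sub_sigma_integral _ _ _ P G2 (EFin \o \1_A) (cst (P A)))//.
- by rewrite ge0_integralZr.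
- exact/measurable_EFinP/measurable_indic.
- by move=> x; rewrite lee_fin.
move=> B sB; have mB := sub _ mG2 _ sB.
by rewrite integral_indic// integral_cst//; exact: pi_indep.
Qed.

(** Both functions may change sign. Adding [M] to the bounded one makes it nonnegative, so that the
    positive and negative parts of the product are those of [g] times this factor. *)
Lemma indep_integral0 (f g : T -> R) M :
  measurable_fun [set: g_sigma_algebraType G1] f ->
  measurable_fun [set: g_sigma_algebraType G2] g ->
  (forall x, (`|f x| <= M)%R) -> P.-integrable setT (EFin \o g) ->
  \int[P]_w (g w)%:E = 0 ->
  P.-integrable setT (fun w => (f w * g w)%:E) /\ \int[P]_w (f w * g w)%:E = 0.
Proof.
move=> mf mg fM ig g0.
have mf' : measurable_fun [set: T] f by exact: g_sigma_measurable_fun mf.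
have mg' : measurable_fun [set: T] g by exact: g_sigma_measurable_fun mg.
have M0 : (0 <= M)%R by rewrite (le_trans _ (fM point)).
have ifg : P.-integrable setT (fun w => (f w * g w)%:E).
  apply: (@le_integrable _ _ _ P setT _ _ (fun w => M%:E * (g w)%:E)) => //.
  - by apply/measurable_EFinP; exact: measurable_funM.
  - move=> w _; rewrite -EFinM lee_fin !normrM (ger0_norm M0).
    by rewrite ler_wpM2r.
  - exact: integrableZl.
split => //.
have fM0 w : (0 <= f w + M)%R by have := fM w; rewrite ler_norml => /andP[]; lra.
pose h w := ((f w + M) * g w)%:E.
have hE w : (f w * g w)%:E = h w - M%:E * (g w)%:E.
  by rewrite /h -EFinM -EFinB; congr EFin; ring.
have ih : P.-integrable setT h.
  rewrite (_ : h = (fun w => (f w * g w)%:E) \+ (fun w => M%:E * (g w)%:E)).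
    by apply: integrableD => //; exact: integrableZl.
  by apply/funext => w; rewrite /h -EFinM -EFinD mulrDl.
under eq_integral do rewrite hE.
rewrite integralB//; last exact: integrableZl.
rewrite integralZl// g0 mule0 sube0.
have hp : h^\+ = fun w => (f w + M)%:E * (EFin \o g)^\+ w.
  by apply/funext => w; rewrite !funeposE /h EFinM maxe_pMr ?mule0 ?lee_fin//.
have hn : h^\- = fun w => (f w + M)%:E * (EFin \o g)^\- w.
  by apply/funext => w; rewrite !funenegE /h EFinM -muleN maxe_pMr ?mule0 ?lee_fin//.
have mfM : measurable_fun [set: g_sigma_algebraType G1] (fun w => (f w + M)%:E).
  by apply/measurable_EFinP; exact: measurable_funD.
have mge : measurable_fun [set: g_sigma_algebraType G2] (EFin \o g).
  exact/measurable_EFinP.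
have fM0' w : 0 <= (f w + M)%:E by rewrite lee_fin.
rewrite integralE hp hn.
rewrite (indep_ge0_integral mfM (measurable_funepos mge) fM0' (funepos_ge0 _)).
rewrite (indep_ge0_integral mfM (measurable_funeneg mge) fM0' (funeneg_ge0 _)).
move: g0; rewrite integralE.
have : \int[P]_w (EFin \o g)^\+ w \is a fin_num by exact: integrable_pos_fin_num.
have : \int[P]_w (EFin \o g)^\- w \is a fin_num by exact: integrable_neg_fin_num.
case: (integral _ _ _) => // a _; case: (integral _ _ _) => // b _.
rewrite -EFinB => -[] /eqP; rewrite subr_eq0 => /eqP ->.
rewrite subee// fin_numM// ge0_fin_numE ?integral_ge0//.
apply: (@le_lt_trans _ _ (\int[P]_w (cst (M + M)%:E w))).
  apply: ge0_le_integral => //.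
  - by apply/measurable_EFinP; exact: measurable_funD.
  - by move=> w _; rewrite lee_fin lerD2r (le_trans (ler_norm _)).
by rewrite integral_cst//= probability_setT mule1 ltry.
Qed.

End independence.

(** * The normal distribution function *)

Section taylor.
Context {R : realType}.
Implicit Types (f df : R -> R) (x t K B : R).

Lemma MVT_le f df K (a b : R) : (forall x : R, is_derive x 1 f (df x)) ->
  (forall x, `|x - a| <= `|b - a| -> `|df x| <= K) ->
  `|f b - f a| <= K * `|b - a|.
Proof.
move=> fdf dfK.
have main (u v : R) : u <= v ->
    (forall x, u <= x <= v -> `|df x| <= K) -> `|f v - f u| <= K * `|v - u|.
  move=> uv H; have [|c] := @MVT_segment R f df u v uv (fun x _ => fdf x).
    by apply: derivable_within_continuous => x _; have [] := fdf x.
  rewrite in_itv/= => cuv ->; rewrite normrM ler_wpM2r//; exact: H.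
have [ab|/ltW ba] := leP a b.
  apply: main => // x /andP[ax xb]; apply: dfK.
  by rewrite !ger0_norm ?subr_ge0// lerB.
rewrite distrC (distrC b); apply: main => // x /andP[bx xa]; apply: dfK.
by rewrite (distrC x) (distrC b) !ger0_norm ?subr_ge0// lerB.
Qed.

Lemma is_derive_shift (f : R -> R) x (s dfs : R) :
  is_derive (x + s) 1 f dfs -> is_derive s 1 (fun s => f (x + s)) dfs.
Proof.
move=> h; have h1 : is_derive s 1 (fun s : R => x + s) 1.
  by apply: is_derive_eq; rewrite add0r mulr1.
by have := @is_derive1_comp _ f (fun s => x + s) s dfs 1 h h1; rewrite mulr1.
Qed.

(** The mean value bound is applied to the remainder and then to its derivative. Only the
    oscillation of [f2] enters, so a bounded [f2] gives a quadratic error and a Lipschitz [f2] a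
    cubic one. *)
Lemma taylor2_le (f0 f1 f2 : R -> R) x t B :
  (forall y : R, is_derive y 1 f0 (f1 y)) -> (forall y : R, is_derive y 1 f1 (f2 y)) ->
  (forall s, `|s| <= `|t| -> `|f2 (x + s) - f2 x| <= B) ->
  `|f0 (x + t) - f0 x - f1 x * t - f2 x * t ^+ 2 / 2| <= B * t ^+ 2.
Proof.
move=> d0 d1 HB.
have B0 : 0 <= B by apply: le_trans (HB 0 _); rewrite ?normr0.
pose k s := f1 (x + s) - f2 x * s.
have dk (s : R) : is_derive s 1 k (f2 (x + s) - f2 x).
  have ? : is_derive s 1 (fun s => f1 (x + s)) (f2 (x + s)).
    exact: is_derive_shift.
  by rewrite /k; apply: is_derive_eq; rewrite /GRing.scale/=; ring.
pose h s := f0 (x + s) - f1 x * s - f2 x * s ^+ 2 / 2.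
have dh (s : R) : is_derive s 1 h (f1 (x + s) - f1 x - f2 x * s).
  have ? : is_derive s 1 (fun s => f0 (x + s)) (f1 (x + s)).
    exact: is_derive_shift.
  by rewrite /h; apply: is_derive_eq; rewrite /GRing.scale/=; field.
have -> : f0 (x + t) - f0 x - f1 x * t - f2 x * t ^+ 2 / 2 = h t - h 0.
  by rewrite /h !mulr0 addr0 expr0n/=; lra.
have -> : B * t ^+ 2 = (B * `|t|) * `|t - 0|.
  by rewrite subr0 -mulrA -normrM ger0_norm -?expr2 ?sqr_ge0.
apply: (MVT_le dh) => s; rewrite !subr0 => st.
have -> : f1 (x + s) - f1 x - f2 x * s = k s - k 0.
  by rewrite /k mulr0 addr0; lra.
apply: (@le_trans _ _ (B * `|s - 0|)).
  apply: (MVT_le dk) => r; rewrite !subr0 => rs; apply: HB; exact: le_trans rs st.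
by rewrite subr0 ler_wpM2l.
Qed.

End taylor.

Section gauss.
Context {R : realType}.
Implicit Types (x y z t c s r h : R).

Definition dPhi x : R := (Num.sqrt (2 * pi))^-1 * expR (- (x ^+ 2) / 2).

Lemma dPhiE : dPhi = normal_pdf 0 1.
Proof.
apply/funext => x; rewrite normal_pdfE ?oner_neq0// /dPhi /normal_peak /normal_fun.
by rewrite subr0 expr1n mul1r -[pi *+ 2]mulr_natl.
Qed.

Lemma PhiE x : Phi x = fine (normal_prob 0 1 `]-oo, x]).
Proof.
have i : lebesgue_measure.-integrable `]-oo, x] (EFin \o (fun y : R => expR (- (y ^+ 2) / 2))).
  have i0 : lebesgue_measure.-integrable `]-oo, x] (EFin \o dPhi).
    apply: (integrableS _ _ (subsetT _)) => //.
    by rewrite dPhiE; exact: integrable_normal_pdf.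
  have : lebesgue_measure.-integrable `]-oo, x]
      (fun y => (Num.sqrt (2 * pi))%:E * (EFin \o dPhi) y)%E.
    exact: integrableZl.
  apply: eq_integrable => // y _; rewrite /= -EFinM /dPhi mulrA divff ?mul1r//.
  by rewrite gt_eqF// sqrtr_gt0 mulr_gt0// pi_gt0.
by rewrite /Phi -RintegralZl// /normal_prob -dPhiE.
Qed.

Lemma Phi_ge0 x : 0 <= Phi x. Proof. by rewrite PhiE fine_ge0. Qed.

Lemma Phi_le1 x : Phi x <= 1.
Proof. by rewrite PhiE -lee_fin fineK ?fin_num_measure// probability_le1. Qed.

Lemma Phi_nd x y : x <= y -> Phi x <= Phi y.
Proof.
move=> xy; rewrite !PhiE fine_le ?fin_num_measure// le_measure ?inE//.
exact: subitvPr.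
Qed.

(** The identity, seen below as a random variable with standard normal law: the limits of its
    distribution function are those of [Phi] at infinity. *)
Let idTR : measurableTypeR R -> R := idfun.

#[local] HB.instance Definition _ :=
  @isMeasurableFun.Build _ _ _ _ idTR (@measurable_id _ _ setT).

Let X : {RV (normal_prob 0 1 : probability (measurableTypeR R) R) >-> R} := idTR.

Lemma cvg_Phi_y1 : Phi x @[x --> +oo] --> (1 : R).
Proof.
have := @cvg_cdfy1 _ _ _ _ X => /fine_cvgP[_].
by apply: cvg_trans; apply: near_eq_cvg; near=> x; rewrite PhiE.
Unshelve. all: by end_near. Qed.

Lemma cvg_Phi_Ny0 : Phi x @[x --> -oo] --> (0 : R).
Proof.
have := @cvg_cdfNy0 _ _ _ _ X => /fine_cvgP[_].
by apply: cvg_trans; apply: near_eq_cvg; near=> x; rewrite PhiE.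
Unshelve. all: by end_near. Qed.

Lemma is_derive_Phi x : is_derive x 1 (@Phi R) (dPhi x).
Proof.
have i : lebesgue_measure.-integrable `]-oo, x + 1] (EFin \o dPhi).
  apply: (integrableS _ _ (subsetT _)) => //.
  by rewrite dPhiE; exact: integrable_normal_pdf.
have xu : x < x + 1 by rewrite ltrDl.
have ax : (-oo < BRight x)%E by rewrite ltNyr.
have cx : {for x, continuous dPhi}.
  by rewrite dPhiE; apply: continuous_normal_pdf; rewrite oner_neq0.
have [d1 d2] := continuous_FTC1 xu i ax cx.
have -> : @Phi R = (fun y => \int[lebesgue_measure]_(t in `]-oo, y]) dPhi t).
  by apply/funext => y; rewrite PhiE dPhiE.
rewrite derive1E in d2; exact: DeriveDef d1 d2.
Qed.

Lemma is_derive_dPhi x : is_derive x 1 dPhi (- x * dPhi x).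
Proof.
rewrite /dPhi.
have ? : is_derive x 1 (fun x : R => - (x ^+ 2) / 2) (- x).
  by apply: is_derive_eq; rewrite /GRing.scale/=; field.
have ? : is_derive x 1 (fun x : R => expR (- (x ^+ 2) / 2)) (expR (- (x ^+ 2) / 2) * - x).
  exact: is_derive1_comp.
by apply: is_derive_eq; rewrite /GRing.scale/=; ring.
Qed.

Definition ddPhi x : R := - x * dPhi x.

Lemma is_derive_ddPhi x : is_derive x 1 ddPhi ((x ^+ 2 - 1) * dPhi x).
Proof.
rewrite /ddPhi; have ? := is_derive_dPhi x.
by apply: is_derive_eq; rewrite /GRing.scale/=; ring.
Qed.

Lemma dPhi_ge0 x : 0 <= dPhi x.
Proof. by rewrite mulr_ge0 ?invr_ge0 ?sqrtr_ge0 ?expR_ge0. Qed.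

(** From [exp(y) >= 1 + y^2 / 2] at [y = x^2 / 2], the density is at most [8 / (8 + x^4)], which
    absorbs any power of [x] up to the third. *)
Lemma normX_dPhi_le k x : (k <= 3)%N -> `|x| ^+ k * dPhi x <= 8.
Proof.
move=> k3.
have y0 : 0 <= x ^+ 2 / 2 by rewrite divr_ge0 ?sqr_ge0.
have pos : 0 < 1 + (x ^+ 2 / 2) ^+ 2 / 2.
  by rewrite ltr_wpDr// divr_ge0// sqr_ge0.
have h : dPhi x <= (1 + (x ^+ 2 / 2) ^+ 2 / 2)^-1.
  rewrite /dPhi -[leRHS]mul1r; apply: ler_pM.
  - by rewrite invr_ge0 sqrtr_ge0.
  - exact: expR_ge0.
  - rewrite invf_le1 ?sqrtr_gt0 ?mulr_gt0 ?pi_gt0//.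
    by rewrite -[leLHS]sqrtr1 ler_wsqrtr//; have := @pi_ge2 R; lra.
  - rewrite mulNr expRN lef_pV2 ?posrE ?expR_gt0//.
    exact: (expR_ge1Dxn 1 y0).
apply: (le_trans (ler_wpM2l _ h)); first by rewrite exprn_ge0.
rewrite ler_pdivrMr//.
have -> : 8 * (1 + (x ^+ 2 / 2) ^+ 2 / 2) = 8 + `|x| ^+ 4.
  have -> : `|x| ^+ 4 = x ^+ 4 by rewrite -normrX ger0_norm// (exprM x 2 2) sqr_ge0.
  by field.
have [x1|x1] := leP `|x| 1.
  have := exprn_ile1 k (normr_ge0 x) x1.
  have : 0 <= `|x| ^+ 4 by rewrite exprn_ge0.
  by lra.
have := ler_weXn2l (ltW x1) (leq_trans k3 (leqnSn 3)).
by lra.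
Qed.

Lemma ddPhi_le x : `|ddPhi x| <= 8.
Proof.
rewrite /ddPhi normrM normrN (ger0_norm (dPhi_ge0 x)).
by have := @normX_dPhi_le 1 x isT; rewrite expr1.
Qed.

Lemma dddPhi_le x : `|(x ^+ 2 - 1) * dPhi x| <= 16.
Proof.
rewrite normrM (ger0_norm (dPhi_ge0 x)).
have h2 := @normX_dPhi_le 2 x isT; have h0 := @normX_dPhi_le 0 x isT.
apply: (@le_trans _ _ ((`|x| ^+ 2 + `|x| ^+ 0) * dPhi x)).
  rewrite ler_wpM2r ?dPhi_ge0//; apply: (le_trans (ler_normB _ _)).
  by rewrite normrX normr1 expr0.
by rewrite mulrDl; lra.
Qed.

(** The quadratic bound is meant for large increments and the cubic one for small increments, as in
    the Lindeberg condition. The constant [16] is both twice the bound on [ddPhi] and the bound on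
    its derivative. *)
Lemma Phi_taylor z t :
  `|Phi (z + t) - Phi z - dPhi z * t - ddPhi z * t ^+ 2 / 2|
    <= 16 * Num.min (t ^+ 2) (`|t| ^+ 3).
Proof.
rewrite minr_pMr// le_min; apply/andP; split.
  apply: taylor2_le => [y|y|s _]; [exact: is_derive_Phi|exact: is_derive_dPhi|].
  apply: (le_trans (ler_normB _ _)).
  by have := ddPhi_le (z + s); have := ddPhi_le z; lra.
have -> : 16 * `|t| ^+ 3 = (16 * `|t|) * t ^+ 2.
  by rewrite -mulrA exprS -normrX (ger0_norm (sqr_ge0 t)).
apply: taylor2_le => [y|y|s st]; [exact: is_derive_Phi|exact: is_derive_dPhi|].
apply: (@le_trans _ _ (16 * `|(z + s) - z|)).
  apply: (MVT_le is_derive_ddPhi) => x _; exact: dddPhi_le.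
by rewrite addrC addKr ler_wpM2l.
Qed.

(* The heat equation in the self-similar variable: shrinking [z] by the factor
   [1 - c] acts to first order as adding variance [2 c]. *)
Lemma Phi_shrink z c : 0 <= c <= 2^-1 ->
  `|Phi (z * (1 - c)) - Phi z - c * ddPhi z| <= 64 * c ^+ 2.
Proof.
move=> /andP[c0 c1].
pose f s := Phi (z * (1 - s)) - s * ddPhi z.
have dl (s : R) : is_derive s 1 (fun s => z * (1 - s)) (- z).
  by apply: is_derive_eq; rewrite /GRing.scale/=; ring.
pose g s := - z * dPhi (z * (1 - s)).
have dg (s : R) : is_derive s 1 g (z ^+ 2 * ddPhi (z * (1 - s))).
  have ? : is_derive s 1 (fun s => dPhi (z * (1 - s))) (ddPhi (z * (1 - s)) * - z).
    by have ? := is_derive_dPhi (z * (1 - s)); exact: is_derive1_comp.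
  by rewrite /g; apply: is_derive_eq; rewrite /GRing.scale/=; ring.
have df (s : R) : is_derive s 1 f (g s - g 0).
  have ? : is_derive s 1 (fun s => Phi (z * (1 - s))) (dPhi (z * (1 - s)) * - z).
    by have ? := is_derive_Phi (z * (1 - s)); exact: is_derive1_comp.
  rewrite /f; apply: is_derive_eq; rewrite /GRing.scale/= /g /ddPhi subr0 !mulr1.
  by ring.
have -> : Phi (z * (1 - c)) - Phi z - c * ddPhi z = f c - f 0.
  by rewrite /f subr0 mulr1 mul0r; ring.
have -> : 64 * c ^+ 2 = (64 * c) * `|c - 0| by rewrite subr0 ger0_norm//; ring.
apply: (MVT_le df) => s; rewrite !subr0 (ger0_norm c0) => sc.
apply: (@le_trans _ _ (64 * `|s - 0|)); last by rewrite subr0 ler_wpM2l.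
apply: (MVT_le dg) => r; rewrite !subr0 => rs.
have r2 : r <= 2^-1 by rewrite (le_trans (ler_norm r))// (le_trans rs)// (le_trans sc).
set w := z * (1 - r).
(* The polynomial factor in [z] must be carried to the point [w] where the density is evaluated;
   this is why [c] is kept below one half. *)
have zw : `|z| <= 2 * `|w|.
  rewrite /w normrM (@ger0_norm _ (1 - r)); last by lra.
  by have := normr_ge0 z; nra.
rewrite /ddPhi normrM normrX normrM normrN (ger0_norm (dPhi_ge0 _)).
have h := @normX_dPhi_le 3 w isT.
apply: (@le_trans _ _ ((2 * `|w|) ^+ 2 * (`|w| * dPhi w))).
  by rewrite ler_wpM2r ?mulr_ge0 ?dPhi_ge0// lerXn2r ?nnegrE ?mulr_ge0.
have -> : (2 * `|w|) ^+ 2 * (`|w| * dPhi w) = 4 * (`|w| ^+ 3 * dPhi w) by ring.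
by lra.
Qed.

(** The function [Phi (y / sqrt s)] has space derivatives [dPhi / sqrt s] and [ddPhi / s], and its
    time derivative is half the latter. Trading a jump [h] for an extra variance [r] thus leaves, to
    first order, the terms in [h] and in [h ^+ 2 - r], which average to zero when [h] is centered
    with variance [r]. The bound [kappa <= s] keeps away from the singularity at time zero. *)
Lemma heat_step (kappa : R) : 0 < kappa -> exists2 C : R, 0 <= C &
  forall s r y h, kappa <= s -> 0 <= r <= kappa ->
  `|Phi ((y - h) / Num.sqrt s) - Phi (y / Num.sqrt (s + r))
    + dPhi (y / Num.sqrt s) / Num.sqrt s * h
    - ddPhi (y / Num.sqrt s) / (2 * s) * (h ^+ 2 - r)|
  <= C * (Num.min (h ^+ 2) (`|h| ^+ 3) + r ^+ 2).
Proof.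
move=> k0.
pose C1 := kappa^-1 + (Num.sqrt kappa)^-1 ^+ 3; pose C2 := kappa^-1 ^+ 2.
have C10 : 0 <= C1 by rewrite addr_ge0 ?exprn_ge0 ?invr_ge0 ?sqrtr_ge0 ?ltW.
have C20 : 0 <= C2 by rewrite exprn_ge0// invr_ge0 ltW.
exists (16 * C1 + 72 * C2); first by rewrite addr_ge0// mulr_ge0.
move=> s r y h ks /andP[r0 rk].
have s0 : 0 < s by exact: lt_le_trans ks.
have sr0 : 0 < s + r by rewrite ltr_wpDr.
have w0 : 0 < Num.sqrt s by rewrite sqrtr_gt0.
set w := Num.sqrt s in w0 *; set w' := Num.sqrt (s + r).
have w'0 : 0 < w' by rewrite sqrtr_gt0.
have ww : w ^+ 2 = s by rewrite sqr_sqrtr ?ltW.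
have ww' : w' ^+ 2 = s + r by rewrite sqr_sqrtr ?ltW.
set z := y / w; set t := - (h / w).
have -> : (y - h) / w = z + t by rewrite mulrBl.
(* The extra variance [r] amounts to shrinking [z] by [1 - c]; from [(1 - c)^2 * (s + r) = s] one
   gets [c = r / (2 * s)] up to second order, which is [dc] below. *)
set c := 1 - w / w'.
have -> : y / w' = z * (1 - c).
  by rewrite /z /c opprB addrC subrK mulrA divfK// gt_eqF.
have q0 : 0 < w / w' by rewrite divr_gt0.
have q2 : (w / w') ^+ 2 * (s + r) = s.
  by rewrite expr_div_n ww' ww divfK// gt_eqF.
have q1 : w / w' <= 1 by rewrite ler_pdivrMr// mul1r ler_wsqrtr// lerDl.
have c0 : 0 <= c by rewrite subr_ge0.
have qE : w / w' = 1 - c by rewrite /c opprB addrC subrK.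
rewrite qE in q0 q1 q2.
have csr : c * (s + r) <= r by nra.
have cs : c * s <= r by nra.
have c2 : c <= 2^-1.
  have : c * (s + r) * 2 <= s + r by lra.
  by rewrite mulrAC -[X in _ <= X]mul1r ler_pM2r// => ?; lra.
have u1 : s * (r - 2 * c * s) <= 2 * r ^+ 2 by nra.
have u2 : - r ^+ 2 <= s * (r - 2 * c * s) by nra.
have rs : (r / s) ^+ 2 <= C2 * r ^+ 2.
  rewrite /C2 -exprMn mulrC lerXn2r ?nnegrE ?mulr_ge0 ?invr_ge0 ?(ltW k0) ?(ltW s0)//.
  by rewrite ler_wpM2r// lef_pV2.
have crs : c <= r / s by rewrite ler_pdivlMr.
have dc : `|r / (2 * s) - c| <= (r / s) ^+ 2.
  have -> : r / (2 * s) - c = s * (r - 2 * c * s) / (2 * s ^+ 2) by field; lra.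
  have s20 : 0 <= (2 * s ^+ 2)^-1 by rewrite invr_ge0 mulr_ge0// sqr_ge0.
  rewrite normrM (ger0_norm s20).
  have -> : (r / s) ^+ 2 = 2 * r ^+ 2 / (2 * s ^+ 2) by field; lra.
  rewrite ler_wpM2r//.
  by rewrite ler_norml u1 andbT; apply: le_trans u2; have := sqr_ge0 r; lra.
have hA := Phi_taylor z t.
have hB : `|Phi (z * (1 - c)) - Phi z - c * ddPhi z| <= 64 * c ^+ 2.
  by apply: Phi_shrink; rewrite c0.
have hD := ddPhi_le z.
have t2 : t ^+ 2 = h ^+ 2 / s by rewrite /t sqrrN expr_div_n ww.
have -> : Phi (z + t) - Phi (z * (1 - c)) + dPhi z / w * h
    - ddPhi z / (2 * s) * (h ^+ 2 - r) =
    (Phi (z + t) - Phi z - dPhi z * t - ddPhi z * t ^+ 2 / 2)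
    - (Phi (z * (1 - c)) - Phi z - c * ddPhi z) + (r / (2 * s) - c) * ddPhi z.
  by rewrite t2 /t; field; rewrite !gt_eqF.
apply: (le_trans (ler_normD _ _)); rewrite normrM.
have hN := le_trans (ler_normB _ _) (lerD hA hB).
have cc : c ^+ 2 <= (r / s) ^+ 2 by rewrite lerXn2r ?nnegrE// (le_trans c0).
have tm : Num.min (t ^+ 2) (`|t| ^+ 3) <= C1 * Num.min (h ^+ 2) (`|h| ^+ 3).
  rewrite minr_pMr// le_min !ge_min; apply/andP; split; apply/orP; [left|right].
    rewrite t2 mulrC ler_wpM2r ?sqr_ge0// /C1.
    apply: ler_wpDr; first by rewrite exprn_ge0// invr_ge0 sqrtr_ge0.
    by rewrite lef_pV2.
  rewrite /t normrN normrM exprMn mulrC ler_wpM2r ?exprn_ge0// /C1.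
  apply: ler_wpDl; first by rewrite invr_ge0 ltW.
  rewrite ger0_norm ?invr_ge0 ?(ltW w0)// lerXn2r ?nnegrE ?invr_ge0 ?sqrtr_ge0//.
  by rewrite lef_pV2 ?posrE ?sqrtr_gt0// ler_wsqrtr.
have m0 : 0 <= Num.min (h ^+ 2) (`|h| ^+ 3) by rewrite le_min sqr_ge0 exprn_ge0.
have r20 := sqr_ge0 r.
have dd : `|r / (2 * s) - c| * `|ddPhi z| <= (r / s) ^+ 2 * 8 by exact: ler_pM.
have E1 : 0 <= C1 * r ^+ 2 by exact: mulr_ge0.
have E2 : 0 <= C2 * Num.min (h ^+ 2) (`|h| ^+ 3) by exact: mulr_ge0.
move: hN tm m0 r20 dd E1 E2 rs cc.
move: (Num.min (h ^+ 2) _) (Num.min (t ^+ 2) _) => m m'.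
move: (`|_ - _|) (_ * `|ddPhi z|) ((r / s) ^+ 2) (c ^+ 2) (r ^+ 2) => a1 a2 a3 a4 a5.
by clearbody C1 C2; move=> *; lra.
Qed.

End gauss.

(** * The central limit theorem *)

Section clt.
Context d (T : measurableType d) (R : realType) (P : probability T R).
Variable X : nat -> T -> R.
Hypothesis mX : forall n, measurable_fun setT (X n).
Hypothesis lawX : forall n A, measurable A -> P (X n @^-1` A) = P (X 0%N @^-1` A).
Let S n w := \sum_(i < n) X i w.
Hypothesis indX : forall n A B, measurable A -> measurable B ->
  P (S n @^-1` A `&` X n @^-1` B) = (P (S n @^-1` A) * P (X n @^-1` B))%E.
Hypothesis EX : (\int[P]_w (X 0%N w)%:E = 0)%E.
Hypothesis EX2 : (\int[P]_w (X 0%N w ^+ 2)%:E = 1)%E.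

Let mS n : measurable_fun setT (S n).
Proof. by apply: measurable_sum => i; exact: mX. Qed.

Lemma law_ge0_integral n (f : R -> \bar R) : measurable_fun setT f ->
  (forall x, 0 <= f x)%E -> (\int[P]_w f (X n w) = \int[P]_w f (X 0%N w))%E.
Proof.
move=> mf f0.
have E m : (\int[P]_w f (X m w) = \int[pushforward P (X m)]_x f x)%E.
  by rewrite (ge0_integral_pushforward (mX m))//= preimage_setT.
by rewrite !E; apply: eq_measure_integral => A mA _; exact: lawX.
Qed.

Let EXn2 n : (\int[P]_w (X n w ^+ 2)%:E = 1)%E.
Proof.
rewrite (@law_ge0_integral n (fun x => (x ^+ 2)%:E))//.
- by apply/measurable_EFinP; exact: measurable_funX.
- by move=> x; rewrite lee_fin sqr_ge0.
Qed.

Let iX2 n : P.-integrable setT (fun w => (X n w ^+ 2)%:E).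
Proof.
apply/integrableP; split; first by apply/measurable_EFinP; exact: measurable_funX.
under eq_integral do rewrite gee0_abs ?lee_fin ?sqr_ge0//.
by rewrite EXn2 ltry.
Qed.

Lemma integrable_bounded (f : T -> R) M : measurable_fun setT f ->
  (forall w, `|f w| <= M) -> P.-integrable setT (EFin \o f).
Proof.
move=> mf fM; apply: (@le_integrable _ _ _ P setT _ _ (cst M%:E)) => //.
- exact/measurable_EFinP.
- by move=> w _; rewrite lee_fin (le_trans (fM w)) ?ler_norm.
- by apply: finite_measure_integrable_cst.
Qed.

Lemma integrableRD (f g : T -> R) :
  P.-integrable setT (EFin \o f) -> P.-integrable setT (EFin \o g) ->
  P.-integrable setT (fun w => (f w + g w)%:E).
Proof. by move=> fi gi; under eq_fun do rewrite EFinD; exact: integrableD. Qed.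

Lemma integrableRB (f g : T -> R) :
  P.-integrable setT (EFin \o f) -> P.-integrable setT (EFin \o g) ->
  P.-integrable setT (fun w => (f w - g w)%:E).
Proof. by move=> fi gi; under eq_fun do rewrite EFinB; exact: integrableB. Qed.

Lemma integrableR_cst (c : R) : P.-integrable setT (fun=> c%:E).
Proof. exact: finite_measure_integrable_cst. Qed.

Let iX n : P.-integrable setT (EFin \o X n).
Proof.
apply: (@le_integrable _ _ _ P setT _ _ (fun w => (1 + X n w ^+ 2)%:E)) => //.
- exact/measurable_EFinP.
- move=> w _; rewrite lee_fin [leRHS]ger0_norm ?addr_ge0 ?sqr_ge0//.
  by rewrite -(real_normK (num_real (X n w))); have := sqr_ge0 (`|X n w| - 1); nra.
- under eq_fun do rewrite EFinD; apply: integrableD => //.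
  exact: finite_measure_integrable_cst.
Qed.

Let EXn n : (\int[P]_w (X n w)%:E = 0)%E.
Proof.
rewrite -EX integralE [RHS]integralE; congr (_ - _)%E.
- transitivity (\int[P]_w ((EFin : R -> \bar R)^\+ (X n w)))%E.
    by apply: eq_integral => w _; rewrite !funeposE.
  rewrite law_ge0_integral//; last by apply: measurable_funepos; exact/measurable_EFinP.
  by apply: eq_integral => w _; rewrite !funeposE.
- transitivity (\int[P]_w ((EFin : R -> \bar R)^\- (X n w)))%E.
    by apply: eq_integral => w _; rewrite !funenegE.
  rewrite law_ge0_integral//; last by apply: measurable_funeneg; exact/measurable_EFinP.
  by apply: eq_integral => w _; rewrite !funenegE.
Qed.

Let ind0 n (f g : R -> R) M : measurable_fun setT f -> measurable_fun setT g ->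
  (forall x, `|f x| <= M) ->
  P.-integrable setT (fun w => (g (X n w))%:E) ->
  (\int[P]_w (g (X n w))%:E = 0)%E ->
  P.-integrable setT (fun w => (f (S n w) * g (X n w))%:E) /\
  (\int[P]_w (f (S n w) * g (X n w))%:E = 0)%E.
Proof.
move=> mf mg fM ig g0.
apply: (@indep_integral0 _ _ _ P (preimage_set_system setT (S n) measurable)
  (preimage_set_system setT (X n) measurable) _ _ _ _ _
  (f \o S n) (g \o X n) M) => //.
- exact: preimage_system_measurable.
- exact: preimage_system_measurable.
- exact: preimage_system_setI.
- exact: preimage_system_setI.
- by move=> _ _ [A mA <-] [B mB <-]; rewrite !setTI; exact: indX.
- by apply: measurableT_comp => //; exact: preimage_system_fun.
- by apply: measurableT_comp => //; exact: preimage_system_fun.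
- by move=> x; exact: fM.
Qed.

(** This is [n] times the error term of [heat_step] for the increment [x / sqrt n]. *)
Let trunc3 n x : R := Num.min (x ^+ 2) (`|x| ^+ 3 / Num.sqrt n%:R).

Let mtrunc3 n : measurable_fun setT (trunc3 n).
Proof.
apply: measurable_minr; first exact: measurable_funX.
apply: measurable_funM => //; apply: measurable_funX.
by apply: measurableT_comp => //; exact: normr_measurable.
Qed.

Let trunc3_ge0 n x : 0 <= trunc3 n x.
Proof.
by rewrite le_min sqr_ge0/= divr_ge0 ?sqrtr_ge0// exprn_ge0.
Qed.

Let t3 n : R := \int[P]_w trunc3 n (X 0%N w).

Let itrunc3 n m : P.-integrable setT (fun w => (trunc3 n (X m w))%:E).
Proof.
apply: (@le_integrable _ _ _ P setT _ _ (fun w => (X m w ^+ 2)%:E)) => //.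
- by apply/measurable_EFinP; exact: measurableT_comp.
- by move=> w _; rewrite lee_fin ger0_norm// ger0_norm ?sqr_ge0// ge_min lexx.
Qed.

(** Dominated convergence with the square as dominating function: the cubic bound gives the
    pointwise limit and the quadratic one the domination, so no third moment is required. *)
Let t3_cvg0 : t3 n @[n --> \oo] --> 0.
Proof.
have h0 : {ae P, forall w, setT w -> (trunc3 n (X 0%N w))%:E @[n --> \oo] --> (0 : \bar R)}.
  apply: aeW => w _; apply/fine_cvgP; split; first exact: nearW.
  apply: (@squeeze_cvgr _ _ _ _ (cst 0) (fun n => `|X 0%N w| ^+ 3 / Num.sqrt n%:R)).
  - by apply: nearW => n /=; rewrite trunc3_ge0 ge_min lexx orbT.
  - exact: cvg_cst.
  - rewrite -[X in _ --> X](mulr0 (`|X 0%N w| ^+ 3)); apply: cvgMr.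
    apply/gtr0_cvgV0.
      by near=> n; rewrite sqrtr_gt0 ltr0n; near: n; exact: nbhs_infty_gt.
    apply/cvgryPge => A; near=> n.
    have : (`|A| ^+ 2 <= n%:R) by near: n; exact: nbhs_infty_ger.
    move=> /ler_wsqrtr; rewrite sqrtr_sqr normr_id; apply: le_trans; exact: ler_norm.
have [|||||_ _] := @dominated_convergence _ _ _ P setT measurableT
  (fun n w => (trunc3 n (X 0%N w))%:E) (cst 0%E) (fun w => (X 0%N w ^+ 2)%:E) => //.
- by move=> n; exact: measurable_int (itrunc3 n 0).
- apply: aeW => w n _ /=.
  by rewrite lee_fin ger0_norm// ge_min lexx.
rewrite integral0 => /fine_cvgP[_]; exact.
Unshelve. all: by end_near. Qed.


Let mPhi : measurable_fun setT (@Phi R).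
Proof.
apply: continuous_measurable_fun => x.
by apply: differentiable_continuous; apply/derivable1_diffP; have [] := is_derive_Phi x.
Qed.

Let mdPhi : measurable_fun setT (@dPhi R).
Proof. by rewrite dPhiE; exact: measurable_normal_pdf. Qed.

Let mddPhi : measurable_fun setT (@ddPhi R).
Proof. by apply: measurable_funM => //; exact: measurable_funN. Qed.

Let absPhi (x : R) : `|Phi x| <= 1.
Proof. by rewrite ger0_norm ?Phi_ge0// Phi_le1. Qed.

Let maff (a b c : R) : measurable_fun setT (fun x : R => (a - x / b) / c).
Proof.
apply: measurable_funM => //; apply: measurable_funB => //.
exact: measurable_funM.
Qed.

(** The state of the replacement scheme in which [j] summands are present and the remaining
    randomness is Gaussian with variance [s]. *)
Let U n (s a : R) j w := Phi ((a - S j w / Num.sqrt n%:R) / Num.sqrt s).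

Let iU n s a j : P.-integrable setT (EFin \o U n s a j).
Proof.
apply: (@integrable_bounded _ 1) => [|w]; last exact: absPhi.
apply: measurableT_comp => //; exact: (measurableT_comp (maff _ _ _)).
Qed.

Let one_step (kappa : R) : 0 < kappa -> exists2 C : R, 0 <= C &
  forall n j a s, kappa <= s -> (0 < n)%N -> n%:R^-1 <= kappa ->
  `|\int[P]_w U n s a j.+1 w - \int[P]_w U n (s + n%:R^-1) a j w|
    <= C * (t3 n / n%:R + n%:R^-1 ^+ 2).
Proof.
move=> k0; have [C C0 H] := heat_step k0; exists C => // n j a s ks n0 nk.
set r : R := n%:R^-1; pose q : R := Num.sqrt n%:R.
have r0 : 0 <= r by rewrite invr_ge0.
have q2 : q ^+ 2 = n%:R by rewrite sqr_sqrtr.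
have q0 : 0 < q by rewrite sqrtr_gt0 ltr0n.
pose f1 x : R := dPhi ((a - x / q) / Num.sqrt s) / Num.sqrt s / q.
pose f2 x : R := ddPhi ((a - x / q) / Num.sqrt s) / (2 * s) * r.
have mf1 : measurable_fun setT f1.
  do 2 apply: measurable_funM => //; exact: measurableT_comp.
have mf2 : measurable_fun setT f2.
  do 2 apply: measurable_funM => //; exact: measurableT_comp.
have s0 : 0 < s by exact: lt_le_trans ks.
have f1M x : `|f1 x| <= 8 / Num.sqrt s / q.
  rewrite /f1 2!normrM !normfV (ger0_norm (sqrtr_ge0 s)) (ger0_norm (ltW q0)).
  apply: ler_wpM2r; first by rewrite invr_ge0 ltW.
  apply: ler_wpM2r; first by rewrite invr_ge0 sqrtr_ge0.
  rewrite ger0_norm ?dPhi_ge0//.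
  by have := @normX_dPhi_le R 0 ((a - x / q) / Num.sqrt s) isT; rewrite expr0 mul1r.
have f2M x : `|f2 x| <= 8 / (2 * s) * r.
  rewrite /f2 2!normrM normfV (ger0_norm r0) (ger0_norm (_ : 0 <= 2 * s)); last first.
    by rewrite mulr_ge0 ?ltW.
  apply: ler_wpM2r => //; apply: ler_wpM2r; last exact: ddPhi_le.
  by rewrite invr_ge0 mulr_ge0 ?ltW.
have [i1 e1] := @ind0 j f1 id _ mf1 (@measurable_id _ _ _) f1M (iX j) (EXn j).
have mg : measurable_fun setT (fun x : R => x ^+ 2 - 1).
  by apply: measurable_funB => //; exact: measurable_funX.
have iX21 : P.-integrable setT (fun w => (X j w ^+ 2 - 1)%:E).
  under eq_fun do rewrite EFinB; apply: integrableB => //.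
  exact: finite_measure_integrable_cst.
have eX21 : (\int[P]_w (X j w ^+ 2 - 1)%:E = 0)%E.
  under eq_integral do rewrite EFinB.
  rewrite integralB//; last exact: finite_measure_integrable_cst.
  by rewrite EXn2 integral_cst//= probability_setT mule1 subee.
have [i2 e2] := @ind0 j f2 _ _ mf2 mg f2M iX21 eX21.
(* The centered first-order terms are added inside the integral before absolute values are taken;
   afterwards they could no longer cancel. *)
pose L w := f1 (S j w) * X j w - f2 (S j w) * (X j w ^+ 2 - 1).
have iL : P.-integrable setT (EFin \o L).
  exact: integrableRB.
have eL : \int[P]_w L w = 0.
  rewrite RintegralB// /Rintegral.
  by rewrite e1 e2 subr0.
have iUU : P.-integrable setT (EFin \o (fun w => U n s a j.+1 w - U n (s + r) a j w)).
  exact: integrableRB.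
have iUL : P.-integrable setT (EFin \o (fun w => U n s a j.+1 w - U n (s + r) a j w + L w)).
  exact: integrableRD.
rewrite -RintegralB// -[X in `|X|]addr0 -eL -RintegralD//.
apply: (le_trans (le_normr_Rintegral _ _)) => //.
have iA : P.-integrable setT (fun w => (trunc3 n (X j w) / n%:R)%:E).
  by under eq_fun do rewrite EFinM; exact: integrableZr.
have iB := integrableRD iA (integrableR_cst (r ^+ 2)).
have iCB : P.-integrable setT (fun w => (C * (trunc3 n (X j w) / n%:R + r ^+ 2))%:E).
  by under eq_fun do rewrite EFinM; exact: integrableZl.
have -> : C * (t3 n / n%:R + r ^+ 2) =
    \int[P]_w (C * (trunc3 n (X j w) / n%:R + r ^+ 2)).
  rewrite RintegralZl// RintegralD//; last exact: integrableR_cst.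
  rewrite RintegralZr//; last exact: itrunc3.
  rewrite Rintegral_cst//= probability_setT mulr1; congr (C * (_ / _ + _)).
  rewrite /t3 /Rintegral; congr fine; symmetry.
  apply: (@law_ge0_integral j (fun x => (trunc3 n x)%:E)) => [|x].
    exact/measurable_EFinP.
  by rewrite lee_fin.
apply: le_Rintegral => //; first exact: integrable_norm.
move=> w _.
have := H s r (a - S j w / q) (X j w / q) ks; rewrite r0 nk => /(_ isT).
have -> : Num.min ((X j w / q) ^+ 2) (`|X j w / q| ^+ 3) = trunc3 n (X j w) / n%:R.
  rewrite /trunc3 minr_pMl ?invr_ge0// -/q expr_div_n q2; congr (Num.min _ _).
  rewrite normrM normfV (ger0_norm (ltW q0)) expr_div_n.
  by rewrite (exprSr q) q2; field; rewrite !gt_eqF ?ltr0n.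
apply: le_trans; rewrite le_eqVlt; apply/orP; left; apply/eqP; congr `|_|.
rewrite /U /S big_ord_recr/= -/(S j w) /L /f1 /f2 -/q.
have -> : a - (S j w + X j w) / q = a - S j w / q - X j w / q by ring.
have rq : r = (q ^+ 2)^-1 by rewrite q2.
move: (Phi _) (Phi _) (dPhi _) (ddPhi _) => A B D E.
by rewrite rq; field; rewrite !gt_eqF// sqrtr_gt0.
Qed.

(** Over the [n] exchanges the errors sum to a multiple of [t3 n + 1 / n]. The extra variance
    [kappa] smooths the test function so that every exchange takes place at a time at least
    [kappa]. *)
Lemma smooth_clt (kappa a : R) : 0 < kappa ->
  \int[P]_w Phi ((a - S n w / Num.sqrt n%:R) / Num.sqrt kappa) @[n --> \oo]
    --> Phi (a / Num.sqrt (kappa + 1)).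
Proof.
move=> k0; have [C C0 H] := one_step k0.
have main n : (0 < n)%N -> n%:R^-1 <= kappa ->
    `|\int[P]_w U n kappa a n w - Phi (a / Num.sqrt (kappa + 1))|
    <= C * (t3 n + n%:R^-1).
  move=> n0 nk.
  (* After [j] summands the Gaussian part still to be accounted for has variance [(n - j) / n], on
     top of [kappa]. *)
  have tele j : (j <= n)%N ->
    `|\int[P]_w U n (kappa + (n - j)%:R / n%:R) a j w - \int[P]_w U n (kappa + 1) a 0 w|
     <= j%:R * (C * (t3 n / n%:R + n%:R^-1 ^+ 2)).
    elim: j => [_|j IH jn].
      by rewrite subn0 divff ?pnatr_eq0 -?lt0n// subrr normr0 mul0r.
    have s1 : kappa + (n - j.+1)%:R / n%:R + n%:R^-1 = kappa + (n - j)%:R / n%:R.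
      by rewrite !natrB ?(ltnW jn)// -natr1; field; rewrite pnatr_eq0 -lt0n.
    have := H n j a (kappa + (n - j.+1)%:R / n%:R) _ n0 nk.
    rewrite s1 lerDl divr_ge0// => /(_ isT) h1.
    have := le_trans (ler_normD _ _) (lerD h1 (IH (ltnW jn))).
    rewrite addrA subrK => /le_trans; apply.
    by rewrite -natr1 mulrDl mul1r addrC.
  have := tele n (leqnn n); rewrite subnn mul0r addr0.
  have -> : \int[P]_w U n (kappa + 1) a 0 w = Phi (a / Num.sqrt (kappa + 1)).
    under eq_Rintegral do rewrite /U /S big_ord0 mul0r subr0.
    by rewrite Rintegral_cst//= probability_setT mulr1.
  move/le_trans; apply; rewrite le_eqVlt; apply/orP; left; apply/eqP.
  by field; rewrite pnatr_eq0 -lt0n.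
apply/cvgrPdist_le => e e0.
have : (fun n => C * (t3 n + n%:R^-1)) @ \oo --> C * (0 + 0).
  apply: cvgMr; apply: cvgD; first exact: t3_cvg0.
  apply/gtr0_cvgV0; last exact: cvgr_idn.
  by near=> n; rewrite ltr0n; near: n; exact: nbhs_infty_gt.
rewrite addr0 mulr0 => /cvgr0Pnorm_le /(_ e e0) Hn.
near=> n; rewrite distrC; apply: (@le_trans _ _ (C * (t3 n + n%:R^-1))).
  apply: main; first by near: n; exact: nbhs_infty_gt.
  rewrite invf_ple ?posrE ?ltr0n//; last by near: n; exact: nbhs_infty_gt.
  by near: n; exact: nbhs_infty_ger.
by apply: (le_trans (ler_norm _)); near: n.
Unshelve. all: by end_near. Qed.

(* Smoothing at scale [sqrt kappa = delta ^+ 2] of the indicator shifted by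
   [delta]. *)
Lemma clt (x : R) :
  fine (P [set w | S n w / Num.sqrt n%:R <= x]) @[n --> \oo] --> Phi x.
Proof.
pose Y n w := S n w / Num.sqrt n%:R.
have mY n : measurable_fun setT (Y n) by exact: measurable_funM.
have mle n : measurable [set w | Y n w <= x].
  rewrite (_ : [set w | _] = Y n @^-1` `]-oo, x]).
    by rewrite -[X in measurable X]setTI; exact: mY.
  by apply/seteqP; split => w /=; rewrite in_itv.
have PE n : fine (P [set w | Y n w <= x]) = \int[P]_w (\1_[set w | Y n w <= x] w).
  by rewrite /Rintegral integral_indic// setIT.
have iI n : P.-integrable setT (fun w => (\1_[set w | Y n w <= x] w : R)%:E).
  apply: (@integrable_bounded _ 1) => // w.
  by rewrite ger0_norm// indicE; case: (_ \in _).
have dd : (d : R) @[d --> 0^'+] --> (0 : R) by exact: cvg_at_right_filter.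
have d0 : (d : R)^-1 @[d --> 0^'+] --> +oo.
  by apply/cvgrVy => //; near=> y; near: y; exact: nbhs_right_gt.
have cont (f : R -> R) : f d @[d --> 0^'+] --> x -> Phi (f d) @[d --> 0^'+] --> Phi x.
  move=> fx; apply: (cvg_comp f (@Phi R) fx).
  by apply: differentiable_continuous; apply/derivable1_diffP; have [] := is_derive_Phi x.
have sd : (Num.sqrt (d ^+ 4 + 1))^-1 @[d --> 0^'+] --> (1 : R).
  have h : (d : R) ^+ 4 + 1 @[d --> 0^'+] --> (0 ^+ 4 + 1 : R).
    by apply: cvgD; [exact: (cvg_comp _ (fun y : R => y ^+ 4) dd (@exprn_continuous R 4 0))|exact: cvg_cst].
  rewrite expr0n /= add0r in h.
  have := cvg_comp _ _ h (@sqrt_continuous R 1); rewrite sqrtr1 => h2.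
  rewrite -[X in _ --> X]invr1; apply: cvgV; first exact: oner_neq0.
  exact: h2.
apply/cvgrPdist_le => e e0.
have e3 : 0 < e / 4 by rewrite divr_gt0.
have c1 : Phi ((x + d) / Num.sqrt (d ^+ 4 + 1)) @[d --> 0^'+] --> Phi x.
  apply: cont; have h := cvgM (cvgD (cvg_cst x) dd) sd.
  by rewrite addr0 mulr1 in h; exact: h.
have c2 : Phi ((x - d) / Num.sqrt (d ^+ 4 + 1)) @[d --> 0^'+] --> Phi x.
  apply: cont; have h := cvgM (cvgB (cvg_cst x) dd) sd.
  by rewrite subr0 mulr1 in h; exact: h.
have c3 : Phi (d^-1) @[d --> 0^'+] --> (1 : R) by apply: cvg_comp d0 (@cvg_Phi_y1 R).
have c4 : Phi (- d^-1) @[d --> 0^'+] --> (0 : R).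
  by apply: cvg_comp (@cvg_Phi_Ny0 R); exact/cvgNrNy.
(* Two errors come from moving and rescaling the argument of [Phi], two from smoothing the
   indicator: the shift [dl] is [dl^-1] times the smoothing width [dl ^+ 2]. *)
have [dl [dl0 [h1 h2 h3 h4]]] : exists dl : R, 0 < dl /\
    [/\ `|Phi x - Phi ((x + dl) / Num.sqrt (dl ^+ 4 + 1))| <= e / 4,
        `|Phi x - Phi ((x - dl) / Num.sqrt (dl ^+ 4 + 1))| <= e / 4,
        `|1 - Phi dl^-1| <= e / 4 & `|0 - Phi (- dl^-1)| <= e / 4].
  near (0 : R)^'+ => dl; exists dl; split; first by near: dl; exact: nbhs_right_gt.
  split; near: dl; [move/cvgrPdist_le: c1|move/cvgrPdist_le: c2|
    move/cvgrPdist_le: c3|move/cvgrPdist_le: c4]; exact.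
have k0 : 0 < dl ^+ 4 by rewrite exprn_gt0.
have sk : Num.sqrt (dl ^+ 4) = dl ^+ 2.
  by rewrite (exprM dl 2 2) sqrtr_sqr ger0_norm// sqr_ge0.
have /cvgrPdist_le/(_ _ e3) u1 := @smooth_clt (dl ^+ 4) (x + dl) k0.
have /cvgrPdist_le/(_ _ e3) u2 := @smooth_clt (dl ^+ 4) (x - dl) k0.
have upper n : fine (P [set w | Y n w <= x]) <=
    \int[P]_w Phi ((x + dl - Y n w) / Num.sqrt (dl ^+ 4)) + (1 - Phi dl^-1).
  have -> : 1 - Phi dl^-1 = \int[P]_w (1 - Phi dl^-1).
    by rewrite Rintegral_cst//= probability_setT mulr1.
  rewrite PE -RintegralD//; last 2 first.
  - exact: iU.
  - exact: integrableR_cst.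
  apply: le_Rintegral => //; first exact: iI.
    exact: (integrableRD (iU n (dl ^+ 4) (x + dl) n) (integrableR_cst _)).
  move=> w _; rewrite indicE sk; have := Phi_le1 dl^-1.
  have := Phi_ge0 ((x + dl - Y n w) / dl ^+ 2).
  case: (boolP (w \in _)) => [|_]; last by rewrite /=; lra.
  rewrite inE /= => Yx _ _.
  suff : Phi dl^-1 <= Phi ((x + dl - Y n w) / dl ^+ 2) by lra.
  apply: Phi_nd; rewrite ler_pdivlMr ?exprn_gt0// expr2 mulrA mulVf ?gt_eqF// mul1r.
  by lra.
have lower n : \int[P]_w Phi ((x - dl - Y n w) / Num.sqrt (dl ^+ 4)) - Phi (- dl^-1)
    <= fine (P [set w | Y n w <= x]).
  have -> : Phi (- dl^-1) = \int[P]_w Phi (- dl^-1).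
    by rewrite Rintegral_cst//= probability_setT mulr1.
  rewrite PE -RintegralB//; last 2 first.
  - exact: iU.
  - exact: integrableR_cst.
  apply: le_Rintegral => //; first exact: (integrableRB (iU n (dl ^+ 4) (x - dl) n) (integrableR_cst _)).
    exact: iI.
  move=> w _; rewrite indicE sk; have := Phi_ge0 (- dl^-1).
  have := Phi_le1 ((x - dl - Y n w) / dl ^+ 2).
  case: (boolP (w \in _)) => [_|]; first by rewrite /=; lra.
  rewrite notin_setE /= => /negP; rewrite -ltNge => Yx _ _.
  suff : Phi ((x - dl - Y n w) / dl ^+ 2) <= Phi (- dl^-1) by lra.
  apply: Phi_nd; rewrite ler_pdivrMr ?exprn_gt0// expr2 mulNr mulrA mulVf ?gt_eqF// mul1r.
  by lra.
apply: filterS2 u1 u2 => n; have := upper n; have := lower n.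
move: h1 h2 h3 h4; rewrite /S; set I1 := (\int[P]_w _); set I2 := (\int[P]_w _).
move: I1 I2 (fine _) (Phi dl^-1) (Phi (- dl^-1)) => I1 I2 p p1 p2.
move: (Phi x) (Phi _) (Phi ((x - dl) / _)) => a1 a2 a3.
rewrite !ler_norml => /andP[h1 h2] /andP[h3 h4] /andP[h5 h6] /andP[h7 h8] h9 h10.
move=> /andP[h11 h12] /andP[h13 h14].
by apply/andP; split; lra.
Unshelve. all: by end_near. Qed.

End clt.

(** * The law of a particle given the environment and the other particles *)

Lemma big_fset_seq (U : choiceType) (V : Type) (idx : V) (op : Monoid.com_law idx)
  (A : {fset U}) (s : seq U) (F : U -> V) : uniq s -> A =i s ->
  \big[op/idx]_(j <- A) F j = \big[op/idx]_(j <- s) F j.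
Proof. by move=> us As; apply: perm_big; apply: uniq_perm => //; exact: fset_uniq. Qed.

Lemma emeasurable_prod d (T : measurableType d) (R : realType) (D : set T) (I : Type)
  (s : seq I) (h : I -> T -> \bar R) : (forall i, measurable_fun D (h i)) ->
  measurable_fun D (fun x => \prod_(i <- s) h i x)%E.
Proof.
move=> mh; elim: s => [|i s IH].
  by under eq_fun do rewrite big_nil; exact: measurable_cst.
by under eq_fun do rewrite big_cons; exact: emeasurable_funM.
Qed.

Section environment.
Local Open Scope ereal_scope.
Context d (T : measurableType d) (R : realType) (P : probability T R).
Variables (Q : nat -> {RV P >-> Delta R}).
Variables (N : nat -> nat -> {RV P >-> nat}) (Y : nat -> {RV P >-> nat}).
Hypothesis HZ : bpire_data Q N Y.

(* Immigrants are treated as the particle number [0] of their generation. *)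
Definition particle (n i : nat) : {RV P >-> nat} :=
  if i is i'.+1 then N n i' else Y n.

Definition particle_law (i : nat) (q : Delta R) : probability nat R :=
  if i is _.+1 then q.1 else q.2.

Let X := particle.
Let law n i w := particle_law i (Q n w).

Lemma measurable_particle_law i (B : set nat) :
  measurable_fun setT (fun q : Delta R => particle_law i q B).
Proof.
have h : measurable_fun setT (fun f : pprobability nat R => f B).
  exact: (measurable_kernel (kprobability (@measurable_id _ (pprobability nat R) setT))).
by case: i => [|i] /=; apply: (measurableT_comp h);
  [exact: measurable_snd|exact: measurable_fst].
Qed.

Definition cylinder (A : nat -> nat -> set nat) : set T :=
  [set w | forall n i, A n i (X n i w)].

(** Generations stop before [M], but particle numbers run up to [M] included: number [0] is the
    immigration, so [M] offspring variables are left. *)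
Definition bounded_support (M : nat) (A : nat -> nat -> set nat) :=
  forall n i, (M <= n)%N || (M < i)%N -> A n i = setT.

Definition cylinder_law M (A : nat -> nat -> set nat) (w : T) : \bar R :=
  \prod_(0 <= n < M) \prod_(0 <= i < M.+1) law n i w (A n i).

(** The quenched product formula on a rectangle of indices; the shift of the particle number by one
    merges immigration and offspring into a single double product. *)
Lemma cylinder_prob M A E : bounded_support M A -> <<s generators Q >> E ->
  P (cylinder A `&` E) = \int[P]_(w in E) cylinder_law M A w.
Proof.
move=> supp sE.
pose s := [seq (n, i) | n <- iota 0 M, i <- iota 0 M].
have us : uniq s by apply: allpairs_uniq; rewrite ?iota_uniq// => -[? ?] [? ?].
have := particles_quenched HZ.
move/(_ [fset x in s]%fset [fset x in iota 0 M]%fset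
   (fun n i => A n i.+1) (fun n => A n 0%N)) => [_ /(_ _ sE)].
have -> : cylinder A = \bigcap_(j in [set` [fset x in s]%fset]) N j.1 j.2 @^-1` A j.1 j.2.+1
    `&` \bigcap_(n in [set` [fset x in iota 0 M]%fset]) Y n @^-1` A n 0%N.
  apply/seteqP; split => [w cw|w [h1 h2] n i].
    by split => [[n i] _|n _]; [exact: (cw n i.+1)|exact: (cw n 0%N)].
  have [Mn|nM] := leqP M n; first by rewrite supp ?Mn.
  case: i => [|i].
    by apply: h2; rewrite /= !inE mem_iota.
  have [Mi|iM] := leqP M i; first by rewrite supp// ltnS Mi orbT.
  apply: (h1 (n, i)); rewrite /= !inE; apply/allpairsP; exists (n, i).
  by rewrite !mem_iota.
move=> ->; apply: eq_integral => w _; rewrite (@big_fset_seq _ _ _ _ _ _ _ us) => [|x]; last by rewrite !inE.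
rewrite (@big_fset_seq _ _ _ _ _ _ _ (iota_uniq 0 M)) => [|x]; last by rewrite !inE.
rewrite /s big_allpairs_dep/= /cylinder_law /index_iota !subn0.
rewrite -big_split/=; apply: eq_bigr => n _.
by rewrite big_cons muleC (iotaDl 1 0 M) big_map.
Qed.

Lemma cylinderI A B :
  cylinder A `&` cylinder B = cylinder (fun n i => A n i `&` B n i).
Proof.
apply/seteqP; split => [w [wA wB] n i|w wAB]; first by split; [exact: wA|exact: wB].
by split => n i; have [] := wAB n i.
Qed.

Lemma bounded_supportI M M' A B : bounded_support M A -> bounded_support M' B ->
  bounded_support (maxn M M') (fun n i => A n i `&` B n i).
Proof.
move=> sA sB n i; rewrite geq_max gtn_max => h.
have [hA hB] : (M <= n)%N || (M < i)%N /\ (M' <= n)%N || (M' < i)%N.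
  by case/orP: h => /andP[-> ->]; rewrite ?orbT.
by rewrite sA// sB// setTI.
Qed.

Lemma measurable_cylinder A : measurable (cylinder A).
Proof.
rewrite (_ : cylinder A = \bigcap_n \bigcap_i (X n i @^-1` A n i)).
  apply: bigcapT_measurable => n; apply: bigcapT_measurable => i.
  by rewrite -[X in measurable X]setTI; exact: (measurable_funP (X n i)).
by apply/seteqP; split => [w cw n _ i _|w cw n i]; [exact: cw|exact: cw].
Qed.

Lemma generators_measurable : generators Q `<=` measurable.
Proof. by move=> _ [n _ [D mD <-]]; exact: (measurable_funP (Q n)). Qed.

Lemma sigma_generators_measurable : <<s generators Q >> `<=` measurable.
Proof.
by apply: smallest_sub; [exact: sigma_algebra_measurable|exact: generators_measurable].
Qed.

Lemma environment_measurable n : measurable_fun [set: g_sigma_algebraType (generators Q)] (Q n).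
Proof. by move=> _ B mB; apply: sub_sigma_algebra; exists n => //; exists B. Qed.

Lemma measurable_law n i (B : set nat) :
  measurable_fun [set: g_sigma_algebraType (generators Q)] (fun w => law n i w B).
Proof.
exact: (measurableT_comp (measurable_particle_law i B) (environment_measurable n)).
Qed.

Lemma measurable_cylinder_law M A :
  measurable_fun [set: g_sigma_algebraType (generators Q)] (cylinder_law M A).
Proof.
apply: emeasurable_prod => n; apply: emeasurable_prod => i; exact: measurable_law.
Qed.

Lemma cylinder_law_ge0 M A w : 0 <= cylinder_law M A w.
Proof. by apply: prode_ge0 => n _; apply: prode_ge0. Qed.

Lemma cylinder_law_integral M A phi : bounded_support M A ->
  measurable_fun [set: g_sigma_algebraType (generators Q)] phi ->
  (forall w, 0 <= phi w) ->
  \int[P]_(w in cylinder A) phi w = \int[P]_w (phi w * cylinder_law M A w).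
Proof.
move=> supp mphi phi0; rewrite integral_mkcond epatch_indic.
apply: (@sub_sigma_integral _ _ _ P (generators Q)) => //.
- exact: generators_measurable.
- exact/measurable_EFinP/measurable_indic/measurable_cylinder.
- apply: g_sigma_measurable_fun; first exact: generators_measurable.
  exact: measurable_cylinder_law.
- by move=> x; rewrite lee_fin.
- exact: cylinder_law_ge0.
move=> C sC; rewrite integral_indic; [|exact: sigma_generators_measurable|exact: measurable_cylinder].
exact: cylinder_prob.
Qed.

(* All the environment together with the particles [(n, i)] in [I]. *)
Definition full_system (I : nat -> nat -> Prop) : set (set T) :=
  [set C | exists E A M, [/\ <<s generators Q >> E, bounded_support M A,
     forall n i, ~ I n i -> A n i = setT & C = E `&` cylinder A]].

Lemma full_system_measurable I : full_system I `<=` measurable.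
Proof.
move=> _ [E [A [M [sE _ _ ->]]]].
by apply: measurableI; [exact: sigma_generators_measurable|exact: measurable_cylinder].
Qed.

Lemma full_system_setI I : setI_closed (full_system I).
Proof.
move=> _ _ [E [A [M [sE sA IA ->]]]] [F [B [M' [sF sB IB ->]]]].
exists (E `&` F), (fun n i => A n i `&` B n i), (maxn M M'); split.
- exact: (@measurableI _ (g_sigma_algebraType (generators Q))).
- exact: bounded_supportI.
- by move=> n i nI; rewrite IA// IB// setTI.
- by rewrite -cylinderI setIACA.
Qed.

Lemma cylinderT : cylinder (fun _ _ => setT) = setT.
Proof. exact/seteqP. Qed.

Lemma full_system_environment I n :
  measurable_fun [set: g_sigma_algebraType (full_system I)] (Q n).
Proof.
move=> _ B mB; apply: sub_sigma_algebra.
exists (setT `&` Q n @^-1` B), (fun _ _ => setT), 0%N; split => //.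
- exact: environment_measurable.
- by rewrite cylinderT setIT.
Qed.

Lemma full_system_particle (I : nat -> nat -> Prop) n i : I n i ->
  measurable_fun [set: g_sigma_algebraType (full_system I)] (X n i).
Proof.
move=> In _ B mB; apply: sub_sigma_algebra.
exists setT, (fun n' i' => if (n' == n) && (i' == i) then B else setT), (maxn n i).+1.
split.
- exact: (@measurableT _ (g_sigma_algebraType (generators Q))).
- move=> n' i' h; case: andP => // -[/eqP nn /eqP ii]; move: h.
  by rewrite nn ii => /orP[]; rewrite ltnNge ?leq_maxl// leqW// leq_maxr.
- by move=> n' i' nI; case: andP => // -[/eqP nn /eqP ii]; rewrite nn ii in nI.
- rewrite !setTI; apply/seteqP; split => [w Bw n' i'|w /(_ n i)].
    by case: andP => // -[/eqP -> /eqP ->].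
  by rewrite !eqxx.
Qed.

(* Given the environment and the other particles, [X n i] has law [law n i]. *)
Lemma particle_integral1 (I : nat -> nat -> Prop) n i (b : nat) (phi : T -> \bar R) :
  ~ I n i -> measurable_fun [set: g_sigma_algebraType (full_system I)] phi ->
  (forall w, 0 <= phi w) ->
  \int[P]_w (phi w * (\1_(X n i @^-1` [set b]) w)%:E) =
  \int[P]_w (phi w * law n i w [set b]).
Proof.
move=> nI mphi phi0.
have mX : measurable (X n i @^-1` [set b]).
  by rewrite -[X in measurable X]setTI; exact: (measurable_funP (X n i)).
have mlaw : measurable_fun setT (fun w => law n i w [set b]).
  apply: g_sigma_measurable_fun; first exact: generators_measurable.
  exact: measurable_law.
have mind : measurable_fun setT (fun w => (\1_(X n i @^-1` [set b]) w : R)%:E).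
  exact/measurable_EFinP/measurable_indic.
have main C : full_system I C -> \int[P]_(w in C) (\1_(X n i @^-1` [set b]) w)%:E =
    \int[P]_(w in C) law n i w [set b].
  move=> FC; have mC := full_system_measurable FC.
  rewrite integral_indic//.
  case: FC => E [A0 [M0 [sE sA0 IA0 CE]]].
  (* The bounding rectangle is enlarged to contain [(n, i)], where the cylinder imposes no
     condition. *)
  have [M [A [sA IA nM iM cA]]] : exists M A, [/\ bounded_support M A,
      A n i = setT, (n < M)%N, (i <= M)%N & cylinder A = cylinder A0].
    exists (maxn M0 (maxn n i).+1), (fun n i => A0 n i `&` setT); split.
    - by apply: bounded_supportI.
    - by rewrite IA0// setIT.
    - by rewrite leq_max ltnS leq_maxl orbT.
    - by rewrite leq_max (leqW (leq_maxr _ _)) orbT.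
    - by congr cylinder; apply/funext => ?; apply/funext => ?; rewrite setIT.
  rewrite CE -cA.
  (* The event that the particle takes the value [b] is added as one more condition of the
     cylinder. *)
  pose B n' i' := if (n' == n) && (i' == i) then [set b] else A n' i'.
  have sB : bounded_support M B.
    move=> n' i' h; rewrite /B; case: andP => [[/eqP nn /eqP ii]|_]; last exact: sA.
    by move: h; rewrite nn ii leqNgt nM ltnNge iM.
  have -> : X n i @^-1` [set b] `&` (E `&` cylinder A) = cylinder B `&` E.
    rewrite setIC -setIA setIC; congr (_ `&` _).
    apply/seteqP; split => [w [cw /= Xw] n' i'|w cw].
      by rewrite /B; case: andP => [[/eqP -> /eqP ->]//|_]; exact: cw.
    have Xb : X n i w = b by have := cw n i; rewrite /B !eqxx.
    split => // n' i'; have := cw n' i'; rewrite /B.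
    by case: andP => [[/eqP -> /eqP ->]|//]; rewrite IA.
  transitivity (\int[P]_(w in E) cylinder_law M B w); first exact: cylinder_prob.
  have mE : measurable E by exact: sigma_generators_measurable.
  rewrite [RHS]integral_mkcondl.
  rewrite (@cylinder_law_integral M A) //; last 2 first.
  - rewrite epatch_indic; apply: emeasurable_funM; first exact: measurable_law.
    by apply/measurable_EFinP; exact: measurable_indic.
  - by move=> w; rewrite epatch_indic mule_ge0// lee_fin.
  rewrite [LHS]integral_mkcond; apply: eq_integral => w _.
  rewrite !epatch_indic/= muleAC; congr (_ * _).
  have /andP[nM' iM'] : (0 <= n < M)%N && (0 <= i < M.+1)%N by rewrite nM ltnS iM.
  set c := law n i w [set b].
  (* Passing from [A] to [B] changes a single factor of the double product: the mass of the whole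
     space becomes [c]. *)
  have inner n' : \prod_(0 <= i' < M.+1) law n' i' w (B n' i') =
      (\prod_(0 <= i' < M.+1) law n' i' w (A n' i')) * (if n' == n then c else 1).
    have -> : (if n' == n then c else 1) =
        \prod_(0 <= i' < M.+1 | i' == i) (if n' == n then c else 1).
      by rewrite big_nat1_eq iM'.
    rewrite [X in _ * X]big_mkcond -big_split/=; apply: eq_bigr => i' _.
    rewrite /B; have [->|_] := eqVneq n' n; have [->|_] := eqVneq i' i;
      rewrite ?mule1//=.
    by rewrite IA probability_setT mul1e.
  rewrite /cylinder_law (eq_bigr _ (fun n' _ => inner n')) big_split/=.
  by rewrite muleC; congr (_ * _); rewrite -big_mkcond big_nat1_eq nM'.
apply: (@sub_sigma_integral _ _ _ P (full_system I)) => //.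
- exact: full_system_measurable.
apply: pi_system_integral_set => //.
- exact: full_system_measurable.
- exact: full_system_setI.
- by rewrite integral_indic// setIT (le_lt_trans (probability_le1 _ _))// ltry.
- apply: main; exists setT, (fun _ _ => setT), 0%N; split => //.
  + exact: (@measurableT _ (g_sigma_algebraType (generators Q))).
  + by rewrite cylinderT setIT.
Qed.

(** The integrand is split along the value of the particle. Letting [phi] depend on this value makes
    it possible to average any nonnegative function of the particle and of the variables in the
    conditioning. *)
Lemma particle_integral (I : nat -> nat -> Prop) n i (phi : T -> nat -> \bar R) :
  ~ I n i ->
  (forall b, measurable_fun [set: g_sigma_algebraType (full_system I)] (phi ^~ b)) ->
  (forall w b, 0 <= phi w b) ->
  \int[P]_w phi w (X n i w) =
  \int[P]_w (\sum_(b <oo) (phi w b * law n i w [set b])).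
Proof.
move=> nI mphi phi0.
have mphi' b : measurable_fun [set: T] (phi ^~ b).
  by apply: g_sigma_measurable_fun (mphi b); exact: full_system_measurable.
have mX b : measurable (X n i @^-1` [set b]).
  by rewrite -[X in measurable X]setTI; exact: (measurable_funP (X n i)).
rewrite integral_nneseries//; last 2 first.
- move=> b; apply: emeasurable_funM => //.
  apply: g_sigma_measurable_fun; first exact: generators_measurable.
  exact: measurable_law.
- by move=> b w _; rewrite mule_ge0.
under [RHS]eq_eseriesr do rewrite -(@particle_integral1 I)//.
rewrite -integral_nneseries//; last 2 first.
- move=> b; apply: emeasurable_funM => //.
  by apply/measurable_EFinP; exact: measurable_indic.
- by move=> b w _; rewrite mule_ge0// lee_fin.
apply: eq_integral => w _.
rewrite (@nneseriesD1 _ _ (X n i w))//; last first.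
  by move=> b _; rewrite mule_ge0// lee_fin.
rewrite eseries0 => [|b _ /negP bX]; last first.
  rewrite indicE memNset ?mule0//= => Xb.
  by apply: bX; rewrite Xb.
by rewrite adde0 indicE mem_set ?mule1.
Qed.

Lemma full_systemS (I I' : nat -> nat -> Prop) : (forall n i, I n i -> I' n i) ->
  full_system I `<=` full_system I'.
Proof.
move=> II' _ [E [A [M [sE sA IA ->]]]]; exists E, A, M; split => // n i nI.
by apply: IA => /II'.
Qed.

Definition environment_cylinder (D : nat -> set (Delta R)) : set T :=
  [set w | forall j, D j (Q j w)].

Lemma environment_cylinder_sigma D : (forall j, measurable (D j)) ->
  <<s generators Q >> (environment_cylinder D).
Proof.
move=> mD; rewrite (_ : environment_cylinder D = \bigcap_j (Q j @^-1` D j)).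
  apply: (@bigcapT_measurable _ (g_sigma_algebraType (generators Q))) => j.
  by rewrite -[X in measurable X]setTI; exact: environment_measurable.
by apply/seteqP; split => [w cw j _|w cw j]; [exact: cw|exact: cw].
Qed.

Definition environment_past (n : nat) : set (set T) :=
  [set C | exists2 D, (forall j, measurable (D j)) /\
     (forall j, (n <= j)%N -> D j = setT) & C = environment_cylinder D].

Lemma environment_past_measurable n : environment_past n `<=` measurable.
Proof.
move=> _ [D [mD _] ->]; apply: sigma_generators_measurable.
exact: environment_cylinder_sigma.
Qed.

Lemma environment_cylinderI C D :
  environment_cylinder C `&` environment_cylinder D =
  environment_cylinder (fun j => C j `&` D j).
Proof.
apply/seteqP; split => [w [wA wB] j|w wAB]; first by split; [exact: wA|exact: wB].
by split => j; have [] := wAB j.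
Qed.

Lemma environment_past_setI n : setI_closed (environment_past n).
Proof.
move=> _ _ [C [mC TC] ->] [D [mD TD] ->].
exists (fun j => C j `&` D j); last exact: environment_cylinderI.
by split => j; [exact: measurableI|move=> nj; rewrite TC// TD// setTI].
Qed.

Lemma environment_past_fun n j : (j < n)%N ->
  measurable_fun [set: g_sigma_algebraType (environment_past n)] (Q j).
Proof.
move=> jn _ B mB; apply: sub_sigma_algebra; rewrite setTI.
exists (fun j' => if j' == j then B else setT).
  split => j'; first by case: ifP.
  by move=> nj'; case: eqP => // jj; move: jn; rewrite -jj ltnNge nj'.
apply/seteqP; split => [w Bw j'|w /(_ j)]; last by rewrite eqxx.
by case: eqP => // ->.
Qed.

Lemma environment_past_indep n A B : environment_past n A ->
  preimage_set_system setT (Q n) measurable B -> P (A `&` B) = P A * P B.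
Proof.
move=> [D [mD TD] ->] [C mC <-]; rewrite setTI.
have [ind _] := environment_iid HZ.
pose D' j := if j == n then C else D j.
have E (m : nat) (F : nat -> set (Delta R)) : (forall j, (m <= j)%N -> F j = setT) ->
    (forall j, measurable (F j)) ->
    P (environment_cylinder F) = \prod_(0 <= j < m) P (Q j @^-1` F j).
  move=> TF mF; have := ind [fset x in iota 0 m]%fset F mF.
  rewrite (@big_fset_seq _ _ _ _ _ _ _ (iota_uniq 0 m)) => [|x]; last by rewrite !inE.
  rewrite /index_iota subn0 => <-; congr (P _).
  apply/seteqP; split => [w cw j _|w cw j]; first exact: cw.
  have [mj|jm] := leqP m j; first by rewrite TF.
  by apply: cw; rewrite /= !inE mem_iota.
have -> : environment_cylinder D `&` Q n @^-1` C = environment_cylinder D'.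
  apply/seteqP; split => [w [cw Cw] j|w cw].
    by rewrite /D'; case: eqP => [->|_]; [exact: Cw|exact: cw].
  split => [j|]; last by have := cw n; rewrite /D' eqxx.
  by have := cw j; rewrite /D'; case: eqP => [->|//]; rewrite TD.
rewrite (E n.+1 D'); last 2 first.
- by move=> j nj; rewrite /D' gtn_eqF// TD// ltnW.
- by move=> j; rewrite /D'; case: eqP.
rewrite (E n D)// big_nat_recr//= /D' eqxx; congr (_ * _).
by apply: eq_big_nat => j /andP[_ jn]; rewrite ltn_eqF.
Qed.

(* The environments and particles of the generations before [n]. *)
Definition past_system (n : nat) : set (set T) :=
  [set C | exists D A M, [/\ (forall j, measurable (D j)) /\
       (forall j, (n <= j)%N -> D j = setT),
     bounded_support M A, forall n' i, (n <= n')%N -> A n' i = setT &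
     C = environment_cylinder D `&` cylinder A]].

Lemma past_system_measurable n : past_system n `<=` measurable.
Proof.
move=> _ [D [A [M [[mD _] _ _ ->]]]].
apply: measurableI; last exact: measurable_cylinder.
by apply: sigma_generators_measurable; exact: environment_cylinder_sigma.
Qed.

Lemma past_system_setI n : setI_closed (past_system n).
Proof.
move=> _ _ [C [A [M [[mC TC] sA TA ->]]]] [D [B [M' [[mD TD] sB TB ->]]]].
exists (fun j => C j `&` D j), (fun n i => A n i `&` B n i), (maxn M M'); split.
- by split => j; [exact: measurableI|move=> nj; rewrite TC// TD// setTI].
- exact: bounded_supportI.
- by move=> n' i nI; rewrite TA// TB// setTI.
- by rewrite -cylinderI -environment_cylinderI setIACA.
Qed.

Lemma past_system_full n (I : nat -> nat -> Prop) :
  (forall n' i, (n' < n)%N -> I n' i) -> past_system n `<=` full_system I.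
Proof.
move=> nI _ [D [A [M [[mD TD] sA TA ->]]]].
exists (environment_cylinder D), A, M; split => //.
  exact: environment_cylinder_sigma.
move=> n' i nI'; apply: TA; rewrite leqNgt; apply/negP => /nI - /(_ i); exact: nI'.
Qed.

Lemma past_systemS n n' : (n <= n')%N -> past_system n `<=` past_system n'.
Proof.
move=> nn' _ [D [A [M [[mD TD] sA TA ->]]]]; exists D, A, M; split => //.
- by split => // j /(leq_trans nn'); exact: TD.
- by move=> m i /(leq_trans nn'); exact: TA.
Qed.

Lemma past_system_environment n j : (j < n)%N ->
  measurable_fun [set: g_sigma_algebraType (past_system n)] (Q j).
Proof.
move=> jn; apply: g_sigma_measurable_funS (environment_past_fun jn).
move=> _ [D [mD TD] ->]; apply: sub_sigma_algebra.
by exists D, (fun _ _ => setT), 0%N; split => //; rewrite cylinderT setIT.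
Qed.

Lemma past_system_particle n n' i : (n' < n)%N ->
  measurable_fun [set: g_sigma_algebraType (past_system n)] (X n' i).
Proof.
move=> n'n _ B mB; apply: sub_sigma_algebra; rewrite setTI.
exists (fun=> setT), (fun n1 i1 => if (n1 == n') && (i1 == i) then B else setT),
  (maxn n' i).+1.
split => //.
- move=> n1 i1 h; case: andP => // -[/eqP nn /eqP ii]; move: h.
  by rewrite nn ii => /orP[]; rewrite ltnNge ?leq_maxl// leqW// leq_maxr.
- by move=> n1 i1 nn1; case: andP => // -[/eqP nn _]; move: n'n; rewrite -nn ltnNge nn1.
- apply/seteqP; split => [w Bw|w [_ /(_ n' i)]]; last by rewrite !eqxx.
  by split => // n1 i1; case: andP => // -[/eqP -> /eqP ->].
Qed.

(** Given the environment, the probability of a cylinder of particles before generation [n] depends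
    only on the environments before [n], because the later factors are total masses. Independence
    then reduces to that of the environments. *)
Lemma past_system_indep n A B : past_system n A ->
  preimage_set_system setT (Q n) measurable B -> P (A `&` B) = P A * P B.
Proof.
move=> [D [A0 [M [[mD TD] sA TA ->]]]] [C mC <-]; rewrite setTI.
set E := environment_cylinder D; set F := Q n @^-1` C.
have sE : <<s generators Q >> E by exact: environment_cylinder_sigma.
have sF : <<s generators Q >> F.
  by rewrite -[F]setTI; exact: environment_measurable.
have sEF : <<s generators Q >> (E `&` F).
  exact: (@measurableI _ (g_sigma_algebraType (generators Q))).
have mE := sigma_generators_measurable sE; have mF := sigma_generators_measurable sF.
rewrite setIAC setIC [X in P X * _]setIC !(cylinder_prob sA)//.
rewrite integral_mkcond [in RHS]integral_mkcond.
rewrite (_ : P F = \int[P]_w (\1_F w)%:E); last by rewrite integral_indic// setIT.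
rewrite -(@indep_ge0_integral _ _ _ P (environment_past n)
  (preimage_set_system setT (Q n) measurable))//.
- apply: eq_integral => w _; rewrite !epatch_indic/= indicI/= EFinM muleA.
  by rewrite muleAC.
- exact: environment_past_measurable.
- exact: preimage_system_measurable.
- exact: environment_past_setI.
- exact: preimage_system_setI.
- exact: environment_past_indep.
- rewrite epatch_indic; apply: emeasurable_funM.
    apply: emeasurable_prod => n'; apply: emeasurable_prod => i.
    have [nn'|n'n] := leqP n n'.
      under eq_fun do rewrite TA// probability_setT.
      exact: measurable_cst.
    exact: (measurableT_comp (measurable_particle_law i _) (environment_past_fun n'n)).
  apply/measurable_EFinP; apply: measurable_indic.
  by apply: sub_sigma_algebra; exists D.
- apply/measurable_EFinP; apply: measurable_indic.
  by apply: sub_sigma_algebra; exists C => //; rewrite setTI.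
- by move=> w; rewrite epatch_indic mule_ge0 ?cylinder_law_ge0// lee_fin.
Qed.

Lemma environment_law n (g : Delta R -> \bar R) : measurable_fun setT g ->
  (forall q, 0 <= g q) -> \int[P]_w g (Q n w) = \int[P]_w g (Q 0%N w).
Proof.
move=> mg g0; have [_ idl] := environment_iid HZ.
rewrite -!(@ge0_integral_distribution _ _ _ _ _ P _ g)//.
by apply: eq_measure_integral => A mA _; exact: idl.
Qed.

Lemma past_environment_integral n (phi : T -> \bar R) (g : Delta R -> \bar R) :
  measurable_fun [set: g_sigma_algebraType (past_system n)] phi ->
  (forall w, 0 <= phi w) -> measurable_fun setT g -> (forall q, 0 <= g q) ->
  \int[P]_w (phi w * g (Q n w)) = \int[P]_w phi w * \int[P]_w g (Q 0%N w).
Proof.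
move=> mphi phi0 mg g0; rewrite -(environment_law n)//.
apply: (@indep_ge0_integral _ _ _ P (past_system n)
  (preimage_set_system setT (Q n) measurable)) => //.
- exact: past_system_measurable.
- exact: preimage_system_measurable.
- exact: past_system_setI.
- exact: preimage_system_setI.
- exact: past_system_indep.
- exact: (measurableT_comp mg (@preimage_system_fun _ _ _ (Q n))).
Qed.

(** Averaging the particle under its law leaves a function [H] of [Q n], which is independent of the
    past. The same averaging at generation [0] identifies the mean of [H]. *)
Lemma past_particle_integral n i (phi : T -> R) (g : Delta R -> nat -> \bar R) :
  measurable_fun [set: g_sigma_algebraType (past_system n)] phi ->
  (forall w, (0 <= phi w)%R) ->
  (forall b, measurable_fun setT (g ^~ b)) -> (forall q b, 0 <= g q b) ->
  \int[P]_w ((phi w)%:E * g (Q n w) (X n i w)) =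
  \int[P]_w (phi w)%:E * \int[P]_w g (Q 0%N w) (X 0%N i w).
Proof.
move=> mphi phi0 mg g0.
pose H q := \sum_(b <oo) (g q b * particle_law i q [set b]).
have H0 q : 0 <= H q by apply: nneseries_ge0 => b _ _; rewrite mule_ge0.
have mH : measurable_fun setT H.
  apply: ge0_emeasurable_sum => b *; first by rewrite mule_ge0.
  by apply: emeasurable_funM => //; exact: measurable_particle_law.
rewrite (@particle_integral (fun n' _ => (n' < n)%N) n i
  (fun w b => (phi w)%:E * g (Q n w) b)); last 3 first.
- by rewrite ltnn.
- move=> b; apply: emeasurable_funM.
    apply/measurable_EFinP; apply: g_sigma_measurable_funS mphi.
    by move=> C /(@past_system_full n (fun n' _ => (n' < n)%N)) h; apply: sub_sigma_algebra; exact: h.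
  by apply: (measurableT_comp (mg b)); exact: full_system_environment.
- by move=> w b; rewrite mule_ge0// lee_fin.
rewrite (@particle_integral (fun _ _ => False) 0%N i
  (fun w b => g (Q 0%N w) b)) => [|[]|b|]//; last first.
  by apply: (measurableT_comp (mg b)); exact: full_system_environment.
rewrite -(@past_environment_integral n (EFin \o phi) H)//; last first.
  exact/measurable_EFinP.
apply: eq_integral => w _; rewrite -nneseriesZl//; last by move=> b _; rewrite mule_ge0.
by apply: eq_eseriesr => b _; rewrite muleA.
Qed.

End environment.

(** * Inequalities for powers *)

Section powR_inequalities.
Context {R : realType}.
Implicit Types (x y z t s h th : R).

Lemma powR1S x th : 0 <= x -> 0 < th -> x `^ (1 + th) = x * x `^ th.
Proof.
move=> x0 th0; rewrite powRD ?powRr1//.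
by apply/implyP => /eqP ?; exfalso; lra.
Qed.

Lemma young_powR x y th : 0 <= x -> 0 <= y -> 0 < th ->
  x `^ th * y <= x `^ (1 + th) + y `^ (1 + th).
Proof.
move=> x0 y0 th0; rewrite !powR1S// ![_ * _ `^ th]mulrC; have [yx|/ltW xy] := leP y x.
  by rewrite ler_wpDr ?mulr_ge0 ?powR_ge0// ler_wpM2l// powR_ge0.
rewrite ler_wpDl ?mulr_ge0 ?powR_ge0// ler_wpM2r//.
by apply: ge0_ler_powR; rewrite ?nnegrE// ltW.
Qed.

(** With [u = ln x] this is convexity of the exponential between [0] and [u]: [h1] and [h2] compare
    its values at both ends with the tangent at [th * u]. *)
Lemma bernoulli_powR x th : 0 <= x -> 0 < th <= 1 -> x `^ th <= 1 + th * (x - 1).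
Proof.
move=> x0 /andP[th0 th1]; have [->|xN0] := eqVneq x 0.
  by rewrite powR0 ?gt_eqF//; lra.
have xgt0 : 0 < x by rewrite lt_neqAle eq_sym xN0.
rewrite /powR (negbTE xN0) -{2}(lnK xgt0); set u := ln x.
have h1 := expR_ge1Dx (u - th * u); have h2 := expR_ge1Dx (- (th * u)).
have e1 : expR u = expR (u - th * u) * expR (th * u) by rewrite -expRD subrK.
have e2 : 1 = expR (- (th * u)) * expR (th * u) by rewrite -expRD addNr expR0.
have E0 := expR_gt0 (th * u).
rewrite e1 {1 2}e2; set E := expR (th * u) in E0 *.
move: (expR (u - th * u)) (expR (- (th * u))) h1 h2 {e1 e2} => a b h1 h2.
have : 1 <= th * a + (1 - th) * b by nra.
by nra.
Qed.

(** A concave power lies below its tangent at [z]. Integrated with [z] the conditional mean of [x],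
    this plays the role of the conditional Jensen inequality. *)
Lemma tangent_powR x z th : 0 <= x -> 0 < z -> 0 < th <= 1 ->
  x `^ th <= z `^ th * (1 + th * (x / z - 1)).
Proof.
move=> x0 z0 th01; have -> : x = z * (x / z) by rewrite mulrCA divff ?mulr1// gt_eqF.
rewrite powRM ?divr_ge0 ?(ltW z0)// ler_wpM2l ?powR_ge0//.
have -> : z * (x / z) / z = x / z by field; rewrite gt_eqF.
by apply: bernoulli_powR => //; rewrite divr_ge0// ltW.
Qed.

Lemma powR_ge_id x th : 0 <= x <= 1 -> 0 < th <= 1 -> x <= x `^ th.
Proof.
move=> /andP[x0 x1] /andP[th0 th1]; have [->|xN0] := eqVneq x 0; first exact: powR_ge0.
by apply: ger1_powR => //; rewrite lt_neqAle eq_sym xN0 x0.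
Qed.

(** Each share [z / (x + y)] lies in the unit interval, hence is at most its own power; the two
    shares add up to one. *)
Lemma powR_subadd x y th : 0 <= x -> 0 <= y -> 0 < th <= 1 ->
  (x + y) `^ th <= x `^ th + y `^ th.
Proof.
move=> x0 y0 th01; have [xy0|xyN0] := eqVneq (x + y) 0.
  by rewrite xy0 powR0 ?addr_ge0 ?powR_ge0//; case/andP: th01 => ? _; rewrite gt_eqF.
have s0 : 0 < x + y by rewrite lt_neqAle eq_sym xyN0 addr_ge0.
have part z : 0 <= z <= x + y -> z / (x + y) * (x + y) `^ th <= z `^ th.
  move=> /andP[z0 zs]; have {2}-> : z = z / (x + y) * (x + y) by rewrite divfK.
  rewrite powRM ?(ltW s0) ?divr_ge0 ?(ltW s0)// ler_wpM2r ?powR_ge0//.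
  apply: powR_ge_id => //; rewrite divr_ge0 ?(ltW s0)//=.
  by rewrite ler_pdivrMr// mul1r.
apply: le_trans (lerD (part x _) (part y _)).
- by rewrite -mulrDl -mulrDl divff ?mul1r.
- by rewrite x0 lerDl.
- by rewrite y0 lerDr.
Qed.

(** For [|t| <= 1], Bernoulli's inequality leaves the remainder [th * t ^+ 2], which is at most
    [|t| ^ (1 + th)]. For larger [t] the remainder dominates everything, and [4] comes from
    [2 ^ (1 + th)]. *)
Lemma powR1D_le t th : 0 < th <= 1 ->
  `|1 + t| `^ (1 + th) <= 1 + (1 + th) * t + 4 * `|t| `^ (1 + th).
Proof.
move=> /andP[th0 th1].
have pos := powR_ge0 `|t| (1 + th).
have th01 : 0 < th <= 1 by rewrite th0.
have [t1|t1] := leP `|t| 1.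
  have t1' : 0 <= 1 + t by move: t1; rewrite ler_norml; lra.
  rewrite ger0_norm// powR1S//.
  have := @bernoulli_powR (1 + t) th t1' th01 => /(ler_wpM2l t1').
  have tt : t ^+ 2 <= `|t| `^ (1 + th).
    rewrite powR1S// -real_normK ?num_real// expr2 ler_wpM2l//.
    by apply: powR_ge_id => //; rewrite normr_ge0.
  move=> h; apply: (le_trans h).
  have : th * t ^+ 2 <= `|t| `^ (1 + th).
    by apply: le_trans tt; rewrite ler_piMl// sqr_ge0.
  by nra.
have tle : `|t| <= `|t| `^ (1 + th) by apply: le1r_powR; [exact: ltW|lra].
have [tge|tlt] := leP 0 t.
  rewrite ger0_norm ?addr_ge0//; rewrite ger0_norm// in t1 tle pos *.
  have h : (1 + t) `^ (1 + th) <= (2 * t) `^ (1 + th).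
    by apply: ge0_ler_powR; rewrite ?nnegrE; lra.
  have h4 : 2 `^ (1 + th) <= 4 :> R.
    have -> : 4 = 2 `^ (2%:R : R) :> R by rewrite powR_mulrn//; lra.
    by apply: ler_powR; lra.
  rewrite powRM// in h; have := ler_wpM2r pos h4.
  by nra.
rewrite ltr0_norm// in t1 tle pos *.
rewrite ler0_norm; last by lra.
have : (- (1 + t)) `^ (1 + th) <= (- t) `^ (1 + th).
  by apply: ge0_ler_powR; rewrite ?nnegrE; lra.
by nra.
Qed.

(* The signed first order term is split between the two sides so that all
   terms are nonnegative. *)
Lemma powR_increment s a y th : 0 <= a -> 0 < th <= 1 ->
  `|s + a * (y - 1)| `^ (1 + th) + (1 + th) * (Num.max (- s) 0 `^ th * a) * y
    + (1 + th) * (Num.max s 0 `^ th * a)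
  <= `|s| `^ (1 + th) + (1 + th) * (Num.max s 0 `^ th * a) * y
    + (1 + th) * (Num.max (- s) 0 `^ th * a)
    + 4 * (a `^ (1 + th) * `|y - 1| `^ (1 + th)).
Proof.
move=> a0 th01; have /andP[th0 th1] := th01.
rewrite -powRM//.
have -> : a * `|y - 1| = `|a * (y - 1)| by rewrite normrM ger0_norm.
set h := a * (y - 1).
(* The difference of the two powers is [sign(s) * |s| ^ th], so its product with [1 + th] is the
   derivative of [|s| ^ (1 + th)]. *)
suff : `|s + h| `^ (1 + th) <= `|s| `^ (1 + th)
    + (1 + th) * (Num.max s 0 `^ th - Num.max (- s) 0 `^ th) * h
    + 4 * `|h| `^ (1 + th) by rewrite /h; lra.
have pos := powR_ge0 `|h| (1 + th).
have [->|sN0] := eqVneq s 0.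
  rewrite add0r normr0 powR0; last by lra.
  by rewrite oppr0 subrr mulr0 mul0r !add0r; lra.
have -> : `|s + h| = `|s| * `|1 + h / s|.
  by rewrite -normrM mulrDr mulr1 mulrCA divff// mulr1.
rewrite powRM//.
have := powR1D_le (h / s) th01 => /(ler_wpM2l (powR_ge0 `|s| (1 + th))).
move/le_trans; apply; rewrite !mulrDr mulr1 [X in _ + X]mulrCA -powRM//.
rewrite -normrM [s * _]mulrCA divff// mulr1 lerD2r lerD2l.
rewrite le_eqVlt; apply/orP; left; apply/eqP; rewrite powR1S//.
have [s0|s0] := ltP 0 s.
  have s0' : - s <= 0 by rewrite oppr_le0 ltW.
  rewrite gtr0_norm// (max_r s0') powR0 ?gt_eqF//.
  by rewrite oppr0 mulr0 addr0; field.
have s0' : s < 0 by rewrite lt_neqAle sN0.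
have s0'' : 0 <= - s by rewrite oppr_ge0.
rewrite ltr0_norm// (max_l s0'') powR0 ?gt_eqF// mulr0 add0r.
by field.
Qed.

(** The factor [expR b] bounds the second derivative of [expR (- x)] on the half-line. Scaled by a
    small parameter, the inequality expands a Laplace transform to second order. *)
Lemma expRN_le2 x b : 0 <= b -> - b <= x -> expR (- x) <= 1 - x + expR b * x ^+ 2.
Proof.
move=> b0 bx.
have [x0|x0] := leP 0 x.
  have h := expR_ge1Dxn 1 x0.
  have E := expR_gt0 x; rewrite expRN; set u := expR x in h E *.
  have b1 : 1 <= expR b by rewrite -expR0 ler_expR.
  have h1 := expR_ge1Dx x; rewrite -/u in h1.
  apply: (@le_trans _ _ (1 - x + x ^+ 2)); last first.
    by rewrite lerD2l ler_peMl// sqr_ge0.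
  rewrite -div1r ler_pdivrMr//.
  have x2 := sqr_ge0 x; have [x1|x1] := leP x 1.
    have : (1 - x + x ^+ 2) * (1 + x) <= (1 - x + x ^+ 2) * u by rewrite ler_wpM2l//; lra.
    have -> : (1 - x + x ^+ 2) * (1 + x) = 1 + x ^+ 2 * x by ring.
    by have := mulr_ge0 x2 x0; lra.
  have : 1 <= 1 - x + x ^+ 2 by nra.
  by nra.
pose y := - x; have y0 : 0 < y by rewrite oppr_gt0.
have -> : 1 - x = 1 + y by [].
have -> : x ^+ 2 = y ^+ 2 by rewrite sqrrN.
have yb : expR y <= expR b by rewrite ler_expR /y; lra.
rewrite -/y.
have h (u : R) : 0 <= u -> 1 + u <= expR u by move=> _; exact: expR_ge1Dx.
have m1 : expR y - 1 <= expR y * y.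
  have := expR_ge1Dx (- y); have E := expR_gt0 y.
  have e : expR (- y) * expR y = 1 by rewrite -expRD addNr expR0.
  by nra.
have m2 : expR y - 1 - y <= (expR y - 1) * y.
  have m3 (t : R) : 0 <= t <= y -> expR t - 1 <= expR y - 1.
    by move=> /andP[_ ty]; rewrite lerD2r ler_expR.
  have df (t : R) : is_derive t 1 (fun t : R => expR t - t) (expR t - 1).
    by apply: is_derive_eq; rewrite ?mulr1.
  have [|c] := @MVT_segment R (fun t => expR t - t) (fun t => expR t - 1) 0 y (ltW y0) (fun t _ => df t).
    by apply: derivable_within_continuous => t _; have [] := df t.
  rewrite in_itv/= subr0 expR0 => cy; rewrite subr0.
  have := m3 c cy => /(ler_wpM2r (ltW y0)) h3 h4.
  by move: h3; rewrite -h4; lra.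
have : (expR y - 1) * y <= expR b * y ^+ 2.
  rewrite expr2 mulrA ler_wpM2r ?(ltW y0)// (le_trans m1)// ler_wpM2r// ltW//.
by lra.
Qed.

End powR_inequalities.

(** * Functions with a random integer parameter *)

Lemma measurable_nat_comp d (T : measurableType d) d' (U : measurableType d')
  (V : T -> nat) (F : nat -> T -> U) : measurable_fun setT V ->
  (forall n, measurable_fun setT (F n)) -> measurable_fun setT (fun w => F (V w) w).
Proof.
move=> mV mF _ B mB; rewrite setTI.
rewrite (_ : _ @^-1` B = \bigcup_n (V @^-1` [set n] `&` F n @^-1` B)).
  apply: bigcupT_measurable => n; apply: measurableI.
    by rewrite -[X in measurable X]setTI; exact: mV.
  by rewrite -[X in measurable X]setTI; exact: mF.
apply/seteqP; split => [w Bw|w [n _ [/= <-]]//].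
by exists (V w).
Qed.

Section by_value.
Local Open Scope ereal_scope.
Context d (T : measurableType d) (R : realType) (mu : {measure set T -> \bar R}).

Lemma integral_by_value (V : T -> nat) (f : T -> \bar R) :
  measurable_fun setT V -> measurable_fun setT f -> (forall w, 0 <= f w) ->
  \int[mu]_w f w = \sum_(v <oo) \int[mu]_w ((\1_(V @^-1` [set v]) w)%:E * f w).
Proof.
move=> mV mf f0.
have mpre v : measurable (V @^-1` [set v]).
  by rewrite -[X in measurable X]setTI; exact: mV.
rewrite -integral_nneseries//; last 2 first.
- move=> v; apply: emeasurable_funM => //.
  by apply/measurable_EFinP; exact: measurable_indic.
- by move=> v w _; rewrite mule_ge0// lee_fin.
apply: eq_integral => w _.
rewrite (@nneseriesD1 _ _ (V w))//; last first.
  by move=> v _; rewrite mule_ge0// lee_fin.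
rewrite eseries0 => [|v _ /negP vV]; last first.
  by rewrite indicE memNset ?mul0e//= => Vv; apply: vV; rewrite Vv.
by rewrite adde0 indicE mem_set ?mul1e.
Qed.

(** Its purpose is to freeze a population size: on each event [V = v] a sum over the particles has a
    deterministic number of terms. *)
Lemma le_integral_by_value (V : T -> nat) (f g : T -> \bar R) :
  measurable_fun setT V -> measurable_fun setT f -> measurable_fun setT g ->
  (forall w, 0 <= f w) -> (forall w, 0 <= g w) ->
  (forall v, \int[mu]_w ((\1_(V @^-1` [set v]) w)%:E * f w) <=
             \int[mu]_w ((\1_(V @^-1` [set v]) w)%:E * g w)) ->
  \int[mu]_w f w <= \int[mu]_w g w.
Proof.
move=> mV mf mg f0 g0 fg; rewrite (integral_by_value mV mf)// (integral_by_value mV mg)//.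
by apply: lee_nneseries => v *; rewrite ?integral_ge0// => w _; rewrite mule_ge0// lee_fin.
Qed.

End by_value.

(** * The associated walk and the branching flow *)

Section branching.
Local Open Scope ereal_scope.
Context d (T : measurableType d) (R : realType) (P : probability T R).
Variables (Q : nat -> {RV P >-> Delta R}).
Variables (N : nat -> nat -> {RV P >-> nat}) (Y : nat -> {RV P >-> nat}).
Hypothesis HZ : bpire_data Q N Y.

Definition log_mean (q : Delta R) : R := ln (fine (law_mean q.1)).

Definition walk (l m : nat) (w : T) : R := (\sum_(j < m) log_mean (Q (l + j)%N w))%R.

Local Notation past n := (g_sigma_algebraType (past_system Q N Y n)).
Local Notation full I := (g_sigma_algebraType (full_system Q N Y I)).

Lemma past_measurable n d' (U : measurableType d') (f : T -> U) :
  measurable_fun [set: past n] f -> measurable_fun [set: T] f.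
Proof. by apply: g_sigma_measurable_fun; exact: past_system_measurable. Qed.

Lemma full_measurable I d' (U : measurableType d') (f : T -> U) :
  measurable_fun [set: full I] f -> measurable_fun [set: T] f.
Proof. by apply: g_sigma_measurable_fun; exact: full_system_measurable. Qed.

Lemma past_measurableS n n' d' (U : measurableType d') (f : T -> U) :
  (n <= n')%N -> measurable_fun [set: past n] f -> measurable_fun [set: past n'] f.
Proof.
move=> nn'; apply: g_sigma_measurable_funS => C hC; apply: sub_sigma_algebra.
exact: past_systemS hC.
Qed.

Lemma past_measurable_full n (I : nat -> nat -> Prop) d' (U : measurableType d')
  (f : T -> U) : (forall n' i, (n' < n)%N -> I n' i) ->
  measurable_fun [set: past n] f -> measurable_fun [set: full I] f.
Proof.
move=> nI; apply: g_sigma_measurable_funS => C hC; apply: sub_sigma_algebra.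
exact: past_system_full hC.
Qed.

Lemma measurable_law_mean : measurable_fun setT (fun q : Delta R => law_mean q.1).
Proof.
apply: ge0_emeasurable_sum => j *; first by rewrite mule_ge0// lee_fin.
apply: emeasurable_funM; first exact: measurable_cst.
exact: (measurable_particle_law 1 [set j]).
Qed.

Lemma measurable_log_mean : measurable_fun setT log_mean.
Proof.
apply: (measurableT_comp (@measurable_ln R)).
by apply: measurableT_comp measurable_law_mean; exact: fine_measurable.
Qed.

Lemma environment_ae n (S : set (Delta R)) : measurable S ->
  {ae P, forall w, S (Q 0%N w)} -> {ae P, forall w, S (Q n w)}.
Proof.
move=> mS; have [_ idl] := environment_iid HZ.
have mC := measurableC mS.
have E m : measurable (Q m @^-1` (~` S)).
  by rewrite -[X in measurable X]setTI; exact: (measurable_funP (Q m)).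
move=> /(negligibleP _ (E 0%N)) h0; apply/(negligibleP _ (E n)).
exact: etrans (idl n _ mC) h0.
Qed.

Hypothesis mean_ae : {ae P, forall w, 0 < law_mean (offspring Q 0 w) < +oo}.

Lemma law_mean_ae n :
  {ae P, forall w, law_mean (offspring Q n w) = (expR (log_mean (Q n w)))%:E}.
Proof.
pose S : set (Delta R) := [set q | 0 < law_mean q.1 < +oo].
have mS : measurable S.
  rewrite (_ : S = (fun q : Delta R => law_mean q.1) @^-1`
      [set` Interval (BRight 0) (BLeft (+oo : \bar R))]).
    rewrite -[X in measurable X]setTI; apply: measurable_law_mean => //.
    exact: emeasurable_itv.
  by apply/seteqP; split => q; rewrite /S /= in_itv/=.
have := @environment_ae n S mS mean_ae.
apply: filterS => w /=; rewrite /S /= => /andP[h1 h2].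
have f : law_mean (Q n w).1 \is a fin_num by rewrite ge0_fin_numE// ltW.
rewrite /log_mean lnK ?fineK// posrE fine_gt0//.
by rewrite h1.
Qed.

(** Given the environment and the other particles, an offspring number divided by its quenched mean
    has mean one. That quenched mean is finite and positive only almost surely, so the last
    comparison is an almost everywhere one. *)
Lemma mean_particle I n i (phi : T -> R) : ~ I n i.+1 ->
  measurable_fun [set: full I] phi -> (forall w, (0 <= phi w)%R) ->
  \int[P]_w (phi w * ((N n i w)%:R * expR (- log_mean (Q n w))))%:E =
  \int[P]_w (phi w)%:E.
Proof.
move=> nI mphi phi0.
have mxi : measurable_fun [set: full I] (fun w => expR (- log_mean (Q n w))).
  apply: (measurableT_comp (@measurable_expR R)); apply: measurable_funN.
  by apply: (measurableT_comp measurable_log_mean); exact: full_system_environment.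
rewrite (@particle_integral _ _ _ _ _ _ _ HZ I n i.+1
  (fun w b => (phi w * (b%:R * expR (- log_mean (Q n w))))%:E))//; last 2 first.
- move=> b; apply/measurable_EFinP; apply: measurable_funM => //.
  exact: measurable_funM.
- by move=> w b; rewrite lee_fin !mulr_ge0// expR_ge0.
have E w : \sum_(b <oo) ((phi w * (b%:R * expR (- log_mean (Q n w))))%:E *
     offspring Q n w [set b]) =
    (phi w * expR (- log_mean (Q n w)))%:E * law_mean (offspring Q n w).
  rewrite /law_mean -nneseriesZl//; last by move=> b _; rewrite mule_ge0// lee_fin.
  by apply: eq_eseriesr => b _; rewrite muleA -EFinM; congr (_%:E * _); ring.
under eq_integral do rewrite E.
apply: ge0_ae_eq_integral => //.
- apply: emeasurable_funM.
    apply/measurable_EFinP; apply: (@full_measurable I).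
    exact: measurable_funM.
  exact: (measurableT_comp measurable_law_mean (measurable_funP (Q n))).
- by apply/measurable_EFinP; exact: full_measurable mphi.
- move=> w _; rewrite mule_ge0//; first by rewrite lee_fin mulr_ge0// expR_ge0.
  by apply: nneseries_ge0 => b _ _; rewrite mule_ge0// lee_fin.
- by move=> w _; rewrite lee_fin.
have := law_mean_ae n; apply: filterS => w h _.
by rewrite h -EFinM -mulrA -expRD addNr expR0 mulr1.
Qed.

Lemma measurable_walk l m : measurable_fun [set: past (l + m)] (walk l m).
Proof.
apply: measurable_sum => j; apply: (measurableT_comp measurable_log_mean).
by apply: past_system_environment; rewrite ltn_add2l.
Qed.

Lemma walkS l m w : walk l m.+1 w = (walk l m w + log_mean (Q (l + m)%N w))%R.
Proof. by rewrite /walk big_ord_recr. Qed.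

(** The factors are independent of the past and of one another, so each generation contributes [r].
    The exponent [t] is left free because both [th] and [1 + th] occur. *)
Lemma walk_moment (t r : R) l m (phi : T -> R) :
  \int[P]_w (expR (- (t * log_mean (Q 0%N w))))%:E = r%:E ->
  measurable_fun [set: past l] phi -> (forall w, (0 <= phi w)%R) ->
  \int[P]_w (phi w * expR (- (t * walk l m w)))%:E = \int[P]_w (phi w)%:E * (r ^+ m)%:E.
Proof.
move=> tr mphi phi0; elim: m => [|m IH].
  rewrite expr0 mule1; apply: eq_integral => w _.
  by rewrite /walk big_ord0 mulr0 oppr0 expR0 mulr1.
have mexp u : measurable_fun setT (fun x : R => expR (- (u * x))).
  apply: (measurableT_comp (@measurable_expR R)); apply: measurable_funN.
  exact: measurable_funM.
transitivity (\int[P]_w ((phi w * expR (- (t * walk l m w)))%:E *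
    (expR (- (t * log_mean (Q (l + m)%N w))))%:E)).
  by apply: eq_integral => w _; rewrite walkS mulrDr opprD expRD mulrA EFinM.
rewrite (@past_environment_integral _ _ _ _ _ _ _ HZ (l + m)%N
  (fun w => (phi w * expR (- (t * walk l m w)))%:E)
  (fun q => (expR (- (t * log_mean q)))%:E)).
- by rewrite IH tr exprSr EFinM muleA.
- apply/measurable_EFinP; apply: measurable_funM.
    by apply: past_measurableS mphi; exact: leq_addr.
  by apply: (measurableT_comp (mexp t)); exact: measurable_walk.
- by move=> w; rewrite lee_fin mulr_ge0// expR_ge0.
- by apply/measurable_EFinP; apply: (measurableT_comp (mexp t)); exact: measurable_log_mean.
- by move=> q; rewrite lee_fin expR_ge0.
Qed.

(** The population at generation [l + m] issued from [z] individuals at generation [l]. The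
    immigration is a parameter so that populations with and without immigrants are driven by the
    same offspring variables and compared path by path. *)
Fixpoint flow (imm : nat -> T -> nat) (l z m : nat) (w : T) : nat :=
  if m is m'.+1 then
    (\sum_(i < flow imm l z m' w) N (l + m') i w + imm (l + m') w)%N
  else z.

Lemma flow_Z k n w : Z N Y k n w = flow Y 0 k n w.
Proof. by elim: n => //= n ->. Qed.

Lemma flow_mono (imm imm' : nat -> T -> nat) l z z' m w : (z <= z')%N ->
  (forall n, imm n w <= imm' n w)%N -> (flow imm l z m w <= flow imm' l z' m w)%N.
Proof.
move=> zz' ii'; elim: m => //= m IH; rewrite leq_add//.
by rewrite -(subnKC IH) big_split_ord/= leq_addr.
Qed.

Lemma flow_addn imm l z m m' w :
  flow imm l z (m + m') w = flow imm (l + m) (flow imm l z m w) m' w.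
Proof. by elim: m' => [|m' IH]; rewrite ?addn0// addnS /= IH addnA. Qed.

Lemma measurable_flow (imm : nat -> T -> nat) l z m :
  (forall n n', (n < n')%N -> measurable_fun [set: past n'] (imm n)) ->
  measurable_fun [set: past (l + m)] (flow imm l z m).
Proof.
move=> mimm; elim: m => [|m IH /=]; first exact: measurable_cst.
have IH' := past_measurableS (leq_addr 1 (l + m)%N) IH; rewrite addn1 -addnS in IH'.
have mN i : measurable_fun [set: past (l + m.+1)] (N (l + m)%N i).
  by apply: (@past_system_particle _ _ _ _ Q N Y _ _ i.+1); rewrite addnS.
have madd (U V : T -> nat) : measurable_fun [set: past (l + m.+1)] U ->
    measurable_fun [set: past (l + m.+1)] V ->
    measurable_fun [set: past (l + m.+1)] (fun w => U w + V w)%N.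
  move=> mU mV; apply: (@measurable_nat_comp _ (past (l + m.+1)) _ _ U (fun u w => u + V w)%N mU).
  by move=> n mT B mB; exact: (mV mT (addn n @^-1` B)).
apply: (madd _ _ _ _); last by apply: mimm; rewrite addnS.
apply: (@measurable_nat_comp _ (past (l + m.+1)) _ _ (flow imm l z m)
  (fun v w => \sum_(i < v) N (l + m)%N i w)%N IH').
elim => [|v IHv]; first by under eq_fun do rewrite big_ord0; exact: measurable_cst.
by under eq_fun do rewrite big_ord_recr/=; exact: madd.
Qed.

End branching.

(** * Fractional moments and the lower bound *)

Lemma integral_EFinD d (T : measurableType d) (R : realType)
  (mu : {measure set T -> \bar R}) (f g : T -> R) :
  measurable_fun setT f -> measurable_fun setT g ->
  (forall w, 0 <= f w) -> (forall w, 0 <= g w) ->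
  (\int[mu]_w (f w + g w)%:E = \int[mu]_w (f w)%:E + \int[mu]_w (g w)%:E)%E.
Proof.
move=> mf mg f0 g0; under eq_integral do rewrite EFinD.
rewrite ge0_integralD//; try by move=> w _; rewrite lee_fin.
  exact/measurable_EFinP.
exact/measurable_EFinP.
Qed.

Lemma integral_EFin_fin_num d (T : measurableType d) (R : realType)
  (mu : {measure set T -> \bar R}) (f : T -> R) :
  (forall w, 0 <= f w) -> (\int[mu]_w (f w)%:E < +oo)%E ->
  (\int[mu]_w (f w)%:E)%E \is a fin_num.
Proof.
by move=> f0 fy; rewrite ge0_fin_numE//; apply: integral_ge0 => w _; rewrite lee_fin.
Qed.

Lemma le_integral_EFin d (T : measurableType d) (R : realType)
  (mu : {measure set T -> \bar R}) (f g : T -> R) :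
  measurable_fun setT f -> measurable_fun setT g ->
  (forall w, 0 <= f w <= g w) ->
  (\int[mu]_w (f w)%:E <= \int[mu]_w (g w)%:E)%E.
Proof.
move=> mf mg fg; apply: ge0_le_integral => //.
- by move=> w _; rewrite lee_fin; case/andP: (fg w).
- exact/measurable_EFinP.
- exact/measurable_EFinP.
- by move=> w _; rewrite lee_fin; case/andP: (fg w).
Qed.

(** The finite quantities [p] and [m] cancel. [A'] is not assumed finite: its finiteness is part of
    the conclusion. *)
Lemma ereal_increment_le (R : realType) (A' A B C p m s : \bar R) (c v : R) :
  (A <= s + (4 * c * v)%:E * B -> C <= B * c%:E ->
  p \is a fin_num -> m \is a fin_num -> A \is a fin_num -> B \is a fin_num ->
  s \is a fin_num -> C \is a fin_num ->
  A' + m + p <= A + p + m + 4%:E * C ->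
  A' <= s + (4 * c * (v + 1))%:E * B)%E.
Proof.
move=> + + fp fm fA fB fs fC.
rewrite -(fineK fA) -(fineK fB) -(fineK fC) -(fineK fp) -(fineK fm) -(fineK fs).
move: (fine A) (fine B) (fine C) (fine p) (fine m) (fine s) => {A B C p m s fp fm fA fB fs fC}A B C p m s.
move: A' => [A'||] h1 h2 h3; last by rewrite leNye.
  by move: h1 h2 h3; rewrite -!EFinM -!EFinD !lee_fin => h1 h2 h3; lra.
by move: h3; rewrite -!EFinM -!EFinD !addye// leye_eq.
Qed.

Section lower_bound.
Local Open Scope ereal_scope.
Context d (T : measurableType d) (R : realType) (P : probability T R).
Variables (Q : nat -> {RV P >-> Delta R}).
Variables (N : nat -> nat -> {RV P >-> nat}) (Y : nat -> {RV P >-> nat}).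
Hypothesis HZ : bpire_data Q N Y.
Hypothesis mean_ae : {ae P, forall w, 0 < law_mean (offspring Q 0 w) < +oo}.

Local Notation past n := (g_sigma_algebraType (past_system Q N Y n)).
Local Notation full I := (g_sigma_algebraType (full_system Q N Y I)).

Variables (th c : R).
Hypothesis th01 : (0 < th <= 1)%R.
Hypothesis c_moment : \int[P]_w
  (`|(N 0 0 w)%:R * expR (- log_mean (Q 0%N w)) - 1| `^ (1 + th))%:E <= c%:E.

Let xN n i w : R := ((N n i w)%:R * expR (- log_mean (Q n w)))%R.

Let xN_ge0 n i w : (0 <= xN n i w)%R.
Proof. by rewrite mulr_ge0// expR_ge0. Qed.

Let c0 : (0 <= c)%R.
Proof.
rewrite -lee_fin; apply: le_trans c_moment; apply: integral_ge0 => w _.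
by rewrite lee_fin powR_ge0.
Qed.

(** The moment assumption concerns a single particle of generation [0]; its siblings have the same
    law given the environment, and other generations the same environment law. *)
Lemma particle_moment n i (phi : T -> R) :
  measurable_fun [set: past n] phi -> (forall w, (0 <= phi w)%R) ->
  \int[P]_w (phi w * `|xN n i w - 1| `^ (1 + th))%:E <= \int[P]_w (phi w)%:E * c%:E.
Proof.
move=> mphi phi0.
pose g (q : Delta R) (b : nat) : \bar R :=
  (`|b%:R * expR (- log_mean q) - 1| `^ (1 + th))%:E.
have mg b : measurable_fun setT (g ^~ b).
  apply/measurable_EFinP; apply: (measurableT_comp (measurable_powR _)).
  apply: (measurableT_comp (@normr_measurable R setT)).
  apply: measurable_funB => //; apply: measurable_funM => //.
  apply: (measurableT_comp (@measurable_expR R)); apply: measurable_funN.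
  exact: measurable_log_mean.
have g0 q b : 0 <= g q b by rewrite lee_fin powR_ge0.
have E j : \int[P]_w g (Q 0%N w) (N 0 j w) =
    \int[P]_w (\sum_(b <oo) (g (Q 0%N w) b * (Q 0%N w).1 [set b])).
  rewrite (@particle_integral _ _ _ _ _ _ _ HZ (fun _ _ => False) 0 j.+1
    (fun w b => g (Q 0%N w) b))// => b.
  by apply: (measurableT_comp (mg b)); exact: full_system_environment.
under eq_integral do rewrite EFinM.
rewrite (@past_particle_integral _ _ _ _ _ _ _ HZ n i.+1 phi g)//.
have Ec : \int[P]_w g (Q 0%N w) (N 0 i w) <= c%:E by rewrite E -(E 0%N).
by rewrite lee_wpmul2l ?integral_ge0// => w _; rewrite lee_fin.
Qed.

(** An inequality of von Bahr and Esseen type, by induction on the number of variables: adding a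
    centered variable, conditionally independent of those already present, raises the moment of
    order [1 + th] by at most [4 * c] times that of its coefficient, since the first-order term of
    [powR_increment] averages to zero. *)
Lemma increment_loop n v (phi s a : T -> R) :
  measurable_fun [set: past n] phi -> measurable_fun [set: past n] s ->
  measurable_fun [set: past n] a ->
  (forall w, (0 <= phi w)%R) -> (forall w, (0 <= a w)%R) ->
  \int[P]_w (phi w * `|s w| `^ (1 + th))%:E < +oo ->
  \int[P]_w (phi w * a w `^ (1 + th))%:E < +oo ->
  \int[P]_w (phi w * `|s w + a w * \sum_(i < v) (xN n i w - 1)| `^ (1 + th))%:E
   <= \int[P]_w (phi w * `|s w| `^ (1 + th))%:E
      + (4 * c * v%:R)%:E * \int[P]_w (phi w * a w `^ (1 + th))%:E.
Proof.
move=> mphi ms ma phi0 a0 fs fa; elim: v => [|v IH].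
  under eq_integral do rewrite big_ord0 mulr0 addr0.
  by rewrite mulr0 mul0e adde0.
set r := (1 + th)%R.
have [th0 th1] : (0 < th)%R /\ (th <= 1)%R by case/andP: th01.
have r0 : (0 <= r)%R by rewrite addr_ge0// ltW.
pose S w : R := (s w + a w * \sum_(i < v) (xN n i w - 1))%R.
(* What is already revealed: all earlier generations, the immigration of generation [n] and its
   first [v] offspring variables. The next one has number [v + 1]. *)
pose I n' i := (n' < n)%N || (n' == n) && (i <= v)%N.
have In n' i : (n' < n)%N -> I n' i by rewrite /I => ->.
have mphiI := past_measurable_full In mphi; have msI := past_measurable_full In ms.
have maI := past_measurable_full In ma.
have mxN i : (i < v)%N -> measurable_fun [set: full I] (xN n i).
  move=> iv; apply: (@measurable_nat_comp _ (full I) _ _ (N n i)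
    (fun b w => b%:R * expR (- log_mean (Q n w)))%R).
    apply: (@full_system_particle _ _ _ _ Q N Y I n i.+1).
    by rewrite /I eqxx iv orbT.
  move=> b; apply: measurable_funM => //.
  apply: (measurableT_comp (@measurable_expR R)); apply: measurable_funN.
  by apply: (measurableT_comp (@measurable_log_mean R)); exact: full_system_environment.
have mS : measurable_fun [set: full I] S.
  apply: measurable_funD => //; apply: measurable_funM => //.
  by apply: measurable_sum => i; apply: measurable_funB => //; exact: mxN.
have mabs (f : T -> R) (G : set (set T)) : measurable_fun [set: g_sigma_algebraType G] f ->
    measurable_fun [set: g_sigma_algebraType G] (fun w => `|f w| `^ r)%R.
  move=> mf; apply: (measurableT_comp (measurable_powR _)).
  exact: (measurableT_comp (@normr_measurable R setT)).
(* The positive and negative parts of the first-order coefficient. Multiplying either by the next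
   normalized offspring number does not change its integral. *)
pose pp w : R := (phi w * (r * (Num.max (S w) 0 `^ th * a w)))%R.
pose pm w : R := (phi w * (r * (Num.max (- S w) 0 `^ th * a w)))%R.
have pp0 w : (0 <= pp w)%R by rewrite !mulr_ge0// powR_ge0.
have pm0 w : (0 <= pm w)%R by rewrite !mulr_ge0// powR_ge0.
have mpp : measurable_fun [set: full I] pp.
  apply: measurable_funM => //; apply: measurable_funM => //; apply: measurable_funM => //.
  by apply: (measurableT_comp (measurable_powR _)); exact: measurable_maxr.
have mpm : measurable_fun [set: full I] pm.
  apply: measurable_funM => //; apply: measurable_funM => //; apply: measurable_funM => //.
  apply: (measurableT_comp (measurable_powR _)); apply: measurable_maxr => //.
  exact: measurable_funN.
have nI : ~ I n v.+1 by rewrite /I !ltnn andbF.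
have Epp := mean_particle HZ mean_ae nI mpp pp0.
have Epm := mean_particle HZ mean_ae nI mpm pm0.
pose A w : R := (phi w * `|S w| `^ r)%R.
pose B w : R := (phi w * a w `^ r)%R.
have A0 w : (0 <= A w)%R by rewrite mulr_ge0// powR_ge0.
have B0 w : (0 <= B w)%R by rewrite mulr_ge0// powR_ge0.
have mA : measurable_fun [set: full I] A by apply: measurable_funM => //; exact: mabs.
have mBp : measurable_fun [set: past n] B.
  by apply: measurable_funM => //; exact: (measurableT_comp (measurable_powR _)).
have mB := past_measurable_full In mBp.
have fA : \int[P]_w (A w)%:E < +oo.
  apply: (le_lt_trans IH); apply: lte_add_pinfty; first exact: fs.
  by apply: lte_mul_pinfty; [rewrite lee_fin !mulr_ge0| |exact: fa].
(* The first-order integrals must be finite to be cancelled; Young's inequality bounds them by the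
   integrals of [A] and [B]. *)
have finM (p : T -> R) (m : T -> R) : measurable_fun [set: full I] p ->
    (forall w, 0 <= m w <= `|S w|)%R ->
    (forall w, p w = phi w * (r * (m w `^ th * a w)))%R -> \int[P]_w (p w)%:E < +oo.
  move=> mp mS' pE.
  apply: (@le_lt_trans _ _ (\int[P]_w (r * (A w + B w))%:E)).
    apply: le_integral_EFin.
    - exact: full_measurable mp.
    - apply: measurable_funM => //; apply: measurable_funD.
        exact: full_measurable mA.
      exact: full_measurable mB.
    move=> w; have /andP[m0 mle] := mS' w.
    rewrite pE !mulr_ge0 ?powR_ge0//= mulrCA ler_wpM2l// -mulrDr ler_wpM2l//.
    apply: (le_trans (young_powR m0 (a0 w) th0)); rewrite lerD2r.
    by apply: ge0_ler_powR; rewrite ?nnegrE.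
  under eq_integral do rewrite EFinM.
  rewrite ge0_integralZl//; last 2 first.
  - by apply/measurable_EFinP; apply: measurable_funD;
      [exact: full_measurable mA|exact: full_measurable mB].
  - by move=> w _; rewrite lee_fin addr_ge0.
  rewrite lte_mul_pinfty// ?lee_fin//.
  rewrite integral_EFinD//; [|exact: full_measurable mA|exact: full_measurable mB].
  exact: lte_add_pinfty fA fa.
have fpp : \int[P]_w (pp w)%:E \is a fin_num.
  rewrite ge0_fin_numE ?integral_ge0// => [|w _]; last by rewrite lee_fin.
  apply: (finM pp (fun w => Num.max (S w) 0)%R) => // w.
  by rewrite le_max lexx orbT/= ge_max ler_norm normr_ge0.
have fpm : \int[P]_w (pm w)%:E \is a fin_num.
  rewrite ge0_fin_numE ?integral_ge0// => [|w _]; last by rewrite lee_fin.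
  apply: (finM pm (fun w => Num.max (- S w) 0)%R) => // w.
  by rewrite le_max lexx orbT/= ge_max -normrN ler_norm normr_ge0.
have C := particle_moment v mBp B0.
pose y w := xN n v w.
pose A' w : R := (phi w * `|S w + a w * (y w - 1)| `^ r)%R.
have key w : (A' w + pm w * y w + pp w <= A w + pp w * y w + pm w + 4 * (B w * `|y w - 1| `^ r))%R.
  have := powR_increment (S w) (y w) (a0 w) th01 => /(ler_wpM2l (phi0 w)).
  by rewrite /A' /A /pm /pp /B -/r; lra.
have mT (f : T -> R) : measurable_fun [set: full I] f -> measurable_fun [set: T] f.
  exact: full_measurable.
have my : measurable_fun [set: T] y.
  apply: (@measurable_nat_comp _ T _ _ (N n v)
    (fun b w => b%:R * expR (- log_mean (Q n w)))%R) => // b.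
  apply: measurable_funM => //.
  apply: (measurableT_comp (@measurable_expR R)); apply: measurable_funN.
  exact: (measurableT_comp (@measurable_log_mean R)).
have y0 w : (0 <= y w)%R by exact: xN_ge0.
have mabsT (f : T -> R) : measurable_fun [set: T] f ->
    measurable_fun [set: T] (fun w => `|f w| `^ r)%R.
  move=> mf; apply: (measurableT_comp (measurable_powR _)).
  exact: (measurableT_comp (@normr_measurable R setT)).
have mphiT := mT _ mphiI; have mST := mT _ mS; have maT := mT _ maI.
have mppT := mT _ mpp; have mpmT := mT _ mpm; have mAT := mT _ mA.
have mBT := mT _ mB.
have my1 : measurable_fun [set: T] (fun w => y w - 1)%R by exact: measurable_funB.
have mA' : measurable_fun [set: T] A'.
  apply: measurable_funM => //; apply: mabsT; apply: measurable_funD => //.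
  exact: measurable_funM.
have mD : measurable_fun [set: T] (fun w => B w * `|y w - 1| `^ r)%R.
  by apply: measurable_funM => //; exact: mabsT.
have A'0 w : (0 <= A' w)%R by rewrite mulr_ge0// powR_ge0.
have D0 w : (0 <= B w * `|y w - 1| `^ r)%R by rewrite mulr_ge0// powR_ge0.
have mul0 (p q : T -> R) : (forall w, 0 <= p w)%R -> (forall w, 0 <= q w)%R ->
  forall w, (0 <= p w * q w)%R by move=> h1 h2 w; rewrite mulr_ge0.
have add0 (p q : T -> R) : (forall w, 0 <= p w)%R -> (forall w, 0 <= q w)%R ->
  forall w, (0 <= p w + q w)%R by move=> h1 h2 w; rewrite addr_ge0.
have mmul (p q : T -> R) : measurable_fun setT p -> measurable_fun setT q ->
  measurable_fun setT (fun w => p w * q w)%R by exact: measurable_funM.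
have madd (p q : T -> R) : measurable_fun setT p -> measurable_fun setT q ->
  measurable_fun setT (fun w => p w + q w)%R by exact: measurable_funD.
have h1 : \int[P]_w (A' w + pm w * y w + pp w)%:E <=
    \int[P]_w (A w + pp w * y w + pm w + 4 * (B w * `|y w - 1| `^ r))%:E.
  apply: le_integral_EFin => [||w].
  - exact: madd (madd _ _ mA' (mmul _ _ mpmT my)) mppT.
  - exact: madd (madd _ _ (madd _ _ mAT (mmul _ _ mppT my)) mpmT)
      (mmul (cst 4%R) _ (measurable_cst _) mD).
  - by rewrite key andbT addr_ge0// addr_ge0// mulr_ge0.
have i4 : \int[P]_w (4 * (B w * `|y w - 1| `^ r))%:E =
    4%:E * \int[P]_w (B w * `|y w - 1| `^ r)%:E.
  under eq_integral do rewrite EFinM.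
  rewrite ge0_integralZl//; first exact/measurable_EFinP.
  by move=> w _; rewrite lee_fin.
move: h1; rewrite (integral_EFinD P (madd _ _ mA' (mmul _ _ mpmT my)) mppT
    (add0 _ _ A'0 (mul0 _ _ pm0 y0)) pp0).
rewrite (integral_EFinD P mA' (mmul _ _ mpmT my) A'0 (mul0 _ _ pm0 y0)).
rewrite (integral_EFinD P (madd _ _ (madd _ _ mAT (mmul _ _ mppT my)) mpmT)
    (mmul (cst 4%R) _ (measurable_cst _) mD)
    (add0 _ _ (add0 _ _ A0 (mul0 _ _ pp0 y0)) pm0)); last first.
  by move=> w; rewrite mulr_ge0.
rewrite (integral_EFinD P (madd _ _ mAT (mmul _ _ mppT my)) mpmT
    (add0 _ _ A0 (mul0 _ _ pp0 y0)) pm0).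
rewrite (integral_EFinD P mAT (mmul _ _ mppT my) A0 (mul0 _ _ pp0 y0)).
rewrite i4 {}Epp {}Epm.
have fB : \int[P]_w (B w)%:E \is a fin_num.
  exact: integral_EFin_fin_num B0 fa.
have fA' : \int[P]_w (A w)%:E \is a fin_num.
  exact: integral_EFin_fin_num A0 fA.
have fs' : \int[P]_w (phi w * `|s w| `^ r)%:E \is a fin_num.
  exact: (integral_EFin_fin_num (fun w => mulr_ge0 (phi0 w) (powR_ge0 _ _)) fs).
have -> : \int[P]_w (phi w * `|s w + a w * \sum_(i < v.+1) (xN n i w - 1)| `^ r)%:E =
    \int[P]_w (A' w)%:E.
  by apply: eq_integral => w _; rewrite /A' /S big_ord_recr/= mulrDr addrA.
have fC : \int[P]_w (B w * `|y w - 1| `^ r)%:E \is a fin_num.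
  rewrite ge0_fin_numE; last by apply: integral_ge0 => w _; rewrite lee_fin.
  by apply: (le_lt_trans C); rewrite -(fineK fB) -EFinM ltry.
have {}IH : \int[P]_w (A w)%:E <= \int[P]_w (phi w * `|s w| `^ r)%:E +
  (4 * c * v%:R)%:E * \int[P]_w (B w)%:E by exact: IH.
rewrite -[v.+1%:R]natr1; move=> main.
exact: (ereal_increment_le IH C fpp fpm fA' fB fs' fC main).
Qed.

End lower_bound.

(** * The normalized population without immigration *)

Section martingale.
Local Open Scope ereal_scope.
Context d (T : measurableType d) (R : realType) (P : probability T R).
Variables (Q : nat -> {RV P >-> Delta R}).
Variables (N : nat -> nat -> {RV P >-> nat}) (Y : nat -> {RV P >-> nat}).
Hypothesis HZ : bpire_data Q N Y.
Hypothesis mean_ae : {ae P, forall w, 0 < law_mean (offspring Q 0 w) < +oo}.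

Local Notation full I := (g_sigma_algebraType (full_system Q N Y I)).
Local Notation past n := (g_sigma_algebraType (past_system Q N Y n)).

Variables (th c rho rho2 : R).
Hypothesis th01 : (0 < th <= 1)%R.
Hypothesis c_moment : \int[P]_w
  (`|(N 0 0 w)%:R * expR (- log_mean (Q 0%N w)) - 1| `^ (1 + th))%:E <= c%:E.
Hypothesis rho01 : (0 <= rho < 1)%R.
Hypothesis rhoE : \int[P]_w (expR (- (th * log_mean (Q 0%N w))))%:E = rho%:E.
Hypothesis rho2E : \int[P]_w (expR (- ((1 + th) * log_mean (Q 0%N w))))%:E = rho2%:E.

Let xN n i w : R := ((N n i w)%:R * expR (- log_mean (Q n w)))%R.

Let mxN n i : measurable_fun setT (xN n i).
Proof.
apply: (@measurable_nat_comp _ T _ _ (N n i)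
  (fun b w => b%:R * expR (- log_mean (Q n w)))%R) => // b.
apply: measurable_funM => //.
apply: (measurableT_comp (@measurable_expR R)); apply: measurable_funN.
exact: (measurableT_comp (@measurable_log_mean R)).
Qed.

Lemma mean_particles (I : nat -> nat -> Prop) n v (phi : T -> R) :
  (forall i, ~ I n i) -> measurable_fun [set: full I] phi -> (forall w, (0 <= phi w)%R) ->
  \int[P]_w (phi w * \sum_(i < v) xN n i w)%:E = v%:R%:E * \int[P]_w (phi w)%:E.
Proof.
move=> nI mphi phi0; have mphiT := full_measurable mphi.
have xN0 i w : (0 <= xN n i w)%R by rewrite mulr_ge0// expR_ge0.
elim: v => [|v IH].
  under eq_integral do rewrite big_ord0 mulr0.
  by rewrite integral0 mul0e.
under eq_integral do rewrite big_ord_recr/= mulrDr.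
rewrite integral_EFinD.
- rewrite IH (mean_particle HZ mean_ae (nI _) mphi phi0).
  by rewrite -[v.+1%:R]natr1 EFinD ge0_muleDl ?lee_fin//= mul1e.
- by apply: measurable_funM => //; exact: measurable_sum.
- exact: measurable_funM.
- by move=> w; rewrite mulr_ge0// sumr_ge0.
- by move=> w; rewrite mulr_ge0.
Qed.

Let V l K m w := flow N (fun _ _ => 0%N) l K m w.

Let mV l K m : measurable_fun [set: past (l + m)] (V l K m).
Proof. by apply: measurable_flow => n n' _; exact: measurable_cst. Qed.

Let mind l K m v : measurable_fun [set: past (l + m)]
  (\1_(V l K m @^-1` [set v]) : T -> R).
Proof.
apply: measurable_indic.
by have := @mV l K m measurableT [set v] I; rewrite setTI.
Qed.

Let mexpw t l m : measurable_fun [set: past (l + m)]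
  (fun w => expR (- (t * walk Q l m w)))%R.
Proof.
apply: (measurableT_comp (@measurable_expR R)); apply: measurable_funN.
by apply: measurable_funM => //; exact: measurable_walk.
Qed.

(** In each generation the weight brings a factor [m_j^(- 1 - th)]: one power of the mean
    compensates the reproduction and the remaining one averages to [rho]. *)
Lemma flow_weighted_mean l K m (phi : T -> R) :
  measurable_fun [set: past l] phi -> (forall w, (0 <= phi w)%R) ->
  \int[P]_w (phi w * ((V l K m w)%:R * expR (- ((1 + th) * walk Q l m w))))%:E
  <= (K%:R * rho ^+ m)%:E * \int[P]_w (phi w)%:E.
Proof.
move=> mphi phi0; elim: m => [|m IH].
  rewrite expr0 mulr1 -ge0_integralZl//; last 2 first.
  - by apply/measurable_EFinP; exact: past_measurable mphi.
  - by move=> w _; rewrite lee_fin.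
  rewrite le_eqVlt; apply/orP; left; apply/eqP; apply: eq_integral => w _.
  by rewrite /walk big_ord0 mulr0 oppr0 expR0 mulr1 mulrC EFinM.
have [rho0 _] := andP rho01.
have mphi' : measurable_fun [set: past (l + m)] phi.
  by apply: past_measurableS mphi; exact: leq_addr.
have mVR m' : measurable_fun [set: T] (fun w => (V l K m' w)%:R : R).
  apply: (@measurableT_comp _ _ _ _ _ _ (fun n : nat => n%:R : R)) => //.
  exact: past_measurable (@mV l K m').
have mexpT t m' := past_measurable (@mexpw t l m').
have mphiT := past_measurable mphi.
have mF m' : measurable_fun [set: T]
    (fun w => phi w * ((V l K m' w)%:R * expR (- ((1 + th) * walk Q l m' w))))%R.
  apply: measurable_funM => //; apply: measurable_funM; first exact: mVR.
  exact: mexpT.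
apply: (@le_trans _ _ (\int[P]_w (rho *
    (phi w * ((V l K m w)%:R * expR (- ((1 + th) * walk Q l m w)))))%:E)); last first.
  under eq_integral do rewrite EFinM.
  rewrite ge0_integralZl//; last 2 first.
  - by apply/measurable_EFinP; exact: mF.
  - by move=> w _; rewrite lee_fin !mulr_ge0// expR_ge0.
  apply: (le_trans (lee_wpmul2l _ IH)); first by rewrite lee_fin.
  by rewrite muleA -EFinM exprS mulrCA.
apply: (le_integral_by_value (past_measurable (@mV l K m))).
- by apply/measurable_EFinP; exact: mF.
- by apply/measurable_EFinP; apply: measurable_funM => //; exact: mF.
- by move=> w; rewrite lee_fin !mulr_ge0// expR_ge0.
- by move=> w; rewrite lee_fin !mulr_ge0// expR_ge0.
move=> v; set n := (l + m)%N.
pose chi w : R := (\1_(V l K m @^-1` [set v]) w * (phi w * expR (- ((1 + th) * walk Q l m w))))%R.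
have chi0 w : (0 <= chi w)%R by rewrite !mulr_ge0// expR_ge0.
have mchi : measurable_fun [set: past n] chi.
  apply: measurable_funM; first exact: mind.
  by apply: measurable_funM; [exact: mphi'|exact: mexpw].
(* The part of the new weight that survives once the offspring numbers have been normalized. *)
pose psi w : R := (chi w * expR (- (th * log_mean (Q n w))))%R.
have psi0 w : (0 <= psi w)%R by rewrite mulr_ge0// expR_ge0.
pose I n' (_ : nat) := (n' < n)%N.
have In n' i : (n' < n)%N -> I n' i by [].
have mpsi : measurable_fun [set: full I] psi.
  apply: measurable_funM; first exact: past_measurable_full In mchi.
  apply: (measurableT_comp (@measurable_expR R)); apply: measurable_funN.
  apply: measurable_funM => //; apply: (measurableT_comp (@measurable_log_mean R)).
  exact: full_system_environment.
have Epsi : \int[P]_w (psi w)%:E = rho%:E * \int[P]_w (chi w)%:E.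
  rewrite muleC -rhoE.
  rewrite -(@past_environment_integral _ _ _ _ _ _ _ HZ n (EFin \o chi)
    (fun q => (expR (- (th * log_mean q)))%:E))//.
  - exact/measurable_EFinP.
  - apply/measurable_EFinP; apply: (measurableT_comp (@measurable_expR R)).
    by apply: measurable_funN; apply: measurable_funM => //; exact: measurable_log_mean.
rewrite le_eqVlt; apply/orP; left; apply/eqP.
transitivity (\int[P]_w (psi w * \sum_(i < v) xN n i w)%:E).
  apply: eq_integral => w _; rewrite -EFinM; congr EFin.
  rewrite /psi /chi indicE; case: (boolP (w \in _)) => [|_]; last by rewrite !mul0r.
  rewrite inE /= -/n => Vv.
  have -> : V l K m.+1 w = (\sum_(i < v) N n i w)%N by rewrite /V /= -/(V l K m w) Vv addn0.
  rewrite walkS -/n natr_sum -mulr_suml !mul1r.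
  have -> : (- ((1 + th) * (walk Q l m w + log_mean (Q n w))) =
     - ((1 + th) * walk Q l m w) + - (th * log_mean (Q n w)) - log_mean (Q n w))%R by ring.
  by rewrite !expRD; ring.
rewrite (@mean_particles I) => [||//|//]; last by move=> i; rewrite /I ltnn.
rewrite Epsi muleA -EFinM -ge0_integralZl//; last 3 first.
- by apply/measurable_EFinP; exact: past_measurable mchi.
- by move=> w _; rewrite lee_fin.
- by rewrite lee_fin mulr_ge0.
apply: eq_integral => w _; rewrite -!EFinM; congr EFin.
rewrite /chi indicE; case: (boolP (w \in _)) => [|_]; last by rewrite !mul0r mulr0.
by rewrite inE /= => Vv; rewrite Vv !mul1r; ring.
Qed.

(** Given the past, one generation adds [V] centered terms of size [a = exp (- walk)], so the moment
    grows by at most [4 * c] times the mean of [V * a ^ (1 + th)]. By [flow_weighted_mean] these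
    means decrease geometrically, so the bound is uniform in time. *)
Lemma flow_deviation l K m (phi : T -> R) :
  measurable_fun [set: past l] phi -> (forall w, (0 <= phi w)%R) ->
  \int[P]_w (phi w)%:E < +oo ->
  \int[P]_w (phi w * `|(V l K m w)%:R * expR (- walk Q l m w) - K%:R| `^ (1 + th))%:E
  <= (4 * c * K%:R * \sum_(j < m) rho ^+ j)%:E * \int[P]_w (phi w)%:E.
Proof.
move=> mphi phi0 fphi; set r := (1 + th)%R.
have [rho0 _] := andP rho01; have [th0 th1] := andP th01.
have c0 : (0 <= c)%R.
  rewrite -lee_fin; apply: le_trans c_moment; apply: integral_ge0 => w _.
  by rewrite lee_fin powR_ge0.
elim: m => [|m IH].
  rewrite big_ord0 mulr0 mul0e le_eqVlt; apply/orP; left; apply/eqP.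
  rewrite -[RHS](@integral0 _ T _ P setT); apply: eq_integral => w _.
  by rewrite /walk big_ord0 oppr0 expR0 mulr1 subrr normr0 powR0 ?mulr0// gt_eqF// addr_gt0.
have mphi' : measurable_fun [set: past (l + m)] phi.
  by apply: past_measurableS mphi; exact: leq_addr.
have mphiT := past_measurable mphi.
have mexp m' : measurable_fun [set: past (l + m')] (fun w => expR (- walk Q l m' w))%R.
  apply: (measurableT_comp (@measurable_expR R)); apply: measurable_funN.
  exact: measurable_walk.
have mVR m' : measurable_fun [set: past (l + m')] (fun w => (V l K m' w)%:R : R).
  by apply: (@measurableT_comp _ _ _ _ _ _ (fun n : nat => n%:R : R)) => //; exact: mV.
pose W m' w : R := ((V l K m' w)%:R * expR (- walk Q l m' w) - K%:R)%R.
have mW m' : measurable_fun [set: past (l + m')] (W m').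
  by apply: measurable_funB => //; exact: measurable_funM.
have mabsW m' : measurable_fun [set: T] (fun w => phi w * `|W m' w| `^ r)%R.
  apply: measurable_funM => //; apply: (measurableT_comp (measurable_powR _)).
  by apply: (measurableT_comp (@normr_measurable R setT)); exact: past_measurable (mW m').
pose G w : R := (phi w * ((V l K m w)%:R * expR (- (r * walk Q l m w))))%R.
have mG : measurable_fun [set: T] G.
  apply: measurable_funM => //; apply: measurable_funM.
    exact: past_measurable (mVR m).
  exact: past_measurable (@mexpw r l m).
have G0 w : (0 <= G w)%R by rewrite !mulr_ge0// expR_ge0.
have absW0 m' w : (0 <= phi w * `|W m' w| `^ r)%R by rewrite mulr_ge0// powR_ge0.
have c40 : (0 <= 4 * c)%R by rewrite mulr_ge0.
have step : \int[P]_w (phi w * `|W m.+1 w| `^ r)%:E <=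
    \int[P]_w (phi w * `|W m w| `^ r + 4 * c * G w)%:E.
  apply: (le_integral_by_value (past_measurable (@mV l K m))).
  - exact/measurable_EFinP.
  - by apply/measurable_EFinP; apply: measurable_funD => //; exact: measurable_funM.
  - by move=> w; rewrite lee_fin.
  - by move=> w; rewrite lee_fin addr_ge0// mulr_ge0.
  move=> v; set n := (l + m)%N.
  pose chi w : R := (\1_(V l K m @^-1` [set v]) w * phi w)%R.
  have chi0 w : (0 <= chi w)%R by rewrite mulr_ge0.
  have chi_le w : (chi w <= phi w)%R.
    by rewrite /chi indicE ler_piMl//; case: (_ \in _).
  have mchi : measurable_fun [set: past n] chi.
    by apply: measurable_funM; [exact: mind|exact: mphi'].
  have mchiT := past_measurable mchi.
  pose a w : R := expR (- walk Q l m w).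
  pose s w : R := (v%:R * a w - K%:R)%R.
  have a0 w : (0 <= a w)%R by exact: expR_ge0.
  have ma : measurable_fun [set: past n] a by exact: mexp.
  have ms : measurable_fun [set: past n] s.
    by apply: measurable_funB => //; exact: measurable_funM.
  have ar w : (a w `^ r = expR (- (r * walk Q l m w)))%R.
    by rewrite /a -expRM; congr expR; ring.
  have chiW w : (chi w * `|s w| `^ r = chi w * `|W m w| `^ r)%R.
    rewrite /chi indicE; case: (boolP (w \in _)) => [|_]; last by rewrite !mul0r.
    by rewrite inE /= /s /W => <-.
  have fs : \int[P]_w (chi w * `|s w| `^ r)%:E < +oo.
    apply: (@le_lt_trans _ _ (\int[P]_w (phi w * `|W m w| `^ r)%:E)).
      under eq_integral do rewrite chiW.
      apply: le_integral_EFin => // [|w].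
        apply: measurable_funM => //; apply: (measurableT_comp (measurable_powR _)).
        by apply: (measurableT_comp (@normr_measurable R setT)); exact: past_measurable (mW m).
      by rewrite mulr_ge0 ?powR_ge0//= ler_wpM2r// powR_ge0.
    apply: (le_lt_trans IH); rewrite lte_mul_pinfty// lee_fin !mulr_ge0//.
    by apply: sumr_ge0 => j _; rewrite exprn_ge0.
  have fa : \int[P]_w (chi w * a w `^ r)%:E < +oo.
    apply: (@le_lt_trans _ _ (\int[P]_w (phi w * expR (- (r * walk Q l m w)))%:E)).
      apply: le_integral_EFin => [||w].
      - by apply: measurable_funM => //; apply: (measurableT_comp (measurable_powR _)); exact: past_measurable ma.
      - by apply: measurable_funM => //; exact: past_measurable (@mexpw r l m).
      - by rewrite ar mulr_ge0 ?expR_ge0//= ler_wpM2r// expR_ge0.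
    (* The moment of order [1 + th] supplies the finiteness required by [increment_loop]. *)
    rewrite (walk_moment HZ m rho2E mphi phi0) muleC lte_mul_pinfty// lee_fin.
    apply: exprn_ge0; rewrite -lee_fin -rho2E; apply: integral_ge0 => w _.
    by rewrite lee_fin expR_ge0.
  have := @increment_loop _ _ _ _ Q N Y HZ mean_ae th c th01 c_moment n v chi s a
    mchi ms ma chi0 a0 fs fa.
  rewrite -/r => main.
  have -> : \int[P]_w ((\1_(V l K m @^-1` [set v]) w)%:E * (phi w * `|W m.+1 w| `^ r)%:E) =
    \int[P]_w (chi w * `|s w + a w * \sum_(i < v) (xN n i w - 1)| `^ r)%:E.
    apply: eq_integral => w _; rewrite -EFinM; congr EFin.
    rewrite /chi indicE; case: (boolP (w \in _)) => [|_]; last by rewrite !mul0r.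
    rewrite inE /= => Vv; rewrite !mul1r; congr (_ * `| _ | `^ _)%R.
    have VS : V l K m.+1 w = (\sum_(i < v) N n i w)%N by rewrite /V /= -/(V l K m w) Vv addn0.
    rewrite /W VS walkS opprD expRD -/(a w) -/n.
    rewrite big_split/= sumr_const card_ord natr_sum /s /xN -mulr_suml.
    by rewrite mulNrn mulrBr mulr_natr; ring.
  apply: (le_trans main).
  rewrite -ge0_integralZl//; last 3 first.
  - apply/measurable_EFinP; apply: measurable_funM => //.
    by apply: (measurableT_comp (measurable_powR _)); exact: past_measurable ma.
  - by move=> w _; rewrite lee_fin mulr_ge0// powR_ge0.
  - by rewrite lee_fin mulr_ge0.
  under [X in _ + X]eq_integral do rewrite -EFinM.
  rewrite -integral_EFinD.
  - rewrite le_eqVlt; apply/orP; left; apply/eqP; apply: eq_integral => w _.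
    rewrite -EFinM; congr EFin; rewrite chiW ar /chi /G indicE.
    case: (boolP (w \in _)) => [|_]; last by rewrite !mul0r mulr0 addr0.
    by rewrite inE /= => Vv; rewrite Vv; ring.
  - apply: measurable_funM => //; apply: (measurableT_comp (measurable_powR _)).
    by apply: (measurableT_comp (@normr_measurable R setT)); exact: past_measurable ms.
  - apply: measurable_funM => //; apply: measurable_funM => //.
    by apply: (measurableT_comp (measurable_powR _)); exact: past_measurable ma.
  - by move=> w; rewrite mulr_ge0// powR_ge0.
  - by move=> w; rewrite !mulr_ge0// powR_ge0.
apply: (le_trans step); rewrite integral_EFinD//; last 2 first.
- exact: measurable_funM.
- by move=> w; rewrite mulr_ge0.
have -> : \int[P]_w (4 * c * G w)%:E = (4 * c)%:E * \int[P]_w (G w)%:E.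
  under eq_integral do rewrite EFinM.
  rewrite ge0_integralZl//; first exact/measurable_EFinP.
  by move=> w _; rewrite lee_fin.
have hG := flow_weighted_mean K m mphi phi0.
have := lee_wpmul2l (_ : 0 <= (4 * c)%:E) hG; rewrite lee_fin => /(_ c40) hG'.
apply: (le_trans (leeD IH hG')).
rewrite muleA -EFinM -ge0_muleDl ?lee_fin; last 2 first.
- by rewrite !mulr_ge0// sumr_ge0// => j _; rewrite exprn_ge0.
- by rewrite !mulr_ge0// exprn_ge0.
by rewrite -EFinD big_ord_recr/= mulrDr !mulrA.
Qed.

(** Markov's inequality of order [1 + th] for a deviation of at least [K / 2]: the moment is linear
    in [K] and the threshold has degree [1 + th], which leaves a bound of order [K^(- th)]. *)
Lemma flow_small_prob l K m A : (0 < K)%N -> <<s past_system Q N Y l >> A ->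
  P (A `&` [set w | ((V l K m w)%:R * expR (- walk Q l m w) <= K%:R / 2)%R])
  <= (8 * c / (1 - rho) * (2 / K%:R) `^ th)%:E * P A.
Proof.
move=> K0 sA; set r := (1 + th)%R.
have [rho0 rho1] := andP rho01; have [th0 th1] := andP th01.
have mA : measurable A.
  by apply: (smallest_sub _ (@past_system_measurable _ _ _ _ Q N Y l) sA); exact: sigma_algebra_measurable.
have c0 : (0 <= c)%R.
  rewrite -lee_fin; apply: le_trans c_moment; apply: integral_ge0 => w _.
  by rewrite lee_fin powR_ge0.
have KR : (0 < K%:R :> R)%R by rewrite ltr0n.
set W := fun w => ((V l K m w)%:R * expR (- walk Q l m w))%R.
have mW : measurable_fun [set: T] W.
  apply: measurable_funM.
    apply: (@measurableT_comp _ _ _ _ _ _ (fun n : nat => n%:R : R)) => //.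
    exact: past_measurable (@mV l K m).
  apply: (measurableT_comp (@measurable_expR R)); apply: measurable_funN.
  exact: past_measurable (@measurable_walk _ _ _ _ Q N Y l m).
set B := [set w | (W w <= K%:R / 2)%R].
have mB : measurable B.
  rewrite (_ : B = W @^-1` `]-oo, (K%:R / 2)%R]).
    by rewrite -[X in measurable X]setTI; exact: mW.
  by apply/seteqP; split => w; rewrite /B /= in_itv.
have mphi : measurable_fun [set: past l] (\1_A : T -> R) by exact: measurable_indic.
have iA : \int[P]_w (\1_A w)%:E = P A by rewrite integral_indic// setIT.
have main := @flow_deviation l K m (\1_A : T -> R) mphi (fun w => _).
have {main} : \int[P]_w (\1_A w * `|W w - K%:R| `^ r)%:E <=
    (4 * c * K%:R * \sum_(j < m) rho ^+ j)%:E * P A.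
  rewrite -iA; apply: main => //.
  by rewrite iA (le_lt_trans (probability_le1 _ mA))// ltry.
move=> main.
have low : ((K%:R / 2) `^ r)%:E * P (A `&` B) <= \int[P]_w (\1_A w * `|W w - K%:R| `^ r)%:E.
  have -> : P (A `&` B) = \int[P]_w (\1_(A `&` B) w)%:E.
    by rewrite integral_indic ?setIT//; exact: measurableI.
  rewrite -ge0_integralZl//; last first.
    by apply/measurable_EFinP/measurable_indic; exact: measurableI.
  under eq_integral do rewrite -EFinM.
  apply: le_integral_EFin => [||w].
  - by apply: measurable_funM => //; apply: measurable_indic; exact: measurableI.
  - apply: measurable_funM; first exact: measurable_indic.
    apply: (measurableT_comp (measurable_powR _)).
    by apply: (measurableT_comp (@normr_measurable R setT)); exact: measurable_funB.
  rewrite mulr_ge0 ?powR_ge0//= indicI mulrCA ler_wpM2l// indicE.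
  case: (boolP (w \in B)) => [|_]; last by rewrite mulr0 powR_ge0.
  rewrite inE /B /= => Ww; rewrite mulr1; apply: ge0_ler_powR.
  - by rewrite addr_ge0// ltW.
  - by rewrite nnegrE divr_ge0.
  - by rewrite nnegrE.
  - by rewrite distrC; apply: le_trans (ler_norm _); lra.
have {low main} := le_trans low main.
have sumle : (\sum_(j < m) rho ^+ j <= (1 - rho)^-1)%R.
  rewrite -div1r ler_pdivlMr; last by lra.
  have -> : ((\sum_(j < m) rho ^+ j) * (1 - rho) = 1 - rho ^+ m)%R.
    by rewrite -[in RHS]opprB subrX1; ring.
  by rewrite lerBlDr lerDl exprn_ge0.
have pK : (0 < (K%:R / 2) `^ r :> R)%R by rewrite powR_gt0// divr_gt0.
have fA : P A \is a fin_num by rewrite fin_num_measure.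
have fAB : P (A `&` B) \is a fin_num by rewrite fin_num_measure//; exact: measurableI.
rewrite -(fineK fA) -(fineK fAB) -!EFinM !lee_fin.
have PA0 : (0 <= fine (P A))%R by exact: fine_ge0.
move: (fine _) (fine _) PA0 => x y y0 h.
have h2 : (x <= ((K%:R / 2) `^ r)^-1 * (4 * c * K%:R * (\sum_(j < m) rho ^+ j) * y))%R.
  by rewrite mulrC ler_pdivlMr// mulrC.
apply: (le_trans h2).
have -> : (((K%:R / 2) `^ r)^-1 = 2 / K%:R * (2 / K%:R) `^ th)%R.
  rewrite -powR1S ?divr_ge0// -/r.
  have e : (K%:R / 2 * (2 / K%:R) = 1 :> R)%R by field; rewrite gt_eqF.
  have e2 : ((K%:R / 2) `^ r * (2 / K%:R) `^ r = 1 :> R)%R.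
    by rewrite -powRM ?divr_ge0// e powR1.
  by rewrite -[RHS](mulKf (lt0r_neq0 pK)) e2 mulr1.
have p0 : (0 <= (2 / K%:R) `^ th :> R)%R by exact: powR_ge0.
apply: (@le_trans _ _ (2 / K%:R * (2 / K%:R) `^ th * (4 * c * K%:R * (1 - rho)^-1 * y)))%R.
  apply: ler_wpM2l; first by rewrite mulr_ge0// divr_ge0.
  by apply: ler_wpM2r => //; apply: ler_wpM2l; rewrite ?mulr_ge0.
rewrite le_eqVlt; apply/orP; left; apply/eqP; field.
by rewrite (gt_eqF KR)/=; lra.
Qed.

End martingale.

Section probability_facts.
Context d (T : measurableType d) (R : realType) (P : probability T R).

Definition pr (A : set T) : R := fine (P A).

Lemma pr_ge0 A : 0 <= pr A. Proof. exact: fine_ge0. Qed.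

Lemma prE A : measurable A -> P A = (pr A)%:E.
Proof. by move=> mA; rewrite fineK ?fin_num_measure. Qed.

Lemma pr_le A B : measurable A -> measurable B -> A `<=` B -> pr A <= pr B.
Proof. by move=> mA mB AB; rewrite fine_le ?fin_num_measure// le_measure ?inE. Qed.

Lemma pr_le1 A : measurable A -> pr A <= 1.
Proof. by move=> mA; rewrite -lee_fin -prE// probability_le1. Qed.

Lemma prU_le A B : measurable A -> measurable B -> pr (A `|` B) <= pr A + pr B.
Proof.
move=> mA mB; rewrite -lee_fin EFinD -!prE//; last exact: measurableU.
exact: measureU2.
Qed.

Lemma prD A B : measurable A -> measurable B -> pr A = pr (A `&` B) + pr (A `\` B).
Proof.
move=> mA mB; apply: EFin_inj; rewrite EFinD -!prE//; last 2 first.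
- exact: measurableD.
- exact: measurableI.
rewrite -measureU//; [by rewrite setUIDK|exact: measurableI|exact: measurableD|].
by apply/seteqP; split => // w [[_ Bw] [_ nBw]]; exact: nBw.
Qed.

Lemma pr_cover A B C : measurable A -> measurable B -> measurable C ->
  A `<=` B `|` C -> pr A <= pr B + pr C.
Proof.
move=> mA mB mC ABC; apply: le_trans (prU_le mB mC); apply: pr_le => //.
exact: measurableU.
Qed.

End probability_facts.

(** * Escape of the population to infinity *)

Section escape.
Context d (T : measurableType d) (R : realType) (P : probability T R).
Variables (Q : nat -> {RV P >-> Delta R}).
Variables (N : nat -> nat -> {RV P >-> nat}) (Y : nat -> {RV P >-> nat}).
Hypothesis HZ : bpire_data Q N Y.
Hypothesis mean_ae : {ae P, forall w, (0 < law_mean (offspring Q 0 w) < +oo)%E}.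

Local Notation past n := (g_sigma_algebraType (past_system Q N Y n)).
Local Notation full I := (g_sigma_algebraType (full_system Q N Y I)).
Local Notation "'past_event' n" := (<<s past_system Q N Y n >>) (at level 10).
Local Notation pr := (pr P).

Variables (th c rho rho2 : R).
Hypothesis th01 : (0 < th <= 1)%R.
Hypothesis c_moment : (\int[P]_w
  (`|(N 0 0 w)%:R * expR (- log_mean (Q 0%N w)) - 1| `^ (1 + th))%:E <= c%:E)%E.
Hypothesis rho01 : (0 <= rho < 1)%R.
Hypothesis rhoE : (\int[P]_w (expR (- (th * log_mean (Q 0%N w))))%:E = rho%:E)%E.
Hypothesis rho2E : (\int[P]_w (expR (- ((1 + th) * log_mean (Q 0%N w))))%:E = rho2%:E)%E.

Lemma past_event_measurable n A : past_event n A -> measurable A.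
Proof.
move=> sA; apply: (smallest_sub _ (@past_system_measurable _ _ _ _ Q N Y n) sA).
exact: sigma_algebra_measurable.
Qed.

Lemma past_eventS n n' A : (n <= n')%N -> past_event n A -> past_event n' A.
Proof.
move=> nn'; apply: smallest_sub; first exact: smallest_sigma_algebra.
by move=> C hC; apply: sub_sigma_algebra; exact: past_systemS hC.
Qed.

Lemma past_eventI n A B : past_event n A -> past_event n B -> past_event n (A `&` B).
Proof. exact: (@measurableI _ (past n)). Qed.

Let noimm : nat -> T -> nat := fun _ _ => 0%N.

Lemma past_event_flow l z m (B : set nat) : past_event (l + m) (flow N Y l z m @^-1` B).
Proof.
have := @measurable_flow _ _ _ _ Q N Y (fun n => Y n) l z m.
move=> /(_ _)/(_ measurableT B); rewrite setTI; apply => // n n' nn'.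
exact: (@past_system_particle _ _ _ _ Q N Y _ _ 0%N nn').
Qed.

Lemma past_event_noimm l z m (B : set nat) : past_event (l + m) (flow N noimm l z m @^-1` B).
Proof.
have := @measurable_flow _ _ _ _ Q N Y noimm l z m.
move=> /(_ _)/(_ measurableT B); rewrite setTI; apply => // n n' nn'.
exact: measurable_cst.
Qed.

Lemma measurable_walkT l m : measurable_fun [set: T] (walk Q l m).
Proof. exact: past_measurable (@measurable_walk _ _ _ _ Q N Y l m). Qed.

(** Markov's inequality for [exp (- th * walk)], whose mean is [rho ^+ m]: the walk tends to
    infinity in probability, uniformly over past events. *)
Lemma walk_small_prob l m A x : 0 < x -> past_event l A ->
  pr (A `&` [set w | x <= expR (- walk Q l m w)]) <= (x `^ th)^-1 * rho ^+ m * pr A.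
Proof.
move=> x0 sA; have mA := past_event_measurable sA; have [th0 th1] := andP th01.
set B := [set w | _].
have mexp : measurable_fun [set: T] (fun w => expR (- walk Q l m w)).
  apply: (measurableT_comp (@measurable_expR R)); apply: measurable_funN.
  exact: measurable_walkT.
have mB : measurable B.
  rewrite (_ : B = (fun w => expR (- walk Q l m w)) @^-1` `[x, +oo[).
    by rewrite -[X in measurable X]setTI; exact: mexp.
  by apply/seteqP; split => w; rewrite /B /= in_itv/= andbT.
have mAB : measurable (A `&` B) by exact: measurableI.
have mphi : measurable_fun [set: past l] (\1_A : T -> R) by exact: measurable_indic.
have iA : (\int[P]_w (\1_A w)%:E = P A)%E by rewrite integral_indic// setIT.
have ind0 w : 0 <= (\1_A w : R) by [].
have E := walk_moment HZ m rhoE mphi ind0.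
have px : 0 < x `^ th by rewrite powR_gt0.
have low : ((x `^ th * pr (A `&` B))%:E <= \int[P]_w (\1_A w * expR (- (th * walk Q l m w)))%:E)%E.
  rewrite EFinM -prE//.
  have -> : P (A `&` B) = (\int[P]_w (\1_(A `&` B) w)%:E)%E.
    by rewrite integral_indic ?setIT.
  rewrite -ge0_integralZl//; last 2 first.
  - by apply/measurable_EFinP; exact: measurable_indic.
  - by rewrite lee_fin powR_ge0.
  under eq_integral do rewrite -EFinM.
  apply: le_integral_EFin => [||w].
  - by apply: measurable_funM => //; exact: measurable_indic.
  - apply: measurable_funM; first exact: measurable_indic.
    apply: (measurableT_comp (@measurable_expR R)); apply: measurable_funN.
    by apply: measurable_funM => //; exact: measurable_walkT.
  rewrite mulr_ge0 ?powR_ge0//= indicI mulrCA ler_wpM2l// indicE.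
  case: (boolP (w \in B)) => [|_]; last by rewrite mulr0 expR_ge0.
  rewrite inE /B /= => xw; rewrite mulr1 mulrC -mulNr expRM.
  by apply: ge0_ler_powR; rewrite ?nnegrE ?expR_ge0// ltW.
move: low; rewrite E iA prE// -EFinM lee_fin => low.
by rewrite -mulrA ler_pdivlMl// (le_trans low)// mulrC.
Qed.

Let mnoimm l z m (B : set nat) : measurable (flow N noimm l z m @^-1` B).
Proof. by apply: (@past_event_measurable (l + m)); exact: past_event_noimm. Qed.

Let mflow l z m (B : set nat) : measurable (flow N Y l z m @^-1` B).
Proof. by apply: (@past_event_measurable (l + m)); exact: past_event_flow. Qed.

Lemma flow_large (e : R) : 0 < e -> exists2 L0, (0 < L0)%N &
  forall L, (L0 <= L)%N -> forall m l A, past_event l A ->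
  pr (A `&` [set w | (flow N noimm l L m w)%:R * expR (- walk Q l m w) <= L%:R / 2])
  <= e * pr A.
Proof.
move=> e0; have [th0 th1] := andP th01; have [rho0 rho1] := andP rho01.
have c0 : 0 <= c.
  rewrite -lee_fin; apply: le_trans c_moment; apply: integral_ge0 => w _.
  by rewrite lee_fin powR_ge0.
set D := 8 * c / (1 - rho).
have D0 : 0 <= D by rewrite divr_ge0 ?mulr_ge0//; lra.
(* Chosen so that [(D + 1) * x ^ th = e]; it then suffices that [2 / L <= x]. *)
pose x := (e / (D + 1)) `^ th^-1.
have D1 : 0 < D + 1 by rewrite ltr_wpDl.
have x0 : 0 < x by rewrite powR_gt0// divr_gt0.
exists (Num.truncn (2 / x)).+1 => // L L0L m l A sA.
have L_gt0 : (0 < L)%N by exact: leq_trans L0L.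
have LR : 0 < L%:R :> R by rewrite ltr0n.
have mA := past_event_measurable sA.
have Lx : 2 / L%:R <= x.
  rewrite ler_pdivrMr// mulrC -ler_pdivrMr//; apply/ltW.
  by apply: lt_le_trans (truncnS_gt _) _; rewrite ler_nat.
have hL : D * (2 / L%:R) `^ th <= e.
  have : (2 / L%:R) `^ th <= e / (D + 1).
    apply: (@le_trans _ _ (x `^ th)).
      by apply: ge0_ler_powR; rewrite ?nnegrE ?divr_ge0// ltW.
    by rewrite /x -powRrM mulVf ?gt_eqF// powRr1// ltW// divr_gt0.
  move=> /(ler_wpM2l D0) /le_trans; apply.
  rewrite mulrCA ler_piMr ?(ltW e0)// ler_pdivrMr// mul1r.
  by rewrite lerDl.
have := @flow_small_prob _ _ _ _ Q N Y HZ mean_ae th c rho rho2 th01 c_moment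
  rho01 rhoE rho2E l L m A L_gt0 sA.
set B := [set w | _]; have mB : measurable B.
  pose f w : R := (flow N noimm l L m w)%:R * expR (- walk Q l m w).
  rewrite (_ : B = f @^-1` `]-oo, L%:R / 2]).
    rewrite -[X in measurable X]setTI; apply: measurable_funM => //.
      apply: (@measurableT_comp _ _ _ _ _ _ (fun n : nat => n%:R : R)) => //.
      by move=> _ C _; rewrite setTI; exact: mnoimm.
    apply: (measurableT_comp (@measurable_expR R)); apply: measurable_funN.
    exact: measurable_walkT.
  by apply/seteqP; split => w; rewrite /B /= in_itv.
rewrite !prE//; last exact: measurableI.
rewrite -EFinM lee_fin => /le_trans; apply.
by rewrite ler_wpM2r// pr_ge0.
Qed.

(** A population above [exp walk * L / 2] exceeds any [K] once the walk is high. The initial number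
    [L] is chosen before [K]; only the waiting time [m0] depends on [K]. *)
Lemma flow_stays (e : R) : 0 < e -> exists2 L0, (0 < L0)%N & forall L, (L0 <= L)%N ->
  forall K, exists m0, forall m l A, (m0 <= m)%N -> past_event l A ->
  pr (A `&` flow N noimm l L m @^-1` [set z | (z < K)%N]) <= e * pr A.
Proof.
move=> e0; have [th0 th1] := andP th01; have [rho0 rho1] := andP rho01.
have e20 : 0 < e / 2 by rewrite divr_gt0.
have [L0 L0_gt0 HL] := flow_large e20; exists L0 => // L L0L K.
have LR : 0 < L%:R :> R by rewrite ltr0n (leq_trans L0_gt0).
(* If [exp (- walk) < y] and the population is above [exp walk * L / 2], it is larger than
   [K.+1]. *)
pose y : R := L%:R / (2 * K.+1%:R).
have y0 : 0 < y by rewrite divr_gt0.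
have : (y `^ th)^-1 * rho ^+ m @[m --> \oo] --> (y `^ th)^-1 * 0.
  by apply: cvgMr; apply: cvg_expr; rewrite ger0_norm.
rewrite mulr0 => /cvgr0Pnorm_le /(_ (e / 2)) /(_ e20) [m0 _ Hm].
exists m0 => m l A m0m sA.
have mA := past_event_measurable sA.
have mexp : measurable_fun [set: T] (fun w => expR (- walk Q l m w)).
  apply: (measurableT_comp (@measurable_expR R)); apply: measurable_funN.
  exact: measurable_walkT.
pose B1 := [set w | (flow N noimm l L m w)%:R * expR (- walk Q l m w) <= L%:R / 2 :> R].
pose B2 := [set w | y <= expR (- walk Q l m w)].
have mB1 : measurable B1.
  pose f w : R := (flow N noimm l L m w)%:R * expR (- walk Q l m w).
  rewrite (_ : B1 = f @^-1` `]-oo, L%:R / 2]).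
    rewrite -[X in measurable X]setTI; apply: measurable_funM => //.
    apply: (@measurableT_comp _ _ _ _ _ _ (fun n : nat => n%:R : R)) => //.
    by move=> _ B _; rewrite setTI; exact: mnoimm.
  by apply/seteqP; split => w; rewrite /B1 /= in_itv.
have mB2 : measurable B2.
  rewrite (_ : B2 = (fun w => expR (- walk Q l m w)) @^-1` `[y, +oo[).
    by rewrite -[X in measurable X]setTI; exact: mexp.
  by apply/seteqP; split => w; rewrite /B2 /= in_itv/= andbT.
have h1 : pr (A `&` B1) <= e / 2 * pr A by exact: HL.
have h2 : pr (A `&` B2) <= e / 2 * pr A.
  apply: (le_trans (walk_small_prob m y0 sA)).
  by rewrite ler_wpM2r ?pr_ge0//; apply: (le_trans (ler_norm _)); exact: Hm.
apply: (@le_trans _ _ (pr (A `&` B1) + pr (A `&` B2))); last by lra.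
apply: pr_cover; [|exact: measurableI|exact: measurableI|].
  by apply: measurableI => //; exact: mnoimm.
move=> w [Aw /= zK]; have [h|h] := leP ((flow N noimm l L m w)%:R * expR (- walk Q l m w)) (L%:R / 2 : R).
  by left.
right; split => //; rewrite /B2 /= /y ler_pdivrMr ?mulr_gt0//.
have E0 := expR_gt0 (- walk Q l m w).
have : (flow N noimm l L m w)%:R * expR (- walk Q l m w) <= K.+1%:R * expR (- walk Q l m w).
  by rewrite ler_pM2r// ler_nat ltnW// ltnW.
by lra.
Qed.

(** The siblings are integrated out one at a time. Each leaves a factor depending on the
    environment, absorbed into [phi], which is therefore general in the induction. *)
Lemma siblings_integral n b L (phi : T -> R) :
  measurable_fun [set: full (fun n' _ => (n' < n)%N)] phi -> (forall w, 0 <= phi w) ->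
  (\int[P]_w (phi w * \prod_(i < L) \1_(N n i @^-1` [set b]) w)%:E =
   \int[P]_w (phi w * fine ((Q n w).1 [set b]) ^+ L)%:E)%E.
Proof.
elim: L phi => [|L IH] phi mphi phi0.
  by apply: eq_integral => w _; rewrite big_ord0 expr0.
pose I n' i := (n' < n)%N || (n' == n) && (i <= L)%N.
have mphiI : measurable_fun [set: full I] phi.
  apply: g_sigma_measurable_funS mphi => C hC; apply: sub_sigma_algebra.
  by apply: full_systemS hC => n' i; rewrite /I => ->.
have mkappa J : measurable_fun [set: full J] (fun w => fine ((Q n w).1 [set b])).
  apply: (measurableT_comp (f := @fine R)); first exact: fine_measurable.
  apply: (measurableT_comp (measurable_particle_law 1 [set b])).
  exact: full_system_environment.
pose psi w := (phi w * \prod_(i < L) \1_(N n i @^-1` [set b]) w : R).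
have psi0 w : 0 <= psi w by rewrite mulr_ge0// prodr_ge0.
have mpsi : measurable_fun [set: full I] psi.
  apply: measurable_funM => //; apply: measurable_prod => i _.
  apply: measurable_indic.
  have := @full_system_particle _ _ _ _ Q N Y I n i.+1 _ measurableT [set b].
  by rewrite setTI; apply; rewrite // /I eqxx ltn_ord orbT.
transitivity (\int[P]_w ((psi w)%:E * (\1_(N n L @^-1` [set b]) w)%:E))%E.
  by apply: eq_integral => w _; rewrite big_ord_recr/= mulrA.
have nI : ~ I n L.+1 by rewrite /I !ltnn andbF.
rewrite (@particle_integral1 _ _ _ _ Q N Y HZ I n L.+1 b (fun w => (psi w)%:E) nI)//; last first.
  exact/measurable_EFinP.
transitivity (\int[P]_w ((phi w * fine ((Q n w).1 [set b])) *
    \prod_(i < L) \1_(N n i @^-1` [set b]) w)%:E)%E.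
  apply: eq_integral => w _; rewrite /= -[X in (_ * X)%E]fineK ?fin_num_measure//.
  by rewrite -EFinM /psi mulrAC.
rewrite (IH (fun w => phi w * fine ((Q n w).1 [set b]))).
- by apply: eq_integral => w _; rewrite exprS mulrA.
- exact: measurable_funM.
- by move=> w; rewrite mulr_ge0// fine_ge0.
Qed.

Hypothesis immigration_pos : 0 < pr (Y 0 @^-1` [set z | (0 < z)%N]).
Variable b : nat.
Hypothesis b_gt1 : (1 < b)%N.
Hypothesis offspring_pos : (0 < P [set w | 0 < (Q 0%N w).1 [set b]])%E.

Lemma pr_immigration n A : past_event n A ->
  pr (A `&` Y n @^-1` [set z | (0 < z)%N]) =
  pr (Y 0 @^-1` [set z | (0 < z)%N]) * pr A.
Proof.
move=> sA; have mA := past_event_measurable sA.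
have mY m : measurable (Y m @^-1` [set z | (0 < z)%N]).
  by rewrite -[X in measurable X]setTI; exact: (measurable_funP (Y m)).
pose B m := Y m @^-1` [set z | (0 < z)%N].
have mB m : measurable (B m) by exact: mY.
have mAB : measurable (A `&` B n) by exact: measurableI.
have iE C : measurable C -> P C = (\int[P]_w (\1_C w)%:E)%E.
  by move=> mC; rewrite integral_indic// setIT.
apply: EFin_inj; rewrite EFinM -!prE// muleC -!/(B _).
transitivity (\int[P]_w ((\1_A w)%:E *
    (\1_[set z | (0 < z)%N] (particle N Y n 0 w))%:E))%E.
  rewrite iE//; apply: eq_integral => w _.
  by rewrite indicI EFinM !indicE.
rewrite (@past_particle_integral _ _ _ _ Q N Y HZ n 0%N (\1_A : T -> R)
  (fun _ z => (\1_[set z | (0 < z)%N] z : R)%:E))//.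
by rewrite -iE// [in RHS](iE (B 0%N)).
Qed.

(** Siblings are independent only given the environment, so the constant is the mean of the [L]-th
    power of the mass at [b]. It is positive because this mass is positive with positive
    probability. *)
Lemma pr_siblings L : exists2 p, 0 < p & forall n A, past_event n A ->
  p * pr A <= pr (A `&` [set w | forall i, (i < L)%N -> N n i w = b]).
Proof.
pose kappa (q : Delta R) : R := fine (q.1 [set b]) ^+ L.
have mkappa : measurable_fun setT kappa.
  apply: measurable_funX; apply: (measurableT_comp (f := @fine R)).
    exact: fine_measurable.
  exact: (measurable_particle_law 1 [set b]).
have kappa0 q : 0 <= kappa q by rewrite exprn_ge0// fine_ge0.
have kappa1 q : kappa q <= 1.
  by rewrite exprn_ile1// ?fine_ge0// -lee_fin fineK ?fin_num_measure// probability_le1.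
have fk : (\int[P]_w (kappa (Q 0%N w))%:E \is a fin_num)%E.
  rewrite ge0_fin_numE; last by apply: integral_ge0 => w _; rewrite lee_fin.
  apply: (@le_lt_trans _ _ (\int[P]_w (1 : R)%:E)%E).
    apply: le_integral_EFin => [||w]; [exact: measurableT_comp|exact: measurable_cst|].
    by rewrite kappa0 kappa1.
  by rewrite integral_cst//= probability_setT mule1 ltry.
exists (fine (\int[P]_w (kappa (Q 0%N w))%:E)%E).
  rewrite fine_gt0// -ge0_fin_numE ?fk ?andbT; last first.
    by apply: integral_ge0 => w _; rewrite lee_fin.
  rewrite lt_neqAle eq_sym; apply/andP; split; last first.
    by apply: integral_ge0 => w _; rewrite lee_fin.
  apply/eqP => k0; move: offspring_pos.
  have := @ae_eq_integral_abs _ _ _ P setT measurableT (fun w => (kappa (Q 0%N w))%:E).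
  move=> /(_ _)[]; first by apply/measurable_EFinP; exact: measurableT_comp.
  under eq_integral do rewrite gee0_abs ?lee_fin//.
  move=> /(_ k0) ae0 _.
  have : P.-negligible [set w | (0 < (Q 0%N w).1 [set b])%E].
    apply: negligibleS ae0 => w /= h /(_ I) [] /eqP; rewrite expf_eq0 => /andP[_].
    rewrite fine_eq0 ?fin_num_measure// => /eqP h0; by rewrite h0 ltxx in h.
  move/negligibleP => ->; rewrite ?ltxx//.
  rewrite (_ : [set _ | _] = (fun w => (Q 0%N w).1 [set b]) @^-1` `]0%E, +oo[).
    rewrite -[X in measurable X]setTI.
    apply: (measurableT_comp (measurable_particle_law 1 [set b])) => //.
    exact: emeasurable_itv.
  by apply/seteqP; split => w; rewrite /= in_itv/= andbT.
move=> n A sA; have mA := past_event_measurable sA.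
set E := [set w | _].
have mN i : measurable (N n i @^-1` [set b]).
  by rewrite -[X in measurable X]setTI; exact: (measurable_funP (N n i)).
have mE : measurable E.
  rewrite (_ : E = \bigcap_(i in [set i | (i < L)%N]) (N n i @^-1` [set b])).
    have [->|L0] := posnP L.
      rewrite (_ : [set _ | _] = set0) ?bigcap_set0//.
      by apply/seteqP; split => i //=; rewrite ltn0.
    by apply: bigcap_measurable => [|i _]; [exists 0%N|exact: mN].
  by apply/seteqP; split => [w Ew i /= iL|w Ew i iL]; exact: Ew.
have mAE : measurable (A `&` E) by exact: measurableI.
have mind : measurable_fun [set: past n] (\1_A : T -> R) by exact: measurable_indic.
have ind0 w : 0 <= (\1_A w : R) by [].
have mindI : measurable_fun [set: full (fun n' _ => (n' < n)%N)] (\1_A : T -> R).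
  by apply: past_measurable_full mind.
have iE C : measurable C -> P C = (\int[P]_w (\1_C w)%:E)%E.
  by move=> mC; rewrite integral_indic// setIT.
rewrite -lee_fin EFinM (fineK fk) -!prE// muleC (iE A mA).
rewrite -(@past_environment_integral _ _ _ _ Q N Y HZ n (fun w => (\1_A w)%:E)
  (fun q => (kappa q)%:E))//; last 2 first.
- exact/measurable_EFinP.
- exact/measurable_EFinP.
under eq_integral do rewrite -EFinM.
rewrite -(siblings_integral b L mindI ind0) iE//.
apply: le_integral_EFin => [||w].
- apply: measurable_funM; first exact: measurable_indic.
  by apply: measurable_prod => i _; exact: measurable_indic.
- exact: measurable_indic.
rewrite mulr_ge0 ?prodr_ge0//= indicI ler_wpM2l//.
rewrite [leRHS]indicE; case: (boolP (w \in E)) => [_|]; first by apply: prodr_ile1 => i; rewrite indicE; case: (_ \in _); rewrite /= ?lexx ?ler01.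
rewrite notin_setE => nE.
have [i iN] : exists i : 'I_L, N n i w <> b.
  apply: contrapT => h; apply: nE => i iL; apply: contrapT => h2; apply: h.
  by exists (Ordinal iL).
by rewrite (bigD1 i)//= indicE memNset ?mul0r.
Qed.

(* An immigrant arrives, then all its descendants have [b > 1] children for
   [k] generations. *)
Lemma growth k : exists s p, 0 < p /\ forall l A, past_event l A ->
  p * pr A <= pr (A `&` flow N Y l 0 s @^-1` [set z | (2 ^ k <= z)%N]).
Proof.
elim: k => [|k [s [p [p0 IH]]]].
  exists 1%N, (pr (Y 0 @^-1` [set z | (0 < z)%N])); split => // l A sA.
  rewrite -(pr_immigration sA) le_eqVlt; apply/orP; left; apply/eqP.
  congr (pr (_ `&` _)); apply/seteqP; split => w /=; rewrite big_ord0 addn0 add0n//.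
have [q q0 Hq] := pr_siblings (2 ^ k).
exists s.+1, (q * p); split; first by rewrite mulr_gt0.
move=> l A sA; set E := flow N Y l 0 s @^-1` [set z | (2 ^ k <= z)%N].
have sE : past_event (l + s) E by exact: past_event_flow.
have sAE : past_event (l + s) (A `&` E).
  by apply: past_eventI => //; apply: past_eventS sA; exact: leq_addr.
have := Hq _ _ sAE; have := IH _ _ sA; rewrite -/E => h1 h2.
rewrite -mulrA; apply: (le_trans (ler_wpM2l (ltW q0) h1)); apply: (le_trans h2).
have mA := past_event_measurable sA.
apply: pr_le.
- apply: measurableI; first exact: past_event_measurable sAE.
  rewrite (_ : [set w | _] = \bigcap_i [set w | (i < 2 ^ k)%N -> N (l + s)%N i w = b]).
    apply: bigcapT_measurable => i; case: (ltnP i (2 ^ k)) => _.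
      rewrite (_ : [set _ | _] = N (l + s)%N i @^-1` [set b]).
        by rewrite -[X in measurable X]setTI; exact: (measurable_funP (N (l + s)%N i)).
      by apply/seteqP; split => w /=; [apply|].
    by rewrite (_ : [set _ | _] = setT)//; apply/seteqP; split.
  by apply/seteqP; split => [w Ew i _|w Ew i]; [exact: Ew|exact: Ew].
- by apply: measurableI => //; exact: (mflow l 0 s.+1).
move=> w [[Aw Ew] Nw]; split => //=; rewrite /= in Ew.
rewrite expnS; apply: leq_trans (leq_addr _ _).
rewrite -(subnKC Ew) big_split_ord/=; apply: leq_trans (leq_addr _ _).
rewrite (eq_bigr (fun=> b)) => [|i _]; last exact: Nw.
by rewrite sum_nat_const card_ord mulnC leq_mul2l b_gt1 orbT.
Qed.

(* Uniformity over the past events [A] lets failures be iterated: reaching a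
   high level has probability at least [q] at each attempt. *)
Definition unlikely_below (beta : R) (K : nat) := exists s, forall m l A,
  (s <= m)%N -> past_event l A ->
  pr (A `&` flow N Y l 0 m @^-1` [set z | (z < K)%N]) <= beta * pr A.

Let noimm_le l s m L w : (L <= flow N Y l 0 s w)%N ->
  (flow N noimm (l + s) L m w <= flow N Y l 0 (s + m) w)%N.
Proof. by move=> h; rewrite flow_addn; apply: flow_mono. Qed.

(** With probability at least [p] the population reaches [2 ^ L0 >= L0], and from there it is above
    [K] at late times with conditional probability at least one half. Neither [p] nor [L0] depends
    on [K], hence neither does [q = p / 2]. *)
Lemma unlikely_below_lt1 : exists2 q, 0 < q <= 1 & forall K, unlikely_below (1 - q) K.
Proof.
have [L0 L00 stays] := @flow_stays 2^-1 (ltac:(lra)).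
have [s [p [p0 Hp]]] := growth L0.
have p1 : p <= 1.
  have sT : past_event 0 [set: T] by exact: (@measurableT _ (past 0)).
  have := Hp _ _ sT; rewrite setTI {1}/pr /= probability_setT mulr1 => /le_trans; apply.
  by apply: pr_le1; exact: mflow.
exists (p / 2); first by apply/andP; split; lra.
move=> K; have [m0 Hm0] := stays (2 ^ L0)%N (ltnW (ltn_expl L0 (ltnSn 1))) K.
exists (s + m0)%N => m l A sm sA.
have [m' mE] : exists m', m = (s + m')%N.
  by exists (m - s)%N; rewrite subnKC// (leq_trans _ sm)// leq_addr.
rewrite mE leq_add2l in sm; rewrite {}mE.
set E := flow N Y l 0 s @^-1` [set z | (2 ^ L0 <= z)%N].
have sE : past_event (l + s) E by exact: past_event_flow.
have sAE : past_event (l + s) (A `&` E).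
  by apply: past_eventI => //; apply: past_eventS sA; exact: leq_addr.
have mA := past_event_measurable sA; have mE := past_event_measurable sE.
have h1 := Hm0 _ _ _ sm sAE; have h2 := Hp _ _ sA; rewrite -/E in h2.
have h3 := prD P mA mE.
have : pr (A `&` flow N Y l 0 (s + m') @^-1` [set z | (z < K)%N]) <=
    pr (A `\` E) + pr (A `&` E `&` flow N noimm (l + s) (2 ^ L0) m' @^-1` [set z | (z < K)%N]).
  apply: pr_cover.
  - by apply: measurableI.
  - exact: measurableD.
  - by apply: measurableI => //; exact: measurableI.
  move=> w [Aw /= Fw]; have [Ew|nEw] := pselect (E w); last by left.
  right; split => //=; apply: leq_ltn_trans Fw; exact: noimm_le.
by nra.
Qed.

(** The level [L] is so high that from it the failure probability is at most [q / 2 * beta]. If [L]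
    is not reached, which has probability at most [1 - q], the population dominates one restarted
    from zero, for which failure has probability at most [beta]. *)
Lemma unlikely_below_step q beta K : 0 < q <= 1 -> (forall K, unlikely_below (1 - q) K) ->
  0 < beta -> unlikely_below beta K -> unlikely_below ((1 - q / 2) * beta) K.
Proof.
move=> /andP[q0 q1] Hq b0 [s Hs].
have e0 : 0 < q / 2 * beta by rewrite mulr_gt0// divr_gt0.
have [L L_gt0 /(_ L (leqnn L) K)[m0 Hm0]] := flow_stays e0.
have [s1 Hs1] := Hq L.
exists (s1 + maxn s m0)%N => m l A sm sA.
have [m' mE] : exists m', m = (s1 + m')%N.
  by exists (m - s1)%N; rewrite subnKC// (leq_trans _ sm)// leq_addr.
rewrite mE leq_add2l geq_max in sm; rewrite {}mE; have [sm1 sm2] := andP sm.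
set E := flow N Y l 0 s1 @^-1` [set z | (z < L)%N].
have sE : past_event (l + s1) E by exact: past_event_flow.
have sA' : past_event (l + s1) A by apply: past_eventS sA; exact: leq_addr.
have sAE : past_event (l + s1) (A `&` E) by exact: past_eventI.
have mA := past_event_measurable sA; have mE := past_event_measurable sE.
have h1 := Hs _ _ _ sm1 sAE; have h2 := Hm0 _ _ _ sm2 sA'.
have h3 := Hs1 _ _ _ (leqnn s1) sA; rewrite -/E in h3.
have : pr (A `&` flow N Y l 0 (s1 + m') @^-1` [set z | (z < K)%N]) <=
    pr (A `&` E `&` flow N Y (l + s1) 0 m' @^-1` [set z | (z < K)%N]) +
    pr (A `&` flow N noimm (l + s1) L m' @^-1` [set z | (z < K)%N]).
  apply: pr_cover.
  - by apply: measurableI.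
  - by apply: measurableI => //; exact: measurableI.
  - by apply: measurableI.
  move=> w [Aw /= Fw]; have [Ew|nEw] := ltnP (flow N Y l 0 s1 w) L.
    left; split => //=; apply: leq_ltn_trans Fw; rewrite flow_addn.
    exact: flow_mono.
  by right; split => //=; apply: leq_ltn_trans Fw; exact: noimm_le.
have := ler_wpM2l (ltW b0) h3.
by rewrite /E; lra.
Qed.

Lemma flow_escapes e K : 0 < e -> unlikely_below e K.
Proof.
move=> e0; have [q q01 Hq] := unlikely_below_lt1; have [q0 q1] := andP q01.
have r0 : 0 < 1 - q / 2 by lra.
have iter j : unlikely_below ((1 - q / 2) ^+ j) K.
  elim: j => [|j IH].
    exists 0%N => m l A _ sA; rewrite expr0 mul1r; apply: pr_le => //.
    - by apply: measurableI => //; exact: past_event_measurable sA.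
    - exact: past_event_measurable sA.
  by rewrite exprS; apply: unlikely_below_step => //; rewrite exprn_gt0.
have : (1 - q / 2) ^+ j @[j --> \oo] --> 0.
  by apply: cvg_expr; rewrite ger0_norm ?(ltW r0)//; lra.
move=> /cvgr0Pnorm_le /(_ e e0) [j _ /(_ j (leqnn j))].
rewrite ger0_norm ?exprn_ge0 ?(ltW r0)// => je.
have [s Hs] := iter j; exists s => m l A sm sA.
by apply: (le_trans (Hs _ _ _ sm sA)); rewrite ler_wpM2r// pr_ge0.
Qed.

Lemma tail_vanishes (f : T -> R) e : measurable_fun setT f -> 0 < e ->
  exists M, forall x, M <= x -> pr [set w | x < f w] <= e.
Proof.
move=> mf e0.
have mF n : measurable [set w | (n%:R : R) < f w].
  rewrite (_ : [set w | _] = f @^-1` `]n%:R, +oo[).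
    by rewrite -[X in measurable X]setTI; exact: mf.
  by apply/seteqP; split => w; rewrite /= in_itv/= andbT.
have : P [set w | (n%:R : R) < f w] @[n --> \oo] --> P (\bigcap_n [set w | (n%:R : R) < f w]).
  apply: nonincreasing_cvg_mu => //.
  - by rewrite (le_lt_trans (probability_le1 _ _))// ltry.
  - exact: bigcapT_measurable.
  - by move=> m n mn; apply/subsetPset => w /=; apply: le_lt_trans; rewrite ler_nat.
rewrite (_ : \bigcap_n _ = set0); last first.
  apply/seteqP; split => // w /(_ (Num.truncn (f w)).+1 I) /=.
  by rewrite ltNge ltW// truncnS_gt.
rewrite measure0 => /fine_cvgP[_] /cvgr0Pnorm_le /(_ e e0) [n _ Hn].
exists n%:R => x nx.
apply: (le_trans _ (le_trans (ler_norm _) (Hn n (leqnn n)))).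
apply: pr_le => //.
  rewrite (_ : [set w | _] = f @^-1` `]x, +oo[).
    by rewrite -[X in measurable X]setTI; exact: mf.
  by apply/seteqP; split => w; rewrite /= in_itv/= andbT.
by move=> w /=; apply: le_lt_trans.
Qed.

(** After a fixed time [s] there are at least [K] individuals with high probability, and their
    descendants follow the walk started at [s]. The walk before [s] is a single random variable,
    eventually below [u n] with high probability. The starting value [k] only helps, by
    monotonicity. *)
Lemma flow_lower_prob k (u : nat -> R) e : u n @[n --> \oo] --> +oo -> 0 < e ->
  \forall n \near \oo,
    pr [set w | (flow N Y 0 k n w)%:R < expR (walk Q 0 n w - u n)] <= e.
Proof.
move=> uy e0; have e30 : 0 < e / 3 by rewrite divr_gt0.
have [L0 L0_gt0 HL] := flow_large e30.
pose K := maxn L0 2; have L0K : (L0 <= K)%N by rewrite leq_maxl.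
have K2 : 1 <= K%:R / 2 :> R.
  by rewrite ler_pdivlMr// mul1r ler_nat leq_maxr.
have [s Hs] := flow_escapes K e30.
have [M HM] := tail_vanishes (measurable_walkT 0 s) e30.
near=> n.
have sn : (s <= n)%N by near: n; exact: nbhs_infty_ge.
have Mu : M <= u n by near: n; move/cvgryPge : uy; exact.
have [m nE] : exists m, n = (s + m)%N by exists (n - s)%N; rewrite subnKC.
rewrite {}nE in sn Mu *; set v := u _ in Mu *.
have mlt (f g : T -> R) : measurable_fun setT f -> measurable_fun setT g ->
    measurable [set w | f w < g w].
  move=> mf mg; rewrite (_ : [set w | _] = (fun w => g w - f w) @^-1` `]0, +oo[).
    by rewrite -[X in measurable X]setTI; exact: measurable_funB.
  by apply/seteqP; split => w; rewrite /= in_itv/= andbT subr_gt0.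
have mnat (U : T -> nat) : (forall B : set nat, measurable (U @^-1` B)) ->
    measurable_fun [set: T] (fun w => (U w)%:R : R).
  move=> mU; apply: (@measurableT_comp _ _ _ _ _ _ (fun n : nat => n%:R : R)) => //.
  by move=> _ B _; rewrite setTI; exact: mU.
have sT l : past_event l [set: T] by exact: (@measurableT _ (past l)).
have prT : pr [set: T] = 1 by rewrite /pr /= probability_setT.
pose A1 := flow N Y 0 0 s @^-1` [set z | (z < K)%N].
pose A2 := [set w | (flow N noimm s K m w)%:R * expR (- walk Q s m w) <= K%:R / 2 :> R].
pose A3 := [set w | v < walk Q 0 s w].
have mA1 : measurable A1 by exact: mflow.
have mA2 : measurable A2.
  rewrite (_ : A2 = ~` [set w | K%:R / 2 < (flow N noimm s K m w)%:R * expR (- walk Q s m w) :> R]).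
    apply: measurableC; apply: mlt => //; apply: measurable_funM.
      by apply: mnat => B; exact: mnoimm.
    apply: (measurableT_comp (@measurable_expR R)); apply: measurable_funN.
    exact: measurable_walkT.
  by apply/seteqP; split => w; rewrite /A2 /= leNgt => /negP.
have mA3 : measurable A3 by apply: mlt => //; exact: measurable_walkT.
have h1 : pr A1 <= e / 3.
  by have := Hs s 0%N setT (leqnn s) (sT 0%N); rewrite setTI prT mulr1.
have h2 : pr A2 <= e / 3.
  by have := HL K L0K m s setT (sT s); rewrite setTI prT mulr1.
have h3 : pr A3 <= e / 3 by exact: HM.
apply: (@le_trans _ _ (pr A1 + pr (A2 `|` A3))); last first.
  by have := prU_le P mA2 mA3; lra.
apply: pr_cover => //; [|exact: measurableU|].
  apply: mlt; first by apply: mnat => B; exact: mflow.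
  apply: (measurableT_comp (@measurable_expR R)); apply: measurable_funB => //.
  exact: measurable_walkT.
move=> w /= Zw; have [|/= KZ] := ltnP (flow N Y 0 0 s w) K; first by left.
right; apply: contrapT => /not_orP[/negP + /negP].
rewrite -ltNge -leNgt => nA2 nA3.
move: Zw; apply/negP; rewrite -leNgt.
have h4 : (flow N noimm s K m w <= flow N Y 0 k (s + m) w)%N.
  by apply: (leq_trans (@noimm_le 0 s m K w KZ)); exact: flow_mono.
apply: (@le_trans _ _ (flow N noimm s K m w)%:R); last by rewrite ler_nat.
have -> : walk Q 0 (s + m) w - v = (walk Q 0 s w - v) + walk Q s m w.
  by rewrite /walk big_split_ord/=; ring.
rewrite expRD; move: nA2; rewrite expRN ltr_pdivlMr ?expR_gt0// => /ltW; apply: le_trans.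
rewrite ler_wpM2r ?expR_ge0// (le_trans _ K2)// -expR0 ler_expR.
by rewrite subr_le0.
Unshelve. all: by end_near. Qed.

End escape.

(** * The upper bound *)

Section upper_bound.
Context d (T : measurableType d) (R : realType) (P : probability T R).
Variables (Q : nat -> {RV P >-> Delta R}).
Variables (N : nat -> nat -> {RV P >-> nat}) (Y : nat -> {RV P >-> nat}).
Hypothesis HZ : bpire_data Q N Y.
Hypothesis mean_ae : {ae P, forall w, (0 < law_mean (offspring Q 0 w) < +oo)%E}.

Local Notation past n := (g_sigma_algebraType (past_system Q N Y n)).
Local Notation full I := (g_sigma_algebraType (full_system Q N Y I)).

Variables (th rho cY : R).
Hypothesis th01 : (0 < th <= 1)%R.
Hypothesis rho01 : (0 <= rho < 1)%R.
Hypothesis rhoE : (\int[P]_w (expR (- (th * log_mean (Q 0%N w))))%:E = rho%:E)%E.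
Hypothesis Y_moment :
  (\int[P]_w (((Y 0 w)%:R * expR (- log_mean (Q 0%N w))) `^ th)%:E <= cY%:E)%E.

(** Subadditivity of the power separates immigrants from offspring. By concavity the offspring part
    does not increase the moment; the immigrants of generation [m] are divided by the walk before
    them and contribute at most [cY * rho ^+ m]. *)
Lemma flow_upper_moment k m :
  (\int[P]_w (((flow N Y 0 k m w)%:R * expR (- walk Q 0 m w)) `^ th)%:E
   <= (k%:R `^ th + cY * \sum_(j < m) rho ^+ j)%:E)%E.
Proof.
have [th0 th1] := andP th01; have [rho0 rho1] := andP rho01.
elim: m => [|m IH].
  rewrite big_ord0 mulr0 addr0.
  under eq_integral do rewrite /= /walk big_ord0 oppr0 expR0 mulr1.
  by rewrite integral_cst//= probability_setT mule1.
set n := (0 + m)%N.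
pose V := flow N Y 0 k m.
have mV : measurable_fun [set: past n] V.
  apply: measurable_flow => n1 n2 n12.
  exact: (@past_system_particle _ _ _ _ Q N Y _ _ 0%N n12).
have mwalk : measurable_fun [set: past n] (walk Q 0 m).
  exact: measurable_walk.
pose a w : R := expR (- walk Q 0 m w).
have ma : measurable_fun [set: past n] a.
  by apply: (measurableT_comp (@measurable_expR R)); exact: measurable_funN.
have a0 w : 0 <= a w by exact: expR_ge0.
pose xN i w : R := (N n i w)%:R * expR (- log_mean (Q n w)).
have mxi : measurable_fun [set: T] (fun w => expR (- log_mean (Q n w))).
  apply: (measurableT_comp (@measurable_expR R)); apply: measurable_funN.
  exact: (measurableT_comp (@measurable_log_mean R)).
have xN0 i w : 0 <= xN i w by rewrite mulr_ge0// expR_ge0.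
have mnat (U : T -> nat) : measurable_fun [set: T] U -> measurable_fun [set: T] (fun w => (U w)%:R : R).
  by move=> mU; apply: (@measurableT_comp _ _ _ _ _ _ (fun n : nat => n%:R : R)).
have mxN i : measurable_fun [set: T] (xN i).
  by apply: measurable_funM => //; exact: mnat.
pose Sv v w : R := \sum_(i < v) xN i w.
have Sv0 v w : 0 <= Sv v w by exact: sumr_ge0.
have mSv v : measurable_fun [set: T] (Sv v) by exact: measurable_sum.
have mVT := past_measurable mV; have maT := past_measurable ma.
have mpow (f : T -> R) : measurable_fun [set: T] f -> measurable_fun [set: T] (fun w => f w `^ th).
  by move=> mf; exact: (measurableT_comp (measurable_powR _)).
pose f1 w : R := (a w * Sv (V w) w) `^ th.
pose f2 w : R := a w `^ th * ((Y n w)%:R * expR (- log_mean (Q n w))) `^ th.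
have f10 w : 0 <= f1 w by exact: powR_ge0.
have f20 w : 0 <= f2 w by rewrite mulr_ge0// powR_ge0.
have mf1 : measurable_fun [set: T] f1.
  apply: mpow; apply: measurable_funM => //.
  exact: (@measurable_nat_comp _ T _ _ V Sv mVT mSv).
have mf2 : measurable_fun [set: T] f2.
  apply: measurable_funM; apply: mpow => //.
  by apply: measurable_funM => //; exact: mnat.
have mZ : measurable_fun [set: T] (fun w => (flow N Y 0 k m.+1 w)%:R : R).
  apply: mnat; apply: (@past_measurable _ _ _ _ Q N Y m.+1).
  apply: (@measurable_flow _ _ _ _ Q N Y _ 0 k m.+1) => n1 n2 n12.
  exact: (@past_system_particle _ _ _ _ Q N Y _ _ 0%N n12).
apply: (@le_trans _ _ (\int[P]_w (f1 w + f2 w)%:E)%E).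
  apply: le_integral_EFin => [||w].
  - apply: mpow; apply: measurable_funM => //.
    apply: (measurableT_comp (@measurable_expR R)); apply: measurable_funN.
    exact: past_measurable (@measurable_walk _ _ _ _ Q N Y 0 m.+1).
  - exact: measurable_funD.
  rewrite powR_ge0/= /f1 /f2.
  have -> : (flow N Y 0 k m.+1 w)%:R * expR (- walk Q 0 m.+1 w) =
      a w * Sv (V w) w + a w * ((Y n w)%:R * expR (- log_mean (Q n w))).
    rewrite /= -/(V w) natrD natr_sum walkS opprD expRD -/(a w) -/n /Sv -mulr_suml.
    by ring.
  rewrite -[X in _ <= _ + X]powRM ?mulr_ge0 ?expR_ge0//.
  by apply: powR_subadd => //; rewrite !mulr_ge0 ?expR_ge0.
rewrite integral_EFinD//.
have -> : k%:R `^ th + cY * \sum_(j < m.+1) rho ^+ j =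
    (k%:R `^ th + cY * \sum_(j < m) rho ^+ j) + cY * rho ^+ m.
  by rewrite big_ord_recr/=; ring.
rewrite [X in (_ <= X)%E]EFinD; apply: leeD.
  apply: (le_trans _ IH); apply: (le_integral_by_value mVT).
  - exact/measurable_EFinP.
  - by apply/measurable_EFinP; apply: mpow; apply: measurable_funM => //; exact: mnat.
  - by move=> w; rewrite lee_fin.
  - by move=> w; rewrite lee_fin powR_ge0.
  move=> v; pose chi w : R := \1_(V @^-1` [set v]) w * (v%:R * a w) `^ th.
  have mind : measurable_fun [set: past n] (\1_(V @^-1` [set v]) : T -> R).
    apply: measurable_indic.
    by have := mV measurableT [set v] I; rewrite setTI.
  have mchi : measurable_fun [set: past n] chi.
    apply: measurable_funM; first exact: mind.
    by apply: (measurableT_comp (measurable_powR _)); exact: measurable_funM.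
  have chi0 w : 0 <= chi w by rewrite mulr_ge0// powR_ge0.
  have mchiT := past_measurable mchi.
  have -> : (\int[P]_w ((\1_(V @^-1` [set v]) w)%:E *
      (((flow N Y 0 k m w)%:R * expR (- walk Q 0 m w)) `^ th)%:E) =
      \int[P]_w (chi w)%:E)%E.
    apply: eq_integral => w _; rewrite -EFinM /chi indicE.
    case: (boolP (w \in _)) => [|_]; last by rewrite !mul0r.
    by rewrite inE /= -/(V w) => <-.
  (* The empty population is set apart: the tangent below is taken at [v], the conditional mean of
     the normalized sum, and needs [v > 0]. *)
  have [v0|v_gt0] := posnP v.
    apply: le_trans (_ : 0 <= _)%E; last by apply: integral_ge0 => w _; exact: chi0.
    rewrite le_eqVlt; apply/orP; left; apply/eqP.
    rewrite -[RHS](@integral0 _ T _ P setT); apply: eq_integral => w _.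
    rewrite -EFinM indicE; case: (boolP (w \in _)) => [|_]; last by rewrite mul0r.
    rewrite inE /= => Vv; rewrite /f1 Vv v0 /Sv big_ord0 mulr0 powR0 ?mulr0//.
    by rewrite gt_eqF.
  have vR : 0 < v%:R :> R by rewrite ltr0n.
  have thv0 : 0 <= th / v%:R by rewrite divr_ge0// ltW.
  apply: (@le_trans _ _ (\int[P]_w (chi w * (1 - th) + chi w * (th / v%:R) * Sv v w)%:E)%E).
    under eq_integral do rewrite -EFinM.
    apply: le_integral_EFin => [||w].
    - apply: measurable_funM => //; apply: measurable_indic.
      by rewrite -[X in measurable X]setTI; exact: mVT.
    - apply: measurable_funD; first exact: measurable_funM.
      by apply: measurable_funM => //; exact: measurable_funM.
    rewrite mulr_ge0//= /chi indicE.
    case: (boolP (w \in _)) => [|_]; last by rewrite !mul0r addr0.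
    rewrite inE /= => Vv; rewrite !mul1r /f1 Vv powRM// powRM//.
    have := tangent_powR (Sv0 v w) vR th01 => /(ler_wpM2l (powR_ge0 (a w) th)).
    move/le_trans; apply; rewrite le_eqVlt; apply/orP; left; apply/eqP.
    by field; rewrite gt_eqF.
  have chiv0 w : 0 <= chi w * (th / v%:R) by exact: mulr_ge0 (chi0 w) thv0.
  have mchiv : measurable_fun [set: T] (fun w => chi w * (th / v%:R)).
    exact: measurable_funM.
  have chi1 w : 0 <= chi w * (1 - th) by apply: mulr_ge0 (chi0 w) _; rewrite subr_ge0.
  have mchi1 : measurable_fun [set: T] (fun w => chi w * (1 - th)).
    exact: measurable_funM.
  rewrite (integral_EFinD P mchi1 (measurable_funM mchiv (mSv v)) chi1
    (fun w => mulr_ge0 (chiv0 w) (Sv0 v w))).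
  rewrite (@mean_particles _ _ _ _ Q N Y HZ mean_ae (fun n' _ => (n' < n)%N) n v
    (fun w => chi w * (th / v%:R)))//; last 2 first.
  - by move=> i; rewrite ltnn.
  - by apply: (measurable_funM (past_measurable_full _ mchi)).
  rewrite -ge0_integralZl//; last 2 first.
  - exact/measurable_EFinP.
  - by move=> w _; rewrite lee_fin.
  under [X in (_ + X <= _)%E]eq_integral do rewrite -EFinM.
  rewrite -integral_EFinD//; last 2 first.
  - exact: measurable_funM.
  - by move=> w; exact: mulr_ge0.
  rewrite le_eqVlt; apply/orP; left; apply/eqP; apply: eq_integral => w _.
  by congr EFin; field; rewrite gt_eqF.
pose g (q : Delta R) (z : nat) : \bar R := ((z%:R * expR (- log_mean q)) `^ th)%:E.
have mg z : measurable_fun setT (g ^~ z).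
  apply/measurable_EFinP; apply: (measurableT_comp (measurable_powR _)).
  apply: measurable_funM => //.
  apply: (measurableT_comp (@measurable_expR R)); apply: measurable_funN.
  exact: measurable_log_mean.
have g0 q z : (0 <= g q z)%E by rewrite lee_fin powR_ge0.
have math : measurable_fun [set: past n] (fun w => a w `^ th).
  exact: (measurableT_comp (measurable_powR _)).
under eq_integral do rewrite EFinM.
rewrite (@past_particle_integral _ _ _ _ Q N Y HZ n 0%N (fun w => a w `^ th) g)//; last first.
  by move=> w; exact: powR_ge0.
have -> : (\int[P]_w (a w `^ th)%:E = (rho ^+ m)%:E)%E.
  transitivity (\int[P]_w ((cst 1 : T -> R) w * expR (- (th * walk Q 0 m w)))%:E)%E.
    by apply: eq_integral => w _; rewrite /= mul1r /a -expRM; congr (expR _)%:E; ring.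
  rewrite (@walk_moment _ _ _ _ Q N Y HZ th rho 0 m (cst 1) rhoE (measurable_cst _) (fun=> ler01)).
  by rewrite /= integral_cst//= probability_setT mul1e mul1e.
by rewrite muleC EFinM lee_wpmul2r// lee_fin exprn_ge0.
Qed.

Lemma flow_upper_prob k m (u : R) :
  pr P [set w | expR u <= (flow N Y 0 k m w)%:R * expR (- walk Q 0 m w)]
  <= (k%:R `^ th + cY / (1 - rho)) * expR (- (th * u)).
Proof.
have [th0 th1] := andP th01; have [rho0 rho1] := andP rho01.
have cY0 : 0 <= cY.
  rewrite -lee_fin; apply: le_trans Y_moment; apply: integral_ge0 => w _.
  by rewrite lee_fin powR_ge0.
pose W w : R := (flow N Y 0 k m w)%:R * expR (- walk Q 0 m w).
have mW : measurable_fun [set: T] W.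
  apply: measurable_funM.
    apply: (@measurableT_comp _ _ _ _ _ _ (fun n : nat => n%:R : R)) => //.
    apply: (@past_measurable _ _ _ _ Q N Y (0 + m)%N).
    apply: (@measurable_flow _ _ _ _ Q N Y _ 0 k m) => n1 n2 n12.
    exact: (@past_system_particle _ _ _ _ Q N Y _ _ 0%N n12).
  apply: (measurableT_comp (@measurable_expR R)); apply: measurable_funN.
  exact: past_measurable (@measurable_walk _ _ _ _ Q N Y 0 m).
set B := [set w | _].
have mB : measurable B.
  rewrite (_ : B = W @^-1` `[expR u, +oo[).
    by rewrite -[X in measurable X]setTI; exact: mW.
  by apply/seteqP; split => w; rewrite /B /= in_itv/= andbT.
have low : ((expR (th * u) * pr P B)%:E <= \int[P]_w (W w `^ th)%:E)%E.
  rewrite EFinM -prE//.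
  have -> : P B = (\int[P]_w (\1_B w)%:E)%E by rewrite integral_indic ?setIT.
  rewrite -ge0_integralZl//; last first.
    by apply/measurable_EFinP; exact: measurable_indic.
  under eq_integral do rewrite -EFinM.
  apply: le_integral_EFin => [||w].
  - by apply: measurable_funM => //; exact: measurable_indic.
  - exact: (measurableT_comp (measurable_powR _)).
  rewrite mulr_ge0 ?expR_ge0//= indicE.
  case: (boolP (w \in B)) => [|_]; last by rewrite mulr0 powR_ge0.
  rewrite inE /B /= => uw; rewrite mulr1 mulrC expRM.
  by apply: ge0_ler_powR; rewrite ?nnegrE ?expR_ge0 ?(ltW th0)// (le_trans _ uw)// expR_ge0.
have := le_trans low (flow_upper_moment k m); rewrite lee_fin => h.
have sumle : \sum_(j < m) rho ^+ j <= (1 - rho)^-1.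
  rewrite -div1r ler_pdivlMr; last by lra.
  have -> : (\sum_(j < m) rho ^+ j) * (1 - rho) = 1 - rho ^+ m.
    by rewrite -[in RHS]opprB subrX1; ring.
  by rewrite lerBlDr lerDl exprn_ge0.
rewrite expRN ler_pdivlMr ?expR_gt0// mulrC (le_trans h)// lerD2l.
exact: ler_wpM2l.
Qed.

End upper_bound.

(** * The limit theorem *)

Section laws_on_nat.
Local Open Scope ereal_scope.
Context (R : realType).
Implicit Type f : probability nat R.

Lemma law_total f : \sum_(j <oo) f [set j] = 1.
Proof.
rewrite -(probability_setT f) -(_ : \bigcup_j [set j] = [set: nat]); last first.
  by apply/seteqP; split => // j _; exists j.
rewrite measure_bigcup//.
  by apply: eq_eseriesl => j; rewrite in_setT.
by move=> i j _ _ [k [/= -> ->]].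
Qed.

(** Every nonzero value is at least one. Read as a lower bound for the mean, this turns the bound on
    [f({0})] into a lower bound for [log m_1]. *)
Lemma law_mean_ge f : 1 <= law_mean f + f [set 0%N].
Proof.
have split0 (u : nat -> \bar R) : (forall j, 0 <= u j) ->
  \sum_(0 <= j <oo) u j = u 0%N + \sum_(0 <= j <oo) u j.+1.
  move=> u0; rewrite (nneseries_recl (fun k _ => u0 k))// -(nneseries_addn 1 u0).
  by congr (_ + _); apply: eq_eseriesr => j _; rewrite addn1.
rewrite -(law_total f) /law_mean (split0 (fun j => f [set j])); last by move=> j; exact: measure_ge0.
rewrite (split0 (fun j => j%:R%:E * f [set j])); last first.
  by move=> j; rewrite mule_ge0// lee_fin.
rewrite mul0e add0e addeC; apply: leeD2r.
apply: lee_nneseries => [j _ _|j _]; first exact: measure_ge0.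
apply: lee_pemull; first exact: measure_ge0.
by rewrite lee_fin ler1n.
Qed.

Lemma law_mean_le1 f : (forall j, (1 < j)%N -> f [set j] = 0) -> law_mean f <= 1.
Proof.
move=> f0; rewrite /law_mean (nneseries_split 0 2)//; last first.
  by move=> j _; rewrite mule_ge0// lee_fin.
rewrite eseries0 ?adde0; last first.
  by move=> j j2 _; rewrite f0 ?mule0.
rewrite !big_nat_recl//= big_geq// mul0e add0e mul1e adde0.
exact: probability_le1.
Qed.

End laws_on_nat.

Section walk_clt.
Context d (T : measurableType d) (R : realType) (P : probability T R).
Variables (Q : nat -> {RV P >-> Delta R}).
Variables (N : nat -> nat -> {RV P >-> nat}) (Y : nat -> {RV P >-> nat}).
Hypothesis HZ : bpire_data Q N Y.
Variables (mu sigma : R).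
Hypothesis sigma_gt0 : 0 < sigma.
Let xi w := log_mean (Q 0%N w).
Hypothesis xi_int : P.-integrable setT (EFin \o xi).
Hypothesis xi_mean : (\int[P]_w (xi w)%:E = mu%:E)%E.
Hypothesis xi_var : (\int[P]_w ((xi w - mu) ^+ 2)%:E = (sigma ^+ 2)%:E)%E.

Lemma walk_clt (x : R) :
  pr P [set w | (walk Q 0 n w - n%:R * mu) / (Num.sqrt n%:R * sigma) <= x]
    @[n --> \oo] --> Phi x.
Proof.
pose h (q : Delta R) : R := (log_mean q - mu) / sigma.
have mh : measurable_fun setT h.
  apply: measurable_funM => //; apply: measurable_funB => //.
  exact: measurable_log_mean.
pose X n w := h (Q n w).
have mX n : measurable_fun setT (X n) by exact: measurableT_comp.
pose S n w := \sum_(i < n) X i w.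
have SE n w : (walk Q 0 n w - n%:R * mu) / (Num.sqrt n%:R * sigma) = S n w / Num.sqrt n%:R.
  rewrite /S /X /h /walk -mulr_suml big_split/= sumr_const card_ord.
  by rewrite invfM mulNrn mulr_natl; ring.
under eq_fun do under eq_set do rewrite SE.
apply: (@clt _ _ _ P X) => //.
- move=> n A mA; have [_ idl] := environment_iid HZ.
  have mB : measurable (h @^-1` A) by rewrite -[X in measurable X]setTI; exact: mh.
  exact: idl n _ mB.
- move=> n A B mA mB.
  apply: (@pi_indep _ _ _ P (environment_past Q n)
    (preimage_set_system setT (Q n) measurable)).
  + exact: environment_past_measurable.
  + exact: preimage_system_measurable.
  + exact: environment_past_setI.
  + exact: preimage_system_setI.
  + exact: environment_past_indep HZ n.
  + have mS : measurable_fun [set: g_sigma_algebraType (environment_past Q n)] (S n).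
      apply: measurable_sum => i; apply: (measurableT_comp mh).
      exact: environment_past_fun.
    by have := mS measurableT A mA; rewrite setTI.
  + have := measurableT_comp mh (@preimage_system_fun _ _ _ (Q n)).
    by move=> /(_ measurableT B mB); rewrite setTI.
- have -> : (\int[P]_w (X 0%N w)%:E = \int[P]_w (((xi w)%:E - mu%:E) * sigma^-1%:E))%E.
    by apply: eq_integral => w _; rewrite -EFinB -EFinM.
  rewrite integralZr//; last by apply: integrableB => //; exact: finite_measure_integrable_cst.
  rewrite integralB//; last exact: finite_measure_integrable_cst.
  by rewrite xi_mean integral_cst//= probability_setT mule1 subee// mul0e.
- have -> : (\int[P]_w (X 0%N w ^+ 2)%:E = \int[P]_w (((xi w - mu) ^+ 2)%:E * ((sigma ^+ 2)^-1)%:E))%E.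
    by apply: eq_integral => w _; rewrite -EFinM /X /h expr_div_n.
  rewrite ge0_integralZr//.
  + by rewrite xi_var -EFinM divff// expf_neq0// gt_eqF.
  + apply/measurable_EFinP; apply: measurable_funX; apply: measurable_funB => //.
    exact: (measurableT_comp (@measurable_log_mean R)).
  + by move=> w _; rewrite lee_fin sqr_ge0.
  + by rewrite lee_fin invr_ge0 sqr_ge0.
Qed.

End walk_clt.

(** * Transfer of the limit law from the walk to the population *)

Section perturbation.
Context d (T : measurableType d) (R : realType) (P : probability T R).

(** Slutsky's lemma combined with the removal of the conditioning: the exceptional events [D]
    collect both a large distance between [V] and [W] and the failure of [B], so the probability of
    [B] tends to one as well. *)
Lemma cprob_perturbation (V W : nat -> T -> R) (B : nat -> set T) (F : R -> R) (x : R) :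
  (forall n, measurable_fun setT (V n)) -> (forall n, measurable_fun setT (W n)) ->
  (forall n, measurable (B n)) ->
  (forall y, pr P [set w | W n w <= y] @[n --> \oo] --> F y) ->
  F y @[y --> x] --> F x ->
  (forall e, 0 < e -> exists2 D : nat -> set T,
    (forall n, measurable (D n)) /\ pr P (D n) @[n --> \oo] --> (0 : R) &
    \forall n \near \oo, forall w, D n w \/ (B n w /\ `|V n w - W n w| <= e)) ->
  cprob P [set w | V n w <= x] (B n) @[n --> \oo] --> F x.
Proof.
move=> mV mW mB WF Fx near_VW.
have mle (U : T -> R) y : measurable_fun setT U -> measurable [set w | U w <= y].
  move=> mU; rewrite (_ : [set w | _] = U @^-1` `]-oo, y]); last first.
    by apply/seteqP; split => w; rewrite /= in_itv.
  by rewrite -[X in measurable X]setTI; exact: mU.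
have mVB n : measurable ([set w | V n w <= x] `&` B n) by apply: measurableI => //; exact: mle.
have B1 : pr P (B n) @[n --> \oo] --> (1 : R).
  apply/cvgrPdist_le => e e0; have [D [mD D0] DB] := near_VW 1 ltr01.
  move/cvgrPdist_le : D0 => /(_ e e0) D0; apply: filterS2 DB D0 => n hB hD.
  have h : pr P setT <= pr P (B n) + pr P (D n).
    apply: pr_cover => // w _; have [|[]] := hB w; first by right.
    by left.
  rewrite sub0r normrN (ger0_norm (pr_ge0 _ _)) in hD.
  rewrite /pr probability_setT/= -!/(pr _ _) in h.
  by rewrite ger0_norm ?subr_ge0 ?pr_le1//; lra.
rewrite -[F x]mulr1 -[X in F x * X]invr1.
apply: cvgM; last by apply: cvgV => //; exact: oner_neq0.
apply/cvgrPdist_le => e e0.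
have e3 : 0 < e / 3 by rewrite divr_gt0.
move/cvgrPdist_le : Fx => /(_ _ e3) /nbhs_ballP[r /= r0 Fr].
have r2 : 0 < r / 2 by rewrite divr_gt0.
have Fball y : `|x - y| <= r / 2 -> `|F x - F y| <= e / 3.
  by move=> xy; apply: Fr; rewrite /ball/=; lra.
have {Fr}Fp : `|F x - F (x + r / 2)| <= e / 3 by apply: Fball; rewrite opprD addNKr normrN gtr0_norm.
have {Fball}Fm : `|F x - F (x - r / 2)| <= e / 3 by apply: Fball; rewrite opprB addrC subrK gtr0_norm.
have [D [mD D0] DB] := near_VW _ r2.
move/cvgrPdist_le : D0 => /(_ _ e3) D0.
have /cvgrPdist_le/(_ _ e3) Wp := WF (x + r / 2).
have /cvgrPdist_le/(_ _ e3) Wm := WF (x - r / 2).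
apply: filterS2 (filterI DB D0) (filterI Wp Wm) => n [hB hD] [hp hm].
rewrite sub0r normrN (ger0_norm (pr_ge0 _ _)) in hD.
have up : pr P ([set w | V n w <= x] `&` B n) <=
    pr P [set w | W n w <= x + r / 2] + pr P (D n).
  apply: pr_cover => //; first exact: mle.
  move=> w [/= Vx _]; have [|[_ VW]] := hB w; [by right|left].
  by move: VW; rewrite ler_norml => /andP[]/=; lra.
have low : pr P [set w | W n w <= x - r / 2] <=
    pr P ([set w | V n w <= x] `&` B n) + pr P (D n).
  apply: pr_cover => //; first exact: mle.
  move=> w /= Wx; have [|[Bw VW]] := hB w; [by right|left; split => //=].
  by move: VW; rewrite ler_norml => /andP[]; lra.
move: Fp Fm hp hm up low hD; rewrite /pr !ler_norml; lra.
Qed.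

End perturbation.

Section log_flow_clt.
Context d (T : measurableType d) (R : realType) (P : probability T R).
Variables (Q : nat -> {RV P >-> Delta R}).
Variables (N : nat -> nat -> {RV P >-> nat}) (Y : nat -> {RV P >-> nat}).
Variables (mu sigma th C : R) (k : nat).
Hypothesis sigma_gt0 : 0 < sigma.
Hypothesis th_gt0 : 0 < th.
Let flowR n w : R := (flow N Y 0 k n w)%:R.
Hypothesis lower : forall (u : nat -> R) (e : R), u n @[n --> \oo] --> +oo -> 0 < e ->
  \forall n \near \oo, pr P [set w | flowR n w < expR (walk Q 0 n w - u n)] <= e.
Hypothesis upper : forall n u,
  pr P [set w | expR u <= flowR n w * expR (- walk Q 0 n w)] <= C * expR (- (th * u)).
Hypothesis walk_limit : forall x,
  pr P [set w | (walk Q 0 n w - n%:R * mu) / (Num.sqrt n%:R * sigma) <= x]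
    @[n --> \oo] --> Phi x.

Let mwalk n : measurable_fun setT (walk Q 0 n).
Proof. exact: past_measurable (@measurable_walk _ _ _ _ Q N Y 0 n). Qed.

Let mflow n : measurable_fun setT (flow N Y 0 k n).
Proof.
apply: (@past_measurable _ _ _ _ Q N Y (0 + n)%N).
apply: (@measurable_flow _ _ _ _ Q N Y _ 0 k n) => n1 n2 n12.
exact: (@past_system_particle _ _ _ _ Q N Y _ _ 0%N n12).
Qed.

Let mflowR n : measurable_fun setT (flowR n).
Proof. exact: (@measurableT_comp _ _ _ _ _ _ (fun n : nat => n%:R : R)). Qed.

Let scale_cvg (c : R) : 0 < c -> c * Num.sqrt n%:R @[n --> \oo] --> +oo.
Proof.
move=> c0; apply/cvgryPge => M; near=> n.
have [M0|M0] := leP M 0; first by rewrite (le_trans M0)// mulr_ge0// ltW.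
rewrite -ler_pdivrMl// -[leLHS]ger0_norm; last by rewrite mulr_ge0 ?invr_ge0 ?ltW.
rewrite -sqrtr_sqr ler_wsqrtr//; near: n; exact: nbhs_infty_ger.
Unshelve. all: by end_near. Qed.

Let upper_cvg (c : R) : 0 < c ->
  C * expR (- (th * (c * Num.sqrt n%:R))) @[n --> \oo] --> 0.
Proof.
move=> c0; rewrite -[0 in X in _ --> X](mulr0 C); apply: cvgMr.
apply: (cvg_comp _ (fun y => expR (- y)) _ (@cvgr_expR R)).
under eq_fun do rewrite mulrA.
by apply: scale_cvg; rewrite mulr_gt0.
Qed.

(** Conditioning on survival also settles the value of [ln] at zero, which does not enter: outside
    the exceptional events the population is positive. *)
Lemma log_flow_clt x :
  cprob P [set w | (ln (flowR n w) - n%:R * mu) / (Num.sqrt n%:R * sigma) <= x]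
    [set w | (0 < flow N Y 0 k n w)%N] @[n --> \oo] --> Phi x.
Proof.
apply: (@cprob_perturbation _ _ _ _
  (fun n w => (ln (flowR n w) - n%:R * mu) / (Num.sqrt n%:R * sigma))
  (fun n w => (walk Q 0 n w - n%:R * mu) / (Num.sqrt n%:R * sigma))
  (fun n => [set w | (0 < flow N Y 0 k n w)%N]) (@Phi R) x) => //.
- move=> n; apply: measurable_funM => //; apply: measurable_funB => //.
  exact: (measurableT_comp (@measurable_ln R)).
- by move=> n; apply: measurable_funM => //; exact: measurable_funB.
- by move=> n; have /(_ measurableT [set z | (0 < z)%N]) := mflow n; rewrite setTI; exact.
- by apply: differentiable_continuous; apply/derivable1_diffP; have [] := is_derive_Phi x.
(* An error [e] after normalization is an error [e * sigma * sqrt n] on the logarithm; this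
   diverges, as the lower and upper bounds require. *)
move=> e e0; pose u n : R := e * sigma * Num.sqrt n%:R.
have es : 0 < e * sigma by rewrite mulr_gt0.
pose D1 n := [set w | flowR n w < expR (walk Q 0 n w - u n)].
pose D2 n := [set w | expR (u n) <= flowR n w * expR (- walk Q 0 n w)].
have mD1 n : measurable (D1 n).
  rewrite (_ : D1 n = ~` ([set: T] `&` [set w | expR (walk Q 0 n w - u n) <= flowR n w])).
    apply: measurableC; apply: measurable_fun_le => //.
    apply: (measurableT_comp (@measurable_expR R)); exact: measurable_funB.
  by rewrite setTI; apply/seteqP; split => w; rewrite /D1 /= ltNge => /negP.
have mD2 n : measurable (D2 n).
  rewrite -[D2 n]setTI; apply: measurable_fun_le => //.
  apply: measurable_funM => //; apply: (measurableT_comp (@measurable_expR R)).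
  exact: measurable_funN.
exists (fun n => D1 n `|` D2 n); first split.
- by move=> n; exact: measurableU.
- apply/cvgrPdist_le => r r0; have r2 : 0 < r / 2 by rewrite divr_gt0.
  have h1 := lower (scale_cvg es) r2.
  have /cvgrPdist_le/(_ _ r2) h2 := upper_cvg es.
  apply: filterS2 h1 h2 => n h1; rewrite !sub0r !normrN => h2.
  rewrite ger0_norm ?pr_ge0// (le_trans (prU_le P (mD1 n) (mD2 n)))//.
  have := upper n (u n); have := ler_norm (C * expR (- (th * (e * sigma * Num.sqrt n%:R)))).
  move: h1 h2; rewrite -/(D1 n) -/(D2 n) -/(u n); lra.
near=> n => w.
have n0 : 0 < Num.sqrt n%:R :> R.
  by rewrite sqrtr_gt0 ltr0n; near: n; exact: nbhs_infty_gt.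
have [|nD1] := pselect (D1 n w); first by left; left.
have [|nD2] := pselect (D2 n w); first by left; right.
right.
have fl : expR (walk Q 0 n w - u n) <= flowR n w by rewrite leNgt; exact/negP.
have fu : flowR n w * expR (- walk Q 0 n w) < expR (u n) by rewrite ltNge; exact/negP.
have f0 : 0 < flowR n w by exact: lt_le_trans (expR_gt0 _) fl.
split; first by move: f0; rewrite /flowR ltr0n.
rewrite -mulrBl opprB addrA subrK normrM [X in _ * X]gtr0_norm; last first.
  by rewrite invr_gt0 mulr_gt0.
rewrite ler_pdivrMr ?mulr_gt0// mulrA mulrAC -/(u n).
have h1 : walk Q 0 n w - u n <= ln (flowR n w) by rewrite -ler_expR lnK.
have h2 : ln (flowR n w) <= walk Q 0 n w + u n.
  rewrite -ler_expR lnK// addrC expRD -ler_pdivrMr ?expR_gt0// -expRN.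
  exact: ltW.
by rewrite ler_norml; apply/andP; split; lra.
Unshelve. all: by end_near. Qed.

End log_flow_clt.

Lemma powR_le1D (R : realType) (x a b : R) : 0 <= x -> 0 <= a <= b ->
  x `^ a <= 1 + x `^ b.
Proof.
move=> x0 /andP[a0 ab]; have [x1|/ltW x1] := leP x 1.
  have : x `^ a <= 1 `^ a by apply: ge0_ler_powR; rewrite ?nnegrE.
  by rewrite powR1; have := powR_ge0 x b; lra.
by have := ler_powR x1 ab; lra.
Qed.

(** * The Laplace transform of a variable bounded below *)

Section ae_integral.
Context d (T : measurableType d) (R : realType) (P : probability T R).

Lemma ae_le_integral_EFin (f g : T -> R) :
  measurable_fun setT f -> measurable_fun setT g ->
  (forall w, 0 <= f w) -> (forall w, 0 <= g w) ->
  {ae P, forall w, f w <= g w} -> (\int[P]_w (f w)%:E <= \int[P]_w (g w)%:E)%E.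
Proof.
move=> mf mg f0 g0 fg; apply: ae_ge0_le_integral => //; [|exact/measurable_EFinP| |exact/measurable_EFinP|].
- by move=> w _; rewrite lee_fin.
- by move=> w _; rewrite lee_fin.
- by apply: filterS fg => w fgw _; rewrite lee_fin.
Qed.

Lemma integral_affine_pow (f : T -> R) (p a b : R) : measurable_fun setT f ->
  (forall w, 0 <= f w) -> 0 <= a -> 0 <= b ->
  (\int[P]_w (f w `^ p)%:E < +oo ->
   \int[P]_w (a + b * f w `^ p)%:E < +oo)%E.
Proof.
move=> mf f0 a0 b0 fp.
have mfp : measurable_fun setT (fun w => f w `^ p).
  exact: (measurableT_comp (measurable_powR _)).
rewrite integral_EFinD//.
- rewrite integral_cst//= probability_setT mule1.
  under eq_integral do rewrite EFinM.
  rewrite ge0_integralZl//; [|exact/measurable_EFinP|by move=> w _; rewrite lee_fin powR_ge0].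
  by apply: lte_add_pinfty; [exact: ltry|exact: lte_mul_pinfty].
- exact: measurable_funM.
- by move=> w; rewrite mulr_ge0// powR_ge0.
Qed.

Variables (X : T -> R) (b mu M2 : R).
Hypothesis mX : measurable_fun setT X.
Hypothesis iX : P.-integrable setT (EFin \o X).
Hypothesis EX : (\int[P]_w (X w)%:E = mu%:E)%E.
Hypothesis EX2 : (\int[P]_w (X w ^+ 2)%:E = M2%:E)%E.
Hypothesis b0 : 0 <= b.
Hypothesis X_ge : {ae P, forall w, - b <= X w}.

Let mexp t : measurable_fun setT (fun w => expR (- (t * X w))).
Proof.
apply: (measurableT_comp (@measurable_expR R)); apply: measurable_funN.
exact: measurable_funM.
Qed.

Lemma laplace_fin (t : R) : 0 <= t ->
  (\int[P]_w (expR (- (t * X w)))%:E)%E = (\int[P]_w expR (- (t * X w)))%:E.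
Proof.
move=> t0; rewrite /Rintegral fineK// ge0_fin_numE; last first.
  by apply: integral_ge0 => w _; rewrite lee_fin expR_ge0.
apply: (@le_lt_trans _ _ (\int[P]_w (expR (t * b))%:E)%E).
  apply: ae_le_integral_EFin => //.
  - apply: filterS X_ge => w Xb; rewrite ler_expR -mulrN ler_wpM2l//; lra.
by rewrite integral_cst//= probability_setT mule1 ltry.
Qed.

Lemma laplace_le (t : R) : 0 <= t <= 1 ->
  \int[P]_w expR (- (t * X w)) <= 1 - t * mu + expR b * t ^+ 2 * M2.
Proof.
move=> /andP[t0 t1]; rewrite -lee_fin -laplace_fin//.
have iX2 : P.-integrable setT (fun w => (X w ^+ 2)%:E).
  apply/integrableP; split; first by apply/measurable_EFinP; exact: measurable_funX.
  under eq_integral do rewrite gee0_abs ?lee_fin ?sqr_ge0//.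
  by rewrite EX2 ltry.
have X2mE : \int[P]_w (X w ^+ 2) = M2 by rewrite /Rintegral EX2.
have XmE : \int[P]_w X w = mu by rewrite /Rintegral EX.
have i1 : P.-integrable setT (EFin \o (fun w => 1 - t * X w)).
  exact: (integrableRB (integrableR_cst P 1) (integrableZl measurableT t iX)).
have i2 := integrableZl measurableT (expR b * t ^+ 2) iX2.
have -> : (1 - t * mu + expR b * t ^+ 2 * M2)%:E =
    (\int[P]_w (1 - t * X w + expR b * t ^+ 2 * X w ^+ 2)%:E)%E.
  rewrite -X2mE -XmE.
  rewrite -[X in X%:E](_ : \int[P]_w (1 - t * X w) + \int[P]_w (expR b * t ^+ 2 * X w ^+ 2) = _); last first.
    rewrite RintegralZl// RintegralB//; last 2 first.
    - exact: integrableR_cst.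
    - exact: (integrableZl measurableT t iX).
    by rewrite RintegralZl// Rintegral_cst//= probability_setT mulr1.
  rewrite -RintegralD// /Rintegral fineK//.
  by apply: integrable_fin_num => //; exact: integrableRD.
apply: ae_le_integral_EFin.
- exact: mexp.
- apply: measurable_funD; first by apply: measurable_funB => //; exact: measurable_funM.
  by apply: measurable_funM => //; exact: measurable_funX.
- by move=> w; exact: expR_ge0.
- move=> w; have e1 : 1 <= expR b by rewrite -expR0 ler_expR.
  rewrite -mulrA -exprMn; set y := t * X w.
  have : 0 <= (expR b - 1) * y ^+ 2 by rewrite mulr_ge0 ?sqr_ge0// subr_ge0.
  by nra.
- apply: filterS X_ge => w Xb; rewrite -mulrA -exprMn; apply: expRN_le2 => //.
  have [X0|/ltW X0] := leP 0 (X w).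
    by rewrite (le_trans _ (mulr_ge0 t0 X0))// oppr_le0.
  by rewrite (le_trans Xb)// ler_niMl.
Qed.


(** Near zero the Laplace transform decreases with slope [- mu], so a small positive argument brings
    it below one. *)
Lemma laplace_lt1 (s : R) : 0 < mu -> 0 < s <= 1 -> exists th : R, [/\ 0 < th <= s,
  0 <= \int[P]_w expR (- (th * X w)) &
  \int[P]_w expR (- (th * X w)) < 1].
Proof.
move=> mu0 /andP[s0 s1].
have M0 : 0 <= M2.
  by rewrite -lee_fin -EX2; apply: integral_ge0 => w _; rewrite lee_fin sqr_ge0.
have D0 : 0 < 2 * (expR b * (M2 + 1)) by rewrite !mulr_gt0 ?expR_gt0//; lra.
(* Up to [t0] the quadratic term of [laplace_le] is at most half of [th * mu]; [M2 + 1] keeps the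
   denominator positive. *)
pose t0 := mu / (2 * (expR b * (M2 + 1))).
have t00 : 0 < t0 by rewrite divr_gt0.
pose th := Num.min s t0.
have th0 : 0 < th by rewrite lt_min s0.
have ths : th <= s by rewrite ge_min lexx.
have tht : th <= t0 by rewrite ge_min lexx orbT.
exists th; split; first by rewrite th0.
  by apply: Rintegral_ge0 => w _; exact: expR_ge0.
apply: (@le_lt_trans _ _ (1 - th * mu + expR b * th ^+ 2 * M2)).
  by apply: laplace_le; rewrite (ltW th0) (le_trans ths s1).
have h : th * (2 * (expR b * (M2 + 1))) <= mu by rewrite -ler_pdivlMr.
have e0 := expR_gt0 b.
suff : expR b * th ^+ 2 * M2 < th * mu by lra.
have -> : expR b * th ^+ 2 * M2 = th * (th * (expR b * M2)) by ring.
rewrite ltr_pM2l//; apply: lt_le_trans h; rewrite ltr_pM2l//.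
have : 0 <= expR b * M2 by rewrite mulr_ge0// ltW.
by lra.
Qed.

End ae_integral.

(** * Consequences of non-degeneracy *)

Section immigration.
Context d (T : measurableType d) (R : realType) (P : probability T R).
Variables (Q : nat -> {RV P >-> Delta R}).
Variables (N : nat -> nat -> {RV P >-> nat}) (Y : nat -> {RV P >-> nat}).
Hypothesis HZ : bpire_data Q N Y.

(** The probability of no immigrant is the mean of the mass at zero; if it were one, this mass would
    be one almost surely. *)
Lemma immigration_pos : (0 < P [set w | (immigration Q 0 w [set 0%N] < 1)%E])%E ->
  0 < pr P (Y 0 @^-1` [set z | (0 < z)%N]).
Proof.
move=> g_lt1; pose g w := immigration Q 0 w [set 0%N].
have mg : measurable_fun setT g by exact: (measurableT_comp (measurable_particle_law 0 [set 0%N]) (measurable_funP (Q 0%N))).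
have g1 w : (g w <= 1)%E by exact: probability_le1.
have gfin w : g w \is a fin_num by rewrite fin_num_measure.
have mY B : measurable (Y 0%N @^-1` B).
  by rewrite -[X in measurable X]setTI; exact: (measurable_funP (Y 0%N)).
have EY : (\int[P]_w g w = P (Y 0 @^-1` [set 0%N]))%E.
  have := @particle_integral1 _ _ _ _ Q N Y HZ (fun _ _ => False) 0 0 0 (cst 1%E).
  move=> /(_ (fun h => h) (measurable_cst _) (fun _ => lee01)) h.
  under eq_integral do rewrite -[g _]mul1e.
  rewrite -[LHS]h; under eq_integral do rewrite /= mul1e.
  by rewrite integral_indic// setIT.
have E1 : (\int[P]_w g w + \int[P]_w (1 - g w) = 1)%E.
  rewrite -ge0_integralD//.
  - under eq_integral do rewrite addeC subeK//.
    by rewrite integral_cst//= probability_setT mule1.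
  - by move=> w _; rewrite suber_ge0 ?gfin ?g1.
  - exact: emeasurable_funB.
rewrite lt_neqAle pr_ge0 andbT eq_sym; apply/negP => /eqP h0.
pose Y0 := Y 0%N @^-1` [set 0%N]; pose Y1 := Y 0%N @^-1` [set z | (0 < z)%N].
have YT : [set: T] = Y0 `|` Y1.
  by apply/seteqP; split => // w _; rewrite /Y0 /Y1 /=; case: (Y 0%N w) => [|z]; [left|right].
have Y01 : Y0 `&` Y1 = set0.
  by apply/seteqP; split => // w []; rewrite /Y0 /Y1 /= => ->.
have P1 : (P Y0 = 1)%E.
  transitivity (P [set: T]); last exact: probability_setT.
  rewrite YT measureU//; [|exact: mY|exact: mY].
  by rewrite [X in (_ + X)%E]prE ?h0 ?adde0//; exact: mY.
have E0 : (\int[P]_w (1 - g w) = 0)%E.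
  move: E1; rewrite EY -/Y0 P1; case: (\int[P]_w _)%E => [r| |]//.
  by rewrite -EFinD => -[] /eqP; rewrite -[X in _ == X]addr0 => /eqP/addrI ->.
have h : ae_eq P setT (fun w => 1 - g w)%E (cst 0%E).
  apply/(ae_eq_integral_abs P measurableT); first exact: emeasurable_funB.
  rewrite -[RHS]E0; apply: eq_integral => w _.
  by rewrite gee0_abs// suber_ge0 ?gfin ?g1.
have mlt : measurable [set w | (g w < 1)%E].
  rewrite -[X in measurable X]setTI; apply: measurable_lte => //.
have : P.-negligible [set w | (g w < 1)%E].
  apply: negligibleS h => w /= gw1 /(_ I) gw; move: gw1; rewrite ltNge => /negP; apply.
  by rewrite -sube_le0 gw.
by move=> /(negligibleP P mlt) P0; move: g_lt1; rewrite [X in (_ < X)%E]P0 ltxx.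
Qed.

(** Otherwise the offspring laws would almost surely live on [0] and [1], so that [log m_1 <= 0],
    contradicting [mu > 0]. *)
Lemma offspring_pos mu : {ae P, forall w, (0 < law_mean (offspring Q 0 w) < +oo)%E} ->
  (\int[P]_w (log_mean (Q 0%N w))%:E = mu%:E)%E -> 0 < mu ->
  exists2 b, (1 < b)%N & (0 < P [set w | (0 < (Q 0%N w).1 [set b])%E])%E.
Proof.
move=> mean_ae Emu mu0; apply: contrapT => none.
have mf b : measurable_fun setT (fun w => (Q 0%N w).1 [set b]).
  exact: (measurableT_comp (measurable_particle_law 1 [set b]) (measurable_funP (Q 0%N))).
have f0 : {ae P, forall w, forall b, (1 < b)%N -> (Q 0%N w).1 [set b] = 0%E}.
  apply: ae_foralln => b; have [b1|b1] := leqP b 1; first by apply: aeW.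
  exists [set w | (0 < (Q 0%N w).1 [set b])%E]; split.
  - by rewrite -[X in measurable X]setTI; exact: measurable_lte.
  - apply/eqP; rewrite eq_le measure_ge0 andbT leNgt; apply/negP => h; apply: none.
    by exists b.
  - move=> w /=; rewrite lt0e => h; rewrite measure_ge0 andbT; apply/eqP => h2; apply: h => _//.
have xi_le0 : {ae P, forall w, log_mean (Q 0%N w) <= 0}.
  apply: filterS2 f0 (law_mean_ae HZ mean_ae 0) => w f0w /= E.
  have := law_mean_le1 f0w; rewrite -/(offspring Q 0 w) E lee_fin -[X in _ <= X]expR0 ler_expR; exact.
have : (\int[P]_w (log_mean (Q 0%N w))%:E <= 0)%E.
  rewrite integralE [X in (X - _)%E](_ : _ = 0%E).
    by rewrite sub0e oppe_le0; apply: integral_ge0.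
  rewrite -(@integral0 _ _ _ P setT); apply: ge0_ae_eq_integral => //.
    apply: measurable_funepos; apply/measurable_EFinP.
    exact: (measurableT_comp (@measurable_log_mean R) (measurable_funP (Q 0%N))).
  by apply: filterS xi_le0 => w h _; rewrite funeposE /= max_r // lee_fin.
by rewrite Emu lee_fin leNgt mu0.
Qed.

End immigration.

Theorem theorem4p1 (d : measure_display) (T : measurableType d) (R : realType)
  (P : probability T R)
  (Q : nat -> {RV P >-> Delta R})
  (N : nat -> nat -> {RV P >-> nat}) (Y : nat -> {RV P >-> nat})
  (HZ : bpire_data Q N Y)
  (Hm1 : {ae P, forall w, (0 < law_mean (offspring Q 0 w) < +oo)%E})
  (mu : R)
  (Hmu : 'E_P[fun w => ln (m1 Q w)]%E = mu%:E) (mu_gt0 : 0 < mu)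
  (Himm : (0 < P [set w | (immigration Q 0 w [set 0%N] < 1)%E])%E)
  (HA : (0 < P [set w | [/\ (0 < immigration Q 0 w [set 0%N])%E,
                            (0 < offspring Q 0 w [set 0%N])%E &
                            (0 < offspring Q 0 w [set 1%N])%E]])%E)
  (HB : exists delta : R, [/\ 0 < delta, delta < 1 &
          {ae P, forall w, (offspring Q 0 w [set 0%N] < delta%:E)%E}])
  (HC : exists q p : R, [/\ 1 < q, 1 < p <= 2,
          ('E_P[fun w => ((1 + `|ln (m1 Q w)| `^ q) *
                          (((N 0%N 0%N w)%:R / m1 Q w) `^ p + 1))%R] < +oo)%E &
          ('E_P[fun w => ((Y 0%N w)%:R `^ p)%R] < +oo)%E])
  (Hlog2 : ('E_P[fun w => (ln (m1 Q w) ^+ 2)%R] < +oo)%E)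
  (sigma : R) (Hsigma : 'V_P[fun w => ln (m1 Q w)]%E = (sigma ^+ 2)%:E)
  (sigma_gt0 : 0 < sigma) :
  forall (k : nat) (x : R), (1 <= k)%N ->
    cprob P [set w | (ln (Z N Y k n w)%:R - n%:R * mu) / (Num.sqrt n%:R * sigma) <= x]
            [set w | (0 < Z N Y k n w)%N] @[n --> \oo] --> Phi x.
Proof.
move=> k x _.
pose xi w := log_mean (Q 0%N w).
have mxi : measurable_fun setT xi.
  exact: (measurableT_comp (@measurable_log_mean R) (measurable_funP (Q 0%N))).
have [delta [delta0 delta1 f0_lt]] := HB.
have [q [p [q1 /andP[p1 p2] N_moment Y_moment]]] := HC.
have mean_exp := law_mean_ae HZ Hm1 0.
rewrite unlock in Hmu Hlog2 N_moment Y_moment.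
have xi_mean : (\int[P]_w (xi w)%:E = mu%:E)%E := Hmu.
have [M2 xi2E] : exists M2, (\int[P]_w (xi w ^+ 2)%:E = M2%:E)%E.
  exists (fine (\int[P]_w (xi w ^+ 2)%:E)); rewrite fineK// ge0_fin_numE//.
  by apply: integral_ge0 => w _; rewrite lee_fin sqr_ge0.
have xi_int : P.-integrable setT (EFin \o xi).
  apply/integrableP; split; first exact/measurable_EFinP.
  apply: (@le_lt_trans _ _ (\int[P]_w (1 + 1 * `|xi w| `^ 2)%:E)%E).
    apply: ae_le_integral_EFin => //.
    - exact: measurableT_comp.
    - apply: measurable_funD => //; apply: measurable_funM => //.
      apply: (measurableT_comp (measurable_powR _)); exact: measurableT_comp.
    - apply: aeW => w; rewrite mul1r -[X in X <= _]powRr1//.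
      by apply: powR_le1D => //; apply/andP; split => //; lra.
  apply: integral_affine_pow => //; first exact: measurableT_comp.
  under eq_integral do rewrite powR_mulrn// real_normK ?num_real//.
  by rewrite xi2E ltry.
have xi_var : (\int[P]_w ((xi w - mu) ^+ 2)%:E = (sigma ^+ 2)%:E)%E.
  rewrite -Hsigma /variance unlock unlock.
  by apply: eq_integral => w _; rewrite Hmu expr2.
(* [m_1 >= 1 - f({0}) > 1 - delta] almost surely, which bounds [log m_1] below by [- b]. *)
pose b := - ln (1 - delta).
have b0 : 0 <= b by rewrite oppr_ge0 ln_le0// lerBlDr lerDl ltW.
have xi_ge : {ae P, forall w, - b <= xi w}.
  apply: filterS2 f0_lt mean_exp => w f0 E; rewrite opprK -ler_expR lnK ?posrE ?subr_gt0//.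
  rewrite -lee_fin -E EFinB leeBlDr//.
  by apply: (le_trans (law_mean_ge (offspring Q 0 w))); rewrite leeD2l// ltW.
(* The two caps on [th]: [1] for the concavity of the power, [p - 1] so that the offspring moment of
   order [1 + th] is finite. *)
have s01 : 0 < Num.min 1 (p - 1) <= 1.
  by rewrite lt_min ltr01 subr_gt0 p1 ge_min lexx.
have [th [/andP[th0 ths] rho0 rho1]] := laplace_lt1 mxi xi_int xi_mean xi2E b0 xi_ge mu_gt0 s01.
have th1 : th <= 1 by rewrite (le_trans ths)// ge_min lexx.
have thp : 1 + th <= p by rewrite addrC -lerBrDr (le_trans ths)// ge_min lexx orbT.
have th01 : 0 < th <= 1 by rewrite th0.
have rho01 : 0 <= \int[P]_w expR (- (th * xi w)) < 1 by rewrite rho0.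
have rhoE := laplace_fin mxi xi_ge (ltW th0).
have rho2E : (\int[P]_w (expR (- ((1 + th) * xi w)))%:E)%E =
    (\int[P]_w expR (- ((1 + th) * xi w)))%:E.
  by apply: (laplace_fin mxi xi_ge); rewrite addr_ge0// ltW.
have mexp : measurable_fun setT (fun w => expR (- xi w)).
  by apply: (measurableT_comp (@measurable_expR R)); exact: measurable_funN.
have mnat (V : {RV P >-> nat}) : measurable_fun setT (fun w => (V w)%:R : R).
  exact: (@measurableT_comp _ _ _ _ _ _ (fun n : nat => n%:R : R)).
have [c c_moment] : exists c, (\int[P]_w
    (`|(N 0%N 0%N w)%:R * expR (- xi w) - 1| `^ (1 + th))%:E <= c%:E)%E.
  set I := (\int[P]_w _)%E.
  suff If : I \is a fin_num by exists (fine I); rewrite fineK.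
  rewrite ge0_fin_numE; last by apply: integral_ge0 => w _; rewrite lee_fin powR_ge0.
  (* With [y] the normalized offspring number, [|y - 1| ^ (1 + th) <= 2 + y ^ p]. The assumed
     integrand is at least [y ^ p + 1], and the added [1] covers the rest. *)
  apply: (@le_lt_trans _ _ (1 + \int[P]_w ((1 + `|ln (m1 Q w)| `^ q) *
      (((N 0%N 0%N w)%:R / m1 Q w) `^ p + 1))%:E)%E); last first.
    exact: lte_add_pinfty (ltry _) N_moment.
  have mlaw : measurable_fun setT (fun w => law_mean (offspring Q 0 w)).
    exact: (measurableT_comp (@measurable_law_mean R) (measurable_funP (Q 0%N))).
  have mm : measurable_fun setT (m1 Q) by exact: measurableT_comp mlaw.
  have m1_ge0 w : 0 <= m1 Q w.
    by apply: fine_ge0; apply: nneseries_ge0 => j _ _; rewrite mule_ge0// lee_fin.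
  pose G w := (1 + `|ln (m1 Q w)| `^ q) * (((N 0%N 0%N w)%:R / m1 Q w) `^ p + 1).
  have G0 w : 0 <= G w by rewrite mulr_ge0// addr_ge0 ?powR_ge0.
  have mG : measurable_fun setT G.
    apply: measurable_funM; apply: measurable_funD => //; apply: (measurableT_comp (measurable_powR _)).
      by apply: measurableT_comp => //; exact: (measurableT_comp (@measurable_ln R)).
    apply: measurable_funM => //.
    under eq_fun do rewrite -powR_inv1 ?m1_ge0//.
    exact: (measurableT_comp (measurable_powR _)).
  rewrite [X in (X + _)%E](_ : _ = \int[P]_w (1 : R)%:E)%E; last first.
    by rewrite integral_cst//= probability_setT mule1.
  rewrite -integral_EFinD//; apply: ae_le_integral_EFin => //.
  - apply: (measurableT_comp (measurable_powR _)); apply: measurableT_comp => //.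
    by apply: measurable_funB => //; exact: measurable_funM.
  - exact: measurable_funD.
  - by move=> w; exact: addr_ge0 ler01 (G0 w).
  apply: filterS mean_exp => w E; rewrite /G.
  have -> : m1 Q w = expR (xi w) by rewrite /m1 E.
  rewrite -expRN; set y := (N 0%N 0%N w)%:R * _.
  have y0 : 0 <= y by rewrite mulr_ge0 ?expR_ge0.
  have h1 : `|y - 1| `^ (1 + th) <= 1 + `|y - 1| `^ p.
    by apply: powR_le1D => //; rewrite addr_ge0// ltW.
  have h2 : `|y - 1| `^ p <= 1 + y `^ p.
    have p0 : 0 <= p by lra.
    have [y1|y1] := leP y 1.
      have : `|y - 1| `^ p <= 1 `^ p.
        apply: ge0_ler_powR; rewrite ?nnegrE//.
        by rewrite ler0_norm ?subr_le0//; lra.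
      by rewrite powR1; have := powR_ge0 y p; lra.
    have : `|y - 1| `^ p <= y `^ p.
      apply: ge0_ler_powR; rewrite ?nnegrE//.
      by rewrite gtr0_norm ?subr_gt0//; lra.
    by lra.
  have h3 : y `^ p + 1 <= (1 + `|ln (expR (xi w))| `^ q) * (y `^ p + 1).
    by rewrite ler_peMl ?addr_ge0 ?powR_ge0// lerDl powR_ge0.
  by lra.
have [cY cY_moment] : exists cY, (\int[P]_w
    (((Y 0%N w)%:R * expR (- xi w)) `^ th)%:E <= cY%:E)%E.
  set I := (\int[P]_w _)%E.
  suff If : I \is a fin_num by exists (fine I); rewrite fineK.
  rewrite ge0_fin_numE; last by apply: integral_ge0 => w _; rewrite lee_fin powR_ge0.
  (* Almost surely [m_1^(- th) <= expR b], and the power [th] of [Y] is at most one plus its power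
     [p]. *)
  apply: (@le_lt_trans _ _ (\int[P]_w (expR b + expR b * (Y 0%N w)%:R `^ p)%:E)%E); last first.
    exact: integral_affine_pow.
  apply: ae_le_integral_EFin => //.
  - by apply: (measurableT_comp (measurable_powR _)); exact: measurable_funM.
  - apply: measurable_funD => //; apply: measurable_funM => //.
    exact: (measurableT_comp (measurable_powR _)).
  - apply: filterS xi_ge => w xib; rewrite powRM ?expR_ge0// mulrC.
    rewrite -[X in X + _]mulr1 -mulrDr; apply: ler_pM; rewrite ?powR_ge0//.
      rewrite -expRM ler_expR.
      have [X0|/ltW X0] := leP 0 (xi w).
        by rewrite (le_trans _ b0)// mulNr oppr_le0 mulr_ge0// ltW.
      by rewrite (le_trans (ler_piMr _ th1)) ?oppr_ge0// lerNl.
    by apply: powR_le1D => //; apply/andP; split; lra.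
have [B B1 B_pos] := offspring_pos HZ Hm1 xi_mean mu_gt0.
have imm_pos := immigration_pos HZ Himm.
have lower := flow_lower_prob HZ Hm1 th01 c_moment rho01 rhoE rho2E imm_pos B1 B_pos k.
have upper := flow_upper_prob HZ Hm1 th01 rho01 rhoE cY_moment k.
have ZE n : Z N Y k n = flow N Y 0 k n by apply/funext => w; exact: flow_Z.
under eq_fun do rewrite ZE.
exact: (@log_flow_clt _ _ _ _ Q N Y mu sigma th _ k sigma_gt0 th0 lower upper
  (walk_clt HZ sigma_gt0 xi_int xi_mean xi_var) x).
Qed.
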